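(* For every $u_0 \in L^1(\mathbb{R})$ there exists a unique global mild solution $u \in C([0,\infty), L^1(\mathbb{R}))$, in the sense of semigroups of nonlinear operators, of the Cauchy problem for the Fornberg-Whitham equation $$ u_t + u u_x + K * u_x = 0, \qquad u|_{t=0} = u_0, $$ where $K(x) = \frac{1}{2} e^{-|x|}$ and the convolution is in the $x$ variable.
   Context: Write $L^1 = L^1(\mathbb{R})$ (real-valued functions), and $\operatorname{sgn}(0)=0$. Nonlinear operators. A (possibly multi-valued) nonlinear operator on $L^1$ is a relation $G \subseteq L^1 \times L^1$, with $G(u) = \{v : (u,v) \in G\}$, domain $D(G) = \{u : G(u) \neq \emptyset\}$ and range $R(G) = \bigcup_{u \in D(G)} G(u)$. For $G, F \subseteq L^1\times L^1$ and $\lambda \in \mathbb{R}$: $\lambda G = \{(u,\lambda v) : (u,v) \in G\}$, $G + F = \{(u, v+w) : (u,v) \in G, (u,w) \in F\}$, $G^{-1} = \{(v,u) : (u,v) \in G\}$, composition is composition of relations, and $I$ is the identity on $L^1$. $G$ is accretive if $\|u_1 - u_2 + \lambda(v_1 - v_2)\|_{L^1} \geq \|u_1 - u_2\|_{L^1}$ for all $(u_1,v_1),(u_2,v_2) \in G$ and all $\lambda > 0$. $G$ is quasi-accretive if there is $\omega > 0$ such that for all $0 < \lambda < 1/\omega$ and all $(u_1,v_1),(u_2,v_2) \in G$ one has $\|u_1 - u_2 + \lambda(v_1 - v_2)\|_{L^1} \geq (1-\lambda\omega)\|u_1 - u_2\|_{L^1}$. An accretive $G$ is m-accretive if $R(I+G)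 = L^1$. A quasi-accretive $G$ is quasi-m-accretive if $G + \omega I$ is m-accretive for some $\omega > 0$. Semigroups. A continuous semigroup of nonlinear operators on $L^1$ is a family $(S(t))_{t \geq 0}$ of maps $S(t) : L^1 \to L^1$ with $S(0) = I$, $S(t_1+t_2) = S(t_1)\circ S(t_2)$ for all $t_1,t_2 \ge 0$, and $t \mapsto S(t)(u_0)$ continuous $[0,\infty) \to L^1$ for every $u_0 \in L^1$. It is generated by the quasi-m-accretive operator $G$ if $S(t)(u_0) = \lim_{n\to\infty} (I + \frac{t}{n}G)^{-n}(u_0)$ (limit in $L^1$) for every $u_0 \in \overline{D(G)}$. The operators $A$ and $B$. Let $A_0$ be the set of all $(u,v) \in L^1 \times L^1$ with $u^2/2 \in L^1$ and $$\int_{\mathbb{R}} \operatorname{sgn}(u(x)-\lambda)\Big( \frac{u(x)^2 - \lambda^2}{2}\,\varphi'(x) + v(x)\varphi(x)\Big)\,dx \geq 0$$ for every $\lambda \in \mathbb{R}$ and every nonnegative $\varphi \in C_c^\infty(\mathbb{R})$. Let $A$ be the closure of $A_0$ in $L^1 \times L^1$; it is the (known) generator of the solution semigroup of contractions on $L^1$ for the inviscid Burgers equation $u_t + (u^2/2)_x = 0$. Let $B : L^1 \to L^1$ be the continuous linear operator $Bu = K' * u$, where $K'(x) = -\frac12 \operatorname{sgn}(x) e^{-|x|}$. Mild solution. Suppose that $A + B$ is quasi-m-accretive and generates the continuous semigroup $(S(t))_{t\ge 0}$ on $L^1$. Then for $u_0 \in L^1$ the function $u(t) := S(t)(u_0)$,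 $t \geq 0$, is called the mild solution of the Cauchy problem. (Thus existence of the mild solution for every $u_0\in L^1$ includes the assertion that $A+B$ is quasi-m-accretive and generates such a semigroup on $L^1$.) *)

(* Defs.v *)
From HB Require Import structures.
From mathcomp Require Import all_boot all_order all_algebra.
From mathcomp Require Import all_classical all_reals all_analysis.
From mathcomp Require Import measurable_realfun lra.

Set Implicit Arguments.
Unset Strict Implicit.
Unset Printing Implicit Defensive.

Import Order.TTheory GRing.Theory Num.Theory.
Import numFieldNormedType.Exports.

Local Open Scope classical_set_scope.
Local Open Scope ring_scope.

(* The library's space of a.e.-classes of integrable functions comes without
   algebraic or topological structure; it is made a [normedModType] below. *)
Definition L1 (R : realType) : Type := LspaceType1 (@lebesgue_measure R).

Section L1_classes.
Variable R : realType.
Local Notation mu := (@lebesgue_measure R).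
Local Notation TR := (measurableTypeR R).
Local Notation Lf := (LfunType mu (@lexx _ _ 1%E)).
Local Notation Q := {mfun_ mu, TR >-> TR}.

Lemma Lnorm_ae (f g : {mfun TR >-> TR}) :
  f = g %[ae mu] -> ('N[mu]_1 [EFin \o f] = 'N[mu]_1 [EFin \o g])%E.
Proof.
have mn (h : {mfun TR >-> TR}) :
    measurable_fun [set: TR] (fun x : TR => `|(h x)%:E|%E).
  apply: (@measurableT_comp _ _ _ _ _ _ (@abse R)) => //.
  apply/measurable_EFinP; exact: (@measurable_funPT _ _ _ _ h).
rewrite !Lnorm1 => fg; apply: ae_eq_integral => //.
- exact: mn.
- exact: mn.
- by apply: filterS fg => x /= fg _; rewrite fg.
Qed.

Lemma repr_pi_ae (f : {mfun TR >-> TR}) : repr (\pi_Q f)%qT = f %[ae mu].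
Proof.
have /eqmodP : (repr (\pi_Q f)%qT = f %[mod Q])%qT by rewrite reprK.
by move=> /asboolP.
Qed.

(* [LfunType] has codomain [R], whereas [{mfun_ mu, _ >-> _}] has codomain
   [measurableTypeR R]: same sigma-algebra, different display. *)
Lemma mfunR_subproof (f : Lf) : @measurable_fun _ _ TR TR setT f.
Proof. exact: (@measurable_funPT _ _ _ _ f). Qed.

Definition mfunR (f : Lf) : {mfun TR >-> TR} :=
  @MeasurableFun.Pack _ _ TR TR (f : R -> R)
    (MeasurableFun.Class
      (@isMeasurableFun.Build _ _ TR TR (f : R -> R) (mfunR_subproof f))).

Definition ae_class (f : Lf) : Q := (\pi_Q (mfunR f))%qT.

Lemma toL1_subproof (f : Lf) : finite_norm mu 1 (ae_class f).
Proof.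
have := @Lfunction_finite _ _ _ _ _ _ f.
by rewrite /finite_norm (Lnorm_ae (repr_pi_ae (mfunR f))).
Qed.

Definition toL1 (f : Lf) : L1 R :=
  @LebesgueSpace.Pack _ _ _ mu 1%E (lexx _) (ae_class f)
    (LebesgueSpace.Class
      (@isFinLebesgue.Build _ _ _ mu 1%E (lexx _) _ (toL1_subproof f))).

Lemma fromL1_subproof (u : L1 R) : (u : R -> R) \in Lfun mu 1.
Proof.
case: u => u [[fu]].
rewrite inE; apply/andP; split; rewrite inE//=.
exact: (@measurable_funPT _ _ _ _ (repr u)).
Qed.

Definition fromL1 (u : L1 R) : Lf := Lfun_Sub (lexx _) (fromL1_subproof u).

Lemma fromL1E (u : L1 R) : fromL1 u = u :> (R -> R).
Proof. by []. Qed.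

Lemma toL1E (f : Lf) : (toL1 f : R -> R) = f %[ae mu].
Proof. exact: repr_pi_ae. Qed.

Lemma L1P (u v : L1 R) : u = v <-> (u : R -> R) = v %[ae mu].
Proof.
split=> [->|]; first exact: aeW.
case: u v => [u [[fu]]] [v [[fv]]] /= uv.
have E : u = v.
  by rewrite -[u]reprK -[v]reprK; apply/eqmodP/asboolP.
by subst v; rewrite (Prop_irrelevance fu fv).
Qed.

Lemma toL1_ae (f g : Lf) : (f : R -> R) = g %[ae mu] -> toL1 f = toL1 g.
Proof.
move=> fg; apply/L1P; apply: ae_eq_trans (toL1E f) _.
by apply: ae_eq_trans fg _; apply: ae_eq_sym; exact: toL1E.
Qed.

Lemma fromL1K : cancel fromL1 toL1.
Proof. by move=> u; apply/L1P; exact: toL1E. Qed.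

End L1_classes.

Section L1_structures.
Variable R : realType.
Local Notation mu := (@lebesgue_measure R).
Local Notation Lf := (LfunType mu (@lexx _ _ 1%E)).

HB.instance Definition _ := gen_eqMixin (L1 R).
HB.instance Definition _ := gen_choiceMixin (L1 R).

Let zero : L1 R := toL1 0.
Let opp (u : L1 R) : L1 R := toL1 (- fromL1 u).
Let add (u v : L1 R) : L1 R := toL1 (fromL1 u + fromL1 v).
Let scale (a : R) (u : L1 R) : L1 R := toL1 (a *: fromL1 u).

Lemma LfunDE (f g : Lf) x : (f + g) x = f x + g x.
Proof. by []. Qed.

Lemma LfunNE (f : Lf) x : (- f) x = - f x.
Proof. by []. Qed.

Lemma LfunZE a (f : Lf) x : (a *: f) x = a * f x.
Proof. by []. Qed.

Lemma Lfun0E x : (0 : Lf) x = 0.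
Proof. by []. Qed.

Let ae_app (P Q : measurableTypeR R -> Prop) : (\forall x \ae mu, P x) ->
  (\forall x \ae mu, P x -> Q x) -> \forall x \ae mu, Q x.
Proof. move=> aeP aePQ; apply: filter_app aePQ aeP. Qed.

Let addE (u v : L1 R) : (add u v : R -> R) = (u \+ v) %[ae mu].
Proof. exact: toL1E. Qed.

Let oppE (u : L1 R) : (opp u : R -> R) = (\- u) %[ae mu].
Proof. exact: toL1E. Qed.

Let scaleE a (u : L1 R) : (scale a u : R -> R) = (a \*: (u : R -> R)) %[ae mu].
Proof. exact: toL1E. Qed.

Let zeroE : (zero : R -> R) = (cst 0) %[ae mu].
Proof. exact: toL1E. Qed.

Let addA : associative add.
Proof.
move=> u v w; apply/L1P.
apply: (ae_app (addE u v)); apply: (ae_app (addE (add u v) w));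
  apply: (ae_app (addE v w)); apply: (ae_app (addE u (add v w))); apply: aeW.
by move=> x /= /(_ I)-> /(_ I)-> /(_ I)-> /(_ I)-> _; rewrite addrA.
Qed.

Let addC : commutative add.
Proof.
move=> u v; apply/L1P; apply: (ae_app (addE v u)); apply: (ae_app (addE u v));
  apply: aeW.
by move=> x /= /(_ I)-> /(_ I)-> _; rewrite addrC.
Qed.

Let add0 : left_id zero add.
Proof.
move=> u; apply/L1P; apply: (ae_app (zeroE)); apply: (ae_app (addE zero u));
  apply: aeW.
by move=> x /= /(_ I)-> /(_ I)-> _; rewrite add0r.
Qed.

Let addN : left_inverse zero opp add.
Proof.
move=> u; apply/L1P; apply: (ae_app (zeroE)); apply: (ae_app (oppE u));
  apply: (ae_app (addE (opp u) u)); apply: aeW.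
by move=> x /= /(_ I)-> /(_ I)-> /(_ I)-> _; rewrite addNr.
Qed.

HB.instance Definition _ := GRing.isZmodule.Build (L1 R) addA addC add0 addN.

Lemma L1D (u v : L1 R) : (u + v : R -> R) = (u \+ v) %[ae mu].
Proof. exact: addE. Qed.

Lemma L1N (u : L1 R) : (- u : R -> R) = (\- u) %[ae mu].
Proof. exact: oppE. Qed.

Lemma L10 : ((0 : L1 R) : R -> R) = (cst 0) %[ae mu].
Proof. exact: zeroE. Qed.

Let scaleA a b u : scale a (scale b u) = scale (a * b) u.
Proof.
apply/L1P; apply: (ae_app (scaleE (a * b) u)); apply: (ae_app (scaleE b u));
  apply: (ae_app (scaleE a (scale b u))); apply: aeW.
by move=> x /= /(_ I)-> /(_ I)-> /(_ I)-> _; rewrite scalerA.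
Qed.

Let scale1 : left_id 1 scale.
Proof.
move=> u; apply/L1P; apply: (ae_app (scaleE 1 u)); apply: aeW.
by move=> x /= /(_ I)-> _; rewrite scale1r.
Qed.

Let scaleDr : right_distributive scale +%R.
Proof.
move=> a u v; apply/L1P.
apply: (ae_app (scaleE a v)); apply: (ae_app (scaleE a u));
  apply: (ae_app (L1D (scale a u) (scale a v))); apply: (ae_app (L1D u v));
  apply: (ae_app (scaleE a (u + v))); apply: aeW.
by move=> x /= /(_ I)-> /(_ I)-> /(_ I)-> /(_ I)-> /(_ I)-> _; rewrite scalerDr.
Qed.

Let scaleDl u : {morph scale^~ u : a b / a + b >-> a + b}.
Proof.
move=> a b; apply/L1P.
apply: (ae_app (scaleE b u)); apply: (ae_app (scaleE a u));
  apply: (ae_app (L1D (scale a u) (scale b u)));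
  apply: (ae_app (scaleE (a + b) u)); apply: aeW.
by move=> x /= /(_ I)-> /(_ I)-> /(_ I)-> /(_ I)-> _; rewrite scalerDl.
Qed.

HB.instance Definition _ :=
  GRing.Zmodule_isLmodule.Build R (L1 R) scaleA scale1 scaleDr scaleDl.

Lemma L1Z a (u : L1 R) : (a *: u : R -> R) = (a \*: (u : R -> R)) %[ae mu].
Proof. exact: scaleE. Qed.

Let norm (u : L1 R) : R := fine ('N[mu]_1 [EFin \o u]).

Let normE (f : Lf) : norm (toL1 f) = fine ('N[mu]_1 [EFin \o f]).
Proof. by rewrite /norm (Lnorm_ae (repr_pi_ae (mfunR f))). Qed.

Let ler_normD u v : norm (u + v) <= norm u + norm v.
Proof. by rewrite [X in X <= _]normE; exact: ler_LnormD. Qed.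

Let normrZ a u : norm (a *: u) = `|a| * norm u.
Proof.
rewrite [LHS]normE; apply: EFin_inj; rewrite EFinM.
by rewrite (finite_norm_fine (fromL1 u)) -LnormZ finite_norm_fine.
Qed.

Let normr0_eq0 u : norm u = 0 -> u = 0.
Proof.
move=> /(@fine_Lnormr_eq0 _ _ _ mu _ _ (fromL1 u)) u0; apply/L1P.
by apply: (ae_app (L10)); apply: (ae_app (u0));
  apply: aeW => x /= /(_ I)-> /(_ I)->.
Qed.

HB.instance Definition _ :=
  Lmodule_isNormed.Build R (L1 R) ler_normD normrZ normr0_eq0.

Lemma L1_normE (u : L1 R) : `|u|%:E = (\int[mu]_x `|(u x)%:E|)%E.
Proof. by rewrite -Lnorm1 -(finite_norm_fine (fromL1 u)). Qed.

End L1_structures.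

(* The a.e. derivative of K(x) = exp(-|x|) / 2, with value 0 at x = 0. *)
Definition dK (R : realType) (x : R) : R := - 2^-1 * Num.sg x * expR (- `|x|).

Section convolution.
Variable R : realType.
Local Notation mu := (@lebesgue_measure R).
Local Notation TR := (measurableTypeR R).

Let expabs (x : R) : R := expR (- `|x|).

Let expabs_cont : continuous expabs.
Proof.
move=> x; apply: continuous_comp; last exact: continuous_expR.
by apply: continuousN; exact: norm_continuous.
Qed.

Let expabs_lty : (\int[mu]_x (expabs x)%:E < +oo)%E.
Proof.
rewrite ge0_symfun_integralT//; last 2 first.
  by move=> x; exact: expR_ge0.
  by move=> x; rewrite /expabs /= normrN.
rewrite lte_mul_pinfty//.
rewrite -set_itvcy (@ge0_continuous_FTC2y _ _ (fun x => - expR (- x)) _ 0)//.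
- by rewrite -EFinB ltry.
- by move=> x _; exact: expR_ge0.
- by apply: continuous_subspaceT; exact: expabs_cont.
- by rewrite -oppr0; apply: cvgN; exact: cvgr_expR.
- by apply: cvg_at_right_filter; apply: cvgN; apply: continuous_comp;
    [exact: opp_continuous|exact: continuous_expR].
- move=> x; rewrite in_itv/= andbT => x0.
  rewrite derive1E derive_val /expabs gtr0_norm//.
  by rewrite mulrN1 opprK.
Qed.

Let expabs_shift y :
  (\int[mu]_x (expabs (x - y))%:E = \int[mu]_x (expabs x)%:E)%E.
Proof.
have dF : (fun x : R => x - y)^`()%classic = cst (1 : R).
  by apply/funext => x; rewrite derive1E derive_val/=; lra.
rewrite [RHS](@increasing_ge0_integration_by_substitutionT _ (fun x => x - y))//.
- by apply: eq_integral => x _; rewrite dF /= mulr1.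
- by move=> a b ab; rewrite ltrD2r.
- by rewrite dF; exact: cst_continuous.
- by rewrite dF; exact: is_cvg_cst.
- by rewrite dF; exact: is_cvg_cst.
- exact: cvg_addrr_Ny.
- exact: cvg_addrr.
- by move=> x; exact: expR_ge0.
Qed.

Lemma measurable_dK : measurable_fun [set: TR] (@dK R : TR -> R).
Proof.
apply: measurable_funM; last exact: continuous_measurable_fun.
apply: measurable_funM => //.
rewrite (_ : Num.sg = (fun x : R => \1_`]0, +oo[ x - \1_`]-oo, 0[ x)); last first.
  apply/funext => x; rewrite !indicE !mem_setE !in_itv/= andbT.
  by case: (ltgtP x 0) => [x0|x0|->]; rewrite ?subr0 ?sub0r ?sgr0
    ?(gtr0_sg x0) ?(ltr0_sg x0).
by apply: measurable_funB; exact: measurable_indic.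
Qed.

Lemma normr_dK_le (x : R) : `|dK x| <= expR (- `|x|).
Proof.
rewrite /dK !normrM (ger0_norm (expR_ge0 _)) ler_piMl ?expR_ge0//.
rewrite normr_sg normrN (@ger0_norm _ 2^-1)//.
by case: (x != 0); rewrite ?mulr1 ?mulr0 ?ler01//; lra.
Qed.

Lemma integrable_dK_conv (u : L1 R) :
  mu.-integrable setT (fun x => (\int[mu]_y (dK (x - y) * u y)%:E)%E).
Proof.
have mu_ : measurable_fun [set: TR] (u : TR -> R).
  exact: (@measurable_funPT _ _ _ _ (fromL1 u)).
pose f (z : TR * TR) : \bar R := (dK (z.1 - z.2) * u z.2)%:E.
have mf : measurable_fun setT f.
  apply/measurable_EFinP; apply: measurable_funM.
    apply: (measurableT_comp measurable_dK).
    by apply: measurable_funB; [exact: measurable_fst|exact: measurable_snd].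
  exact: (measurableT_comp mu_ measurable_snd).
apply: (@integrable_fubini_F _ _ _ _ R mu mu f).
apply/integrable21ltyP => //.
have iu : (\int[mu]_y `|(u y)%:E| < +oo)%E by rewrite -L1_normE ltry.
pose C := (\int[mu]_x (expabs x)%:E)%E.
have C0 : (0 <= C)%E by apply: integral_ge0 => x _; rewrite lee_fin expR_ge0.
have mau : measurable_fun [set: TR] (fun y : TR => `|(u y)%:E|%E).
  apply: (@measurableT_comp _ _ _ _ _ _ (@abse R)) => //.
  exact/measurable_EFinP.
apply: (@le_lt_trans _ _ (\int[mu]_y (C * `|(u y)%:E|))%E); last first.
  by rewrite ge0_integralZl// lte_mul_pinfty// ge0_fin_numE.
have maf : measurable_fun setT (abse \o f).
  exact: (@measurableT_comp _ _ _ _ _ _ (@abse R)).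
apply: ge0_le_integral => //.
- by move=> y _; exact: integral_ge0.
- apply: (@measurable_fun_fubini_tonelli_G _ _ TR TR R mu (abse \o f)) => //.
  by move=> z; exact: abse_ge0.
- exact: measurable_funeM.
move=> y _.
rewrite /C -(expabs_shift y) muleC -ge0_integralZl//; last 2 first.
- apply/measurable_EFinP; apply: continuous_measurable_fun.
  move=> x; apply: continuous_comp; last exact: expabs_cont.
  by apply: continuousB; [exact: cvg_id|exact: cst_continuous].
- by move=> x _; rewrite lee_fin expR_ge0.
apply: ge0_le_integral => //.
- apply: (@measurableT_comp _ _ _ _ _ _ (@abse R)) => //.
  by apply: (measurableT_comp mf); exact: measurable_pair2.
- apply/measurable_EFinP; apply: measurable_funM => //.
  apply: continuous_measurable_fun.
  move=> x; apply: continuous_comp; last exact: expabs_cont.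
  by apply: continuousB; [exact: cvg_id|exact: cst_continuous].
- by move=> x _; rewrite /f/= -EFinM lee_fin normrM mulrC ler_wpM2l// normr_dK_le.
Qed.

Lemma conv_dK_fin (u : L1 R) x :
  (\int[mu]_y (dK (x - y) * u y)%:E)%E \is a fin_num.
Proof.
have mu_ : measurable_fun [set: TR] (u : TR -> R).
  exact: (@measurable_funPT _ _ _ _ (fromL1 u)).
apply: integrable_fin_num => //.
apply: (@le_integrable _ _ _ mu _ _ _ (EFin \o u)) => //.
- apply/measurable_EFinP; apply: measurable_funM => //.
  apply: (measurableT_comp measurable_dK).
  by apply: measurable_funB => //; exact: measurable_cst.
- move=> y _ /=; rewrite lee_fin normrM ler_piMl//.
  apply: (le_trans (normr_dK_le _)).
  by rewrite -expR0 ler_expR oppr_le0.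
- exact/Lfun1_integrable/fromL1_subproof.
Qed.

Lemma Lfun_conv_dK (u : L1 R) :
  (fun x => \int[mu]_y (dK (x - y) * u y)) \in Lfun mu 1.
Proof.
apply/Lfun1_integrable; apply: eq_integrable (integrable_dK_conv u) => //.
by move=> x _ /=; rewrite fineK// conv_dK_fin.
Qed.

Definition conv_dK (u : L1 R) : L1 R :=
  toL1 (Lfun_Sub (lexx _) (Lfun_conv_dK u)).

End convolution.

Section nonlinear_operators.
Context {R : realType} {V : normedModType R}.
Implicit Types G F : set (V * V).

Definition op_dom G : set V := [set u | exists v, G (u, v)].

Definition op_range G : set V := [set v | exists u, G (u, v)].

Definition op_scale (a : R) G : set (V * V) :=
  [set (uv.1, a *: uv.2) | uv in G].

Definition op_add G F : set (V * V) :=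
  [set uw | exists v w, [/\ G (uw.1, v), F (uw.1, w) & uw.2 = v + w]].

Definition op_id : set (V * V) := [set uv | uv.1 = uv.2].

Definition op_graph (f : V -> V) : set (V * V) := [set uv | uv.2 = f uv.1].

Definition op_pow G (n : nat) : set (V * V) :=
  iter n (fun H => (G \; H)%relation) op_id.

Definition accretive G : Prop :=
  forall u1 v1 u2 v2, G (u1, v1) -> G (u2, v2) ->
  forall l : R, 0 < l -> `|u1 - u2| <= `|u1 - u2 + l *: (v1 - v2)|.

Definition quasi_accretive G : Prop :=
  exists2 w : R, 0 < w & forall l : R, 0 < l -> l < w^-1 ->
  forall u1 v1 u2 v2, G (u1, v1) -> G (u2, v2) ->
  (1 - l * w) * `|u1 - u2| <= `|u1 - u2 + l *: (v1 - v2)|.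

Definition m_accretive G : Prop :=
  accretive G /\ op_range (op_add op_id G) = setT.

Definition quasi_m_accretive G : Prop :=
  quasi_accretive G /\
  exists2 w : R, 0 < w & m_accretive (op_add G (op_scale w op_id)).

(* Semigroups and solutions are functions on all of R of which only the values
   at times t >= 0 matter. *)
Definition continuous_semigroup (S : R -> V -> V) : Prop :=
  [/\ S 0 = id,
      forall t1 t2, 0 <= t1 -> 0 <= t2 -> S (t1 + t2) = S t1 \o S t2
    & forall u0, {within `[0, +oo[, continuous (fun t => S t u0)}].

(* (I + (t / n) G)^-n (u0), a priori a set, is asked to be a singleton {w n} for
   all large n. The time t = 0 is left to the axiom S 0 = id: since 0 G has
   domain D(G), the set (I + 0 G)^-n (u0) is empty for u0 outside D(G). *)
Definition generates G (S : R -> V -> V) : Prop :=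
  forall u0, closure (op_dom G) u0 -> forall t : R, 0 < t ->
  exists2 w : nat -> V,
    \forall n \near \oo,
      [set v | op_pow ((op_add op_id (op_scale (t / n%:R) G))^-1)%relation n
                 (u0, v)] = [set w n]
    & w @ \oo --> S t u0.

Definition mild_solution G (u0 : V) (u : R -> V) : Prop :=
  quasi_m_accretive G /\
  exists S : R -> V -> V,
    [/\ continuous_semigroup S, generates G S
      & forall t, 0 <= t -> u t = S t u0].

End nonlinear_operators.

Section Fornberg_Whitham.
Variable R : realType.
Local Notation mu := (@lebesgue_measure R).

Definition test_function (phi : R -> R) : Prop :=
  (forall (n : nat) (x : R), derivable (derive1n n phi) x 1) /\
  compact (closure [set x | phi x != 0]).

Definition entropy_pair (u v : L1 R) : Prop :=
  mu.-integrable setT (fun x => ((u x) ^+ 2 / 2)%:E) /\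
  forall (l : R) (phi : R -> R),
    test_function phi -> (forall x, 0 <= phi x) ->
    0 <= \int[mu]_x (Num.sg (u x - l) *
           (((u x) ^+ 2 - l ^+ 2) / 2 * derive1 phi x + v x * phi x)).

Definition burgers0 : set (L1 R * L1 R) := [set uv | entropy_pair uv.1 uv.2].

Definition burgers : set (L1 R * L1 R) := closure burgers0.

(* K * u_x is read as K' * u. *)
Definition fornberg_whitham : set (L1 R * L1 R) :=
  op_add burgers (op_graph (@conv_dK R)).

End Fornberg_Whitham.

Arguments burgers0 R : clear implicits.
Arguments burgers R : clear implicits.
Arguments fornberg_whitham R : clear implicits.

(* Main.v *)
(* In one dimension an entropy pair (u, v) of A_0 can be described pointwise:
   W = u^2/2 is absolutely continuous with W' = v, and on an interval where
   W > 0 the sign of u can only jump from + to -. One direction follows by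
   testing with smooth approximations of indicators of intervals and letting
   the Kruzhkov constant be 0 and tend to +-oo at Lebesgue points. Given this
   description, sg (u1 - u2) (W1 - W2) increases by at most the integral of
   sg (u1 - u2) (v1 - v2) where it does not vanish, and its zero set contributes
   nothing; so the total integral of sg (u1 - u2) (v1 - v2) is nonnegative, which
   is accretivity.

   The equation u + l v = f with f continuous of compact support is solved up to
   a small error: W is the maximum of P, the solution of
   P' = (f - sqrt (2 P)) / l reflected at 0, and of its mirror image N, for which
   u = - sqrt (2 N). The square root is made Lipschitz so that P is a limit of
   Picard iterates. Hence A is m-accretive.

   Since u |-> K' * u is Lipschitz, A + B is quasi-m-accretive by a contraction
   argument, and the exponential formula of Crandall and Liggett, via Kobayashi's
   estimate, yields the semigroup. *)
From HB Require Import structures.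
Require Import Defs.
From mathcomp Require Import all_boot all_order all_algebra.
From mathcomp Require Import all_classical all_reals all_analysis.
From mathcomp Require Import measurable_realfun ring lra.

Set Implicit Arguments.
Unset Strict Implicit.
Unset Printing Implicit Defensive.

Import Order.TTheory GRing.Theory Num.Theory.
Import numFieldNormedType.Exports.

Local Open Scope classical_set_scope.
Local Open Scope ring_scope.

(** * The exponential formula *)

(** Two pairs of [A_0] are compared through W1 - W2, which is continuous although u1 and u2 are not.
    The obstacle is its zero set, which may have infinitely many gaps and positive measure. One
    lemma, [engine], disposes of such sets wherever they occur: for accretivity, for the reflected
    equation and for the glued solution.

    Solving u + l v = f up to a small L1 error suffices, because accretivity turns approximate
    solutions into a Cauchy sequence and [A] is closed. This is what permits replacing the square
    root, which is not Lipschitz at 0, by [soft_root d]. The price is a pointwise error of at most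
    [d], and it becomes a small L1 error only because all approximate solutions live on one interval
    that does not depend on [d]; hence the barrier that accompanies the Picard iteration.

    Density of the domain is a separate matter: it comes from C^1 functions of compact support,
    which are profiles for trivial reasons. It is also what makes the semigroup unique, since
    [generates] speaks only of the closure of the domain. *)

Section exponential_formula.
Context {R : realType} {V : completeNormedModType R}.
Variables (G : set (V * V)) (w : R).
Hypothesis w_gt0 : 0 < w.
Hypothesis G_quasi : forall l : R, 0 < l -> l < w^-1 ->
  forall u1 v1 u2 v2, G (u1, v1) -> G (u2, v2) ->
  (1 - l * w) * `|u1 - u2| <= `|u1 - u2 + l *: (v1 - v2)|.
Hypothesis G_range : forall l : R, 0 < l -> l < w^-1 ->
  forall f, exists u v, G (u, v) /\ u + l *: v = f.
Implicit Types (l k : R) (x y v : V) (m n : nat).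
Hypothesis G_dense : closure (op_dom G) = setT.

(** The side conditions on [l] stand inside the existential so that one total choice function
    [resolvent] serves every [l] and [f]. *)
Lemma resolvent_ex (l : R) (f : V) :
  exists u, 0 < l -> l < w^-1 -> G (u, l^-1 *: (f - u)).
Proof.
have [[l0 lw]|nl] := pselect (0 < l /\ l < w^-1); last first.
  by exists 0 => l0 lw; case: nl.
have [u [v [Guv <-]]] := G_range l0 lw f.
by exists u => _ _; rewrite addrAC subrr add0r scalerA mulVf ?scale1r ?gt_eqF.
Qed.

Definition resolvent (l : R) (f : V) : V := sval (cid (resolvent_ex l f)).
Local Notation J := resolvent.

Lemma resolventP l f : 0 < l -> l < w^-1 -> G (J l f, l^-1 *: (f - J l f)).
Proof. by rewrite /J; case: cid. Qed.

Lemma step_gt0 l : 0 < l -> l < w^-1 -> 0 < 1 - l * w.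
Proof. by move=> l0 lw; rewrite subr_gt0 -ltr_pdivlMr// div1r. Qed.

Lemma resolvent_unique l u v : 0 < l -> l < w^-1 -> G (u, v) ->
  J l (u + l *: v) = u.
Proof.
move=> l0 lw Guv; set f := u + _.
have := G_quasi l0 lw (resolventP f l0 lw) Guv.
rewrite scalerBr scalerA divff ?gt_eqF// scale1r.
have -> : J l f - u + (f - J l f - l *: v) = 0.
  by rewrite {2}/f (addrAC (u + _)) addrK addrA subrK subrr.
rewrite normr0 pmulr_rle0 ?step_gt0// normr_le0 subr_eq0.
by move/eqP.
Qed.

Lemma resolvent_lipschitz l x y : 0 < l -> l < w^-1 ->
  (1 - l * w) * `|J l x - J l y| <= `|x - y|.
Proof.
move=> l0 lw.
apply: (le_trans (G_quasi l0 lw (resolventP x l0 lw) (resolventP y l0 lw))).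
rewrite -scalerBr scalerA divff ?gt_eqF// scale1r.
by rewrite opprD opprK addrACA (addrC (J l x)) subrK (addrC (- y)) addKr.
Qed.

Lemma iter_resolvent_lipschitz l m x y : 0 < l -> l < w^-1 ->
  (1 - l * w) ^+ m * `|iter m (J l) x - iter m (J l) y| <= `|x - y|.
Proof.
move=> l0 lw; elim: m => [|m ih] /=; first by rewrite expr0 mul1r.
apply: le_trans ih; rewrite exprSr -mulrA ler_wpM2l ?exprn_ge0// ?(ltW (step_gt0 _ _))//.
exact: resolvent_lipschitz.
Qed.

(** Since x = J (x + l v), one resolvent step moves x by at most l |v|, up to the Lipschitz factor.
    This is the estimate on the axes m = 0 and n = 0 of the double induction below. *)
Lemma iter_resolvent_drift l m x v : 0 < l -> l < w^-1 -> G (x, v) ->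
  (1 - l * w) ^+ m * `|iter m (J l) x - x| <= m%:R * l * `|v|.
Proof.
move=> l0 lw Gxv.
have s0 := step_gt0 l0 lw.
have s1 : 1 - l * w <= 1 by rewrite lerBlDr lerDl mulr_ge0// ltW.
have J1 : (1 - l * w) * `|J l x - x| <= l * `|v|.
  have := resolvent_lipschitz x (x + l *: v) l0 lw.
  rewrite (resolvent_unique l0 lw Gxv) => /le_trans; apply.
  by rewrite opprD addrA subrr sub0r normrN normrZ gtr0_norm.
elim: m => [|m ih] /=; first by rewrite subrr normr0 !mulr0 !mul0r.
rewrite -(subrKA (J l x)) (le_trans (ler_wpM2l _ (ler_normD _ _)))//.
  by rewrite exprn_ge0// ltW.
rewrite mulrDr -natr1 mulrDl mul1r [leRHS]mulrDl lerD//.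
  apply: le_trans ih; rewrite exprSr -mulrA.
  by rewrite ler_wpM2l ?exprn_ge0 ?(ltW s0)// resolvent_lipschitz.
rewrite exprSr -mulrA (le_trans _ J1)// ler_piMl ?mulr_ge0 ?(ltW s0)//.
by rewrite exprn_ile1 ?(ltW s0).
Qed.

(* Kobayashi's estimate: the two weights balance so that the squared bound is
   preserved exactly by the induction, and [sqrt] is concave. *)
Lemma iter_resolvent_dist l k m n x v : 0 < l -> l < w^-1 -> 0 < k -> k < w^-1 ->
  G (x, v) ->
  (1 - l * w) ^+ m * (1 - k * w) ^+ n * `|iter m (J l) x - iter n (J k) x| <=
  `|v| * Num.sqrt ((m%:R * l - n%:R * k) ^+ 2 + m%:R * l ^+ 2 + n%:R * k ^+ 2).
Proof.
move=> l0 lw k0 kw Gxv.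
have s0 := step_gt0 l0 lw; have t0 := step_gt0 k0 kw.
have base (y h : R) (p : nat) : 0 <= h -> y <= p%:R * h * `|v| ->
    y <= `|v| * Num.sqrt ((p%:R * h) ^+ 2 + p%:R * h ^+ 2).
  move=> h0 /le_trans; apply; rewrite mulrC ler_wpM2l//.
  rewrite -{1}(@ger0_norm _ (p%:R * h)) ?mulr_ge0// -sqrtr_sqr.
  rewrite ler_sqrt ?addr_ge0 ?sqr_ge0 ?mulr_ge0 ?sqr_ge0// lerDl.
  by rewrite mulr_ge0 ?sqr_ge0.
elim: m n => [|m ihm] n.
  rewrite expr0 mul1r mul0r sub0r sqrrN mul0r addr0; apply: base; first exact: ltW.
  by rewrite /= distrC iter_resolvent_drift.
elim: n => [|n ihn].
  rewrite expr0 mulr1 !mul0r subr0 addr0; apply: base; first exact: ltW.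
  exact: iter_resolvent_drift.
rewrite !iterS; set x' := iter m _ x; set y' := iter n _ x.
(* The step [h] is chosen with h / l = a, h / k = b and a + b = 1. Quasi-accretivity with step [h]
   then compares the two new iterates with a convex combination of the two mixed differences. *)
pose h := l * k / (l + k).
have lk0 : 0 < l + k by rewrite addr_gt0.
have h0 : 0 < h by rewrite divr_gt0 ?mulr_gt0.
have hl : h < l by rewrite /h -mulrA gtr_pMr// ltr_pdivrMr// mul1r ltrDr.
have hk : h < k by rewrite /h (mulrC l) -mulrA gtr_pMr// ltr_pdivrMr// mul1r ltrDl.
have hw : h < w^-1 by exact: lt_trans kw.
pose a := k / (l + k); pose b := l / (l + k).
have ab : a + b = 1 by rewrite /a /b -mulrDl addrC divff// gt_eqF.
have a0 : 0 <= a by rewrite divr_ge0 ?ltW.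
have b0 : 0 <= b by rewrite divr_ge0 ?ltW.
have key : (1 - h * w) * `|J l x' - J k y'| <=
    a * `|x' - J k y'| + b * `|J l x' - y'|.
  apply: (le_trans (G_quasi h0 hw (resolventP x' l0 lw) (resolventP y' k0 kw))).
  rewrite -{1}(ger0_norm a0) -{1}(ger0_norm b0) -!normrZ.
  rewrite (le_trans _ (ler_normD _ _))// le_eqVlt; apply/orP; left; apply/eqP.
  congr (`|_|); rewrite [in LHS]scalerBr !scalerA.
  have -> : h / l = a by rewrite /h /a; field; rewrite !gt_eqF.
  have -> : h / k = b by rewrite /h /b; field; rewrite !gt_eqF.
  rewrite -{1}(scale1r (J l x')) -{1}(scale1r (J k y')) -ab !scalerDl !scalerBr.
  rewrite [in LHS]opprD [in LHS]opprB.
  rewrite ![in LHS]addrA [LHS](ACl (((5*3)*(2*8))*((1*6)*(7*4))))/=.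
  by rewrite !subrr !addr0.
pose A := (m%:R * l - n.+1%:R * k) ^+ 2 + m%:R * l ^+ 2 + n.+1%:R * k ^+ 2.
pose B := (m.+1%:R * l - n%:R * k) ^+ 2 + m.+1%:R * l ^+ 2 + n%:R * k ^+ 2.
have AE : 0 <= A by do ?[exact: sqr_ge0|exact: ler0n|apply: addr_ge0|apply: mulr_ge0].
have BE : 0 <= B by do ?[exact: sqr_ge0|exact: ler0n|apply: addr_ge0|apply: mulr_ge0].
have CE : a * A + b * B =
  (m.+1%:R * l - n.+1%:R * k) ^+ 2 + m.+1%:R * l ^+ 2 + n.+1%:R * k ^+ 2.
  by rewrite /a /b /A /B -!natr1; field; rewrite gt_eqF.
rewrite -CE.
have jensen : a * Num.sqrt A + b * Num.sqrt B <= Num.sqrt (a * A + b * B).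
  rewrite -[leLHS]ger0_norm; last by do ?[exact: sqrtr_ge0|apply: addr_ge0|apply: (mulr_ge0 a0)|apply: (mulr_ge0 b0)].
  rewrite -sqrtr_sqr ler_sqrt; last by apply: addr_ge0; [apply: (mulr_ge0 a0)|apply: (mulr_ge0 b0)].
  rewrite -{2}(sqr_sqrtr AE) -{2}(sqr_sqrtr BE) -subr_ge0.
  have -> : b = 1 - a by rewrite -ab addrC addKr.
  set A' := Num.sqrt A; set B' := Num.sqrt B.
  have -> : a * A' ^+ 2 + (1 - a) * B' ^+ 2 - (a * A' + (1 - a) * B') ^+ 2 =
    a * (1 - a) * (A' - B') ^+ 2 by ring.
  by rewrite mulr_ge0 ?sqr_ge0// mulr_ge0// -ab addrC addKr.
apply: (@le_trans _ _ (`|v| * (a * Num.sqrt A + b * Num.sqrt B))); last first.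
  by rewrite ler_wpM2l.
have u0 := step_gt0 h0 hw.
(* Each induction hypothesis lacks one factor, 1 - l w or 1 - k w. Both are at most 1 - h w, the
   factor gained from [key]. *)
have lu : 1 - l * w <= 1 - h * w by apply: lerB => //; apply: ler_wpM2r; apply: ltW.
have ku : 1 - k * w <= 1 - h * w by apply: lerB => //; apply: ler_wpM2r; apply: ltW.
rewrite -(ler_pM2l u0) !exprS.
have := ihm n.+1; rewrite -/A iterS -/x' -/y' exprS => H1.
have H2 := ihn; rewrite -/B iterS -/x' -/y' exprS in H2.
have pm : 0 <= (1 - l * w) ^+ m by rewrite exprn_ge0// ltW.
have pn : 0 <= (1 - k * w) ^+ n by rewrite exprn_ge0// ltW.
move: key H1 H2 lu ku u0 s0 t0.
set D := `|J l x' - J k y'|; set D1 := `|x' - J k y'|; set D2 := `|J l x' - y'|.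
have D10 : 0 <= D1 by exact: normr_ge0.
have D20 : 0 <= D2 by exact: normr_ge0.
move: pm pn D10 D20; clearbody D D1 D2.
set p := _ ^+ m; set q := _ ^+ n; set al := 1 - l * w; set be := 1 - k * w.
set u := 1 - h * w; set X := Num.sqrt A; set Y := Num.sqrt B; set C := `|v|.
move=> p0 q0 D10 D20 key H1 H2 lu ku u0 s0 t0.
clearbody p q al be u X Y C; clear CE jensen; clearbody a b.
apply: (@le_trans _ _ (p * q * al * be * (a * D1 + b * D2))).
  have -> : u * (al * p * (be * q) * D) = (p * q * al * be) * (u * D) by ring.
  by rewrite ler_wpM2l// !mulr_ge0 ?(ltW s0) ?(ltW t0).
apply: (@le_trans _ _ (u * (a * (p * (be * q) * D1) + b * (al * p * q * D2)))).
  rewrite !mulrDr lerD//.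
    have -> : p * q * al * be * (a * D1) = al * (a * (p * (be * q) * D1)) by ring.
    by rewrite ler_wpM2r// !mulr_ge0 ?(ltW t0).
  have -> : p * q * al * be * (b * D2) = be * (b * (al * p * q * D2)) by ring.
  by rewrite ler_wpM2r// !mulr_ge0 ?(ltW s0).
rewrite ler_wpM2l ?(ltW u0)// mulrDr lerD//.
  by rewrite [leRHS]mulrCA ler_wpM2l.
by rewrite [leRHS]mulrCA ler_wpM2l.
Qed.

(** For s = l w <= 1/2 one has (1 + 2 s)(1 - s) >= 1, hence exp (- 2 s) <= 1 - s. This keeps the
    weights of the previous estimates away from 0, uniformly in the mesh. *)
Lemma step_expR l m (T : R) : 0 < l -> l * w <= 2^-1 -> m%:R * l <= T ->
  expR (- (2 * w * T)) <= (1 - l * w) ^+ m.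
Proof.
move=> l0 lw mT.
have lw0 : 0 < l * w by rewrite mulr_gt0.
have : expR (- (2 * (l * w))) <= 1 - l * w.
  rewrite expRN; have lw1 : 0 < 1 - l * w by lra.
  rewrite -(ler_pM2l (expR_gt0 (2 * (l * w)))) divff ?gt_eqF ?expR_gt0//.
  apply: (@le_trans _ _ ((1 + 2 * (l * w)) * (1 - l * w))); last first.
    by rewrite ler_wpM2r ?(ltW lw1)// expR_ge1Dx//; lra.
  nra.
move=> H; apply: (@le_trans _ _ (expR (- (2 * (l * w))) ^+ m)).
  rewrite -expRM_natl ler_expR mulrN lerN2.
  have -> : m%:R * (2 * (l * w)) = 2 * w * (m%:R * l) by ring.
  by rewrite ler_wpM2l// mulr_ge0// ltW.
by rewrite lerXn2r// nnegrE ?expR_ge0//; lra.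
Qed.

(** The point x need not lie in the domain: it is replaced by a nearby y that does, at the cost of
    two Lipschitz errors e / 4, and the double-index estimate is applied to y with error e / 2. *)
Lemma iter_cauchy x (t e : R) : 0 <= t -> 0 < e -> exists2 d : R, 0 < d &
  forall l k m n, 0 < l < d -> 0 < k < d ->
    `|m%:R * l - t| < d -> `|n%:R * k - t| < d ->
    `|iter m (J l) x - iter n (J k) x| <= e.
Proof.
move=> t0 e0.
pose c := expR (- (2 * w * (t + 1))).
have c0 : 0 < c := expR_gt0 _.
have [y [[v Gyv] xy]] : exists y, op_dom G y /\ `|x - y| < c * e / 4.
  have : closure (op_dom G) x by rewrite G_dense.
  move=> /(_ (ball x (c * e / 4))) [].
    by apply: nbhsx_ballx; rewrite divr_gt0// mulr_gt0.
  by move=> y [Dy]; rewrite -ball_normE /= => xy; exists y.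
(* [h] makes |v| h <= c^2 e / 2, where c^2 bounds the two weights from below. [d] makes the radicand
   at most h^2: its terms are at most 4 d, (t + 1) d and (t + 1) d, using d <= 1. *)
pose h := c ^+ 2 * e / 2 / (`|v| + 1).
have h0 : 0 < h by rewrite !divr_gt0 ?mulr_gt0 ?exprn_gt0// ltr_wpDl.
have T0 : 0 < 4 + 2 * (t + 1) by lra.
pose d := Num.min (Num.min 1 (2 * w)^-1) (h ^+ 2 / (4 + 2 * (t + 1))).
have d0 : 0 < d.
  by rewrite !lt_min ltr01 invr_gt0 mulr_gt0//= divr_gt0 ?exprn_gt0.
have d1 : d <= 1 by rewrite /d !ge_min lexx.
have dw : d <= (2 * w)^-1 by rewrite /d !ge_min lexx !orbT.
have dh : d * (4 + 2 * (t + 1)) <= h ^+ 2.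
  by rewrite -ler_pdivlMr// /d !ge_min lexx !orbT.
exists d => // l k m n /andP[l0 ld] /andP[k0 kd] mlt nkt.
have small (p : R) : p < d -> p * w <= 2^-1.
  by move=> pd; rewrite -ler_pdivlMr// -invfM (le_trans (ltW pd)).
have small' (p : R) : p < d -> p < w^-1.
  move=> pd; apply: (lt_le_trans pd); apply: (le_trans dw).
  by rewrite lef_pV2 ?posrE ?mulr_gt0// ler_peMl ?ler1n// ltW.
have lip (p : R) (i : nat) : 0 < p -> p < d -> `|i%:R * p - t| < d -> c <= (1 - p * w) ^+ i.
  move=> p0 pd; rewrite ltr_norml => /andP[_ ipt].
  by apply: step_expR; rewrite ?small//; lra.
have nearp (p : R) (i : nat) : 0 < p -> p < d -> `|i%:R * p - t| < d ->
    `|iter i (J p) x - iter i (J p) y| <= e / 4.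
  move=> p0 pd ipt; rewrite -(ler_pM2l c0).
  apply: le_trans (ler_wpM2r _ (lip _ _ p0 pd ipt)) _ => //.
  apply: (le_trans (iter_resolvent_lipschitz _ _ _ p0 (small' _ pd))).
  by rewrite mulrA ltW.
have mid : `|iter m (J l) y - iter n (J k) y| <= e / 2.
  have H := iter_resolvent_dist m n l0 (small' _ ld) k0 (small' _ kd) Gyv.
  have c2 : 0 < c ^+ 2 by rewrite exprn_gt0.
  rewrite -(ler_pM2l c2).
  have cc : c ^+ 2 <= (1 - l * w) ^+ m * (1 - k * w) ^+ n.
    by rewrite expr2; apply: ler_pM; rewrite ?(ltW c0) ?lip.
  apply: le_trans (ler_wpM2r _ cc) _ => //; apply: (le_trans H).
  apply: (@le_trans _ _ (`|v| * h)).
    rewrite ler_wpM2l// -[leRHS](@ger0_norm _ h) ?(ltW h0)// -sqrtr_sqr.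
    rewrite ler_sqrt ?exprn_ge0 ?(ltW h0)//; apply: le_trans dh.
    move: mlt nkt; rewrite !ltr_norml => /andP[a1 a2] /andP[b1 b2].
    have : (m%:R * l - n%:R * k) ^+ 2 <= 4 * d.
      have : `|m%:R * l - n%:R * k| <= 2 * d by rewrite ler_norml; lra.
      move=> /(lerXn2r 2); rewrite !nnegrE => /(_ _ _) /le_trans.
      rewrite real_normK ?num_real// => -> //; rewrite ?mulr_ge0 ?(ltW d0)//.
      by rewrite exprMn -natrX ler_pM2l// expr2 ger_pMr.
    have : m%:R * l ^+ 2 <= (t + 1) * d.
      by rewrite expr2 mulrA; apply: ler_pM; rewrite ?mulr_ge0 ?(ltW l0) ?(ltW k0) ?(ltW ld) ?(ltW kd)//; lra.
    have : n%:R * k ^+ 2 <= (t + 1) * d.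
      by rewrite expr2 mulrA; apply: ler_pM; rewrite ?mulr_ge0 ?(ltW l0) ?(ltW k0) ?(ltW ld) ?(ltW kd)//; lra.
    lra.
  have -> : `|v| * h = c ^+ 2 * (e / 2) * (`|v| / (`|v| + 1)) by rewrite /h; ring.
  rewrite -[leRHS]mulr1 ler_wpM2l//.
    by rewrite ltW// mulr_gt0// divr_gt0.
  by rewrite ler_pdivrMr ?ltr_wpDl// mul1r lerDl.
have := nearp l m l0 ld mlt; have := nearp k n k0 kd nkt; rewrite distrC.
have := ler_distD (iter n (J k) y) (iter m (J l) x) (iter n (J k) x).
have := ler_distD (iter m (J l) y) (iter m (J l) x) (iter n (J k) y).
lra.
Qed.

Lemma truncn_mesh (t l : R) : 0 <= t -> 0 < l ->
  `|(Num.truncn (t / l))%:R * l - t| <= l.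
Proof.
move=> t0 l0.
have /truncn_itv /andP[] : 0 <= t / l by rewrite divr_ge0 ?(ltW l0).
rewrite ler_pdivlMr// ltr_pdivrMr// -natr1 [(_ + 1) * _]mulrDl mul1r => a b.
by rewrite ler_norml; lra.
Qed.

Lemma mesh_near (t d : R) : 0 <= t -> 0 < d ->
  exists l m, 0 < l < d /\ `|m%:R * l - t| < d.
Proof.
move=> t0 d0; exists (d / 2), (Num.truncn (t / (d / 2))).
have h0 : 0 < d / 2 by rewrite divr_gt0.
have hd : d / 2 < d by lra.
by split; [rewrite h0|exact: le_lt_trans (truncn_mesh _ _) _].
Qed.

(** The limit is characterised by all pairs (l, m) with l small and m l near t, not only by l = t /
    n. Steps of equal length can then be concatenated, which gives the semigroup law, and t can be
    moved, which gives continuity. *)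
Lemma semigroup_ex (t : R) x : exists z : V, 0 <= t -> forall e : R, 0 < e ->
  exists2 d : R, 0 < d & forall l m, 0 < l < d -> `|m%:R * l - t| < d ->
    `|iter m (J l) x - z| <= e.
Proof.
have [t0|] := boolP (0 <= t); last by exists 0.
pose l (i : nat) : R := i.+1%:R^-1.
pose m (i : nat) := Num.truncn (t / l i).
pose z i := iter (m i) (J (l i)) x.
have l0 i : 0 < l i by rewrite invr_gt0.
have near_lm (d : R) : 0 < d -> \forall i \near \oo, l i < d.
  by move=> d0; near=> i; near: i; exact: near_infty_natSinv_lt (PosNum d0).
have cz : cvgn z.
  apply/cauchy_cvgP/cauchyP => e e0.
  have e2 : 0 < e / 2 by rewrite divr_gt0.
  have [d d0 H] := iter_cauchy x t0 e2.
  have [p [i [pd ipt]]] := mesh_near t0 d0.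
  exists (iter i (J p) x).
  suff : \forall j \near \oo, ball (iter i (J p) x) e (z j) by [].
  near=> j; rewrite -ball_normE /=.
  have ljd : l j < d by near: j; exact: near_lm.
  apply: le_lt_trans (H _ _ _ _ pd _ ipt _) _; rewrite ?l0//; last lra.
  by apply: le_lt_trans ljd; exact: truncn_mesh.
exists (limn z) => _ e e0.
have e2 : 0 < e / 2 by rewrite divr_gt0.
have [d d0 H] := iter_cauchy x t0 e2.
exists d => // p i pd ipt.
have /cvgrPdist_le/(_ _ e2) cz' : z @ \oo --> limn z by [].
near \oo => j.
have ljd : l j < d by near: j; exact: near_lm.
have : `|limn z - z j| <= e / 2 by near: j.
have : `|iter i (J p) x - z j| <= e / 2.
  apply: (H _ _ _ _ pd _ ipt _); rewrite ?l0//.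
  by apply: le_lt_trans ljd; exact: truncn_mesh.
have := ler_distD (z j) (iter i (J p) x) (limn z).
rewrite (distrC (z j)); lra.
Unshelve. all: by end_near.
Qed.

Definition semigroup_of (t : R) (x : V) : V := sval (cid (semigroup_ex t x)).
Local Notation S := semigroup_of.

Lemma semigroup_ofP t x : 0 <= t -> forall e : R, 0 < e ->
  exists2 d : R, 0 < d & forall l m, 0 < l < d -> `|m%:R * l - t| < d ->
    `|iter m (J l) x - S t x| <= e.
Proof. by rewrite /S; case: cid. Qed.

Lemma semigroup_of0 : S 0 = id.
Proof.
apply/funext => x; apply/eqP; rewrite -subr_eq0 -normr_eq0 eq_le normr_ge0 andbT.
apply/ler_addgt0Pr => e e0; rewrite add0r.
have [d d0 H] := semigroup_ofP x (lexx 0) e0.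
rewrite distrC; apply: (H (d / 2) 0%N).
  lra.
by rewrite mul0r subrr normr0.
Qed.

(** With a common step [l], m + n iterations approximate time s + t and split as m iterations after
    n. Replacing the inner n iterations by [S t x] costs the Lipschitz factor 1 / c. *)
Lemma semigroup_ofD s t x : 0 <= s -> 0 <= t -> S (s + t) x = S s (S t x).
Proof.
move=> s0 t0; apply/eqP; rewrite -subr_eq0 -normr_eq0 eq_le normr_ge0 andbT.
apply/ler_addgt0Pr => e e0; rewrite add0r.
have st0 : 0 <= s + t by rewrite addr_ge0.
pose c := expR (- (2 * w * (s + 1))).
have c0 : 0 < c := expR_gt0 _.
have e4 : 0 < e / 4 by rewrite divr_gt0.
have [d1 d10 H1] := semigroup_ofP x st0 e4.
have ce : 0 < c * (e / 4) by rewrite mulr_gt0.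
have [d2 d20 H2] := semigroup_ofP x t0 ce.
have [d3 d30 H3] := semigroup_ofP (S t x) s0 e4.
pose d := Num.min (Num.min (d1 / 2) d2) (Num.min d3 (Num.min 1 (2 * w)^-1)).
have d0 : 0 < d.
  by rewrite !lt_min d20 d30 ltr01 divr_gt0//= invr_gt0 mulr_gt0.
have dd1 : d <= d1 / 2 by rewrite /d !ge_min lexx.
have dd2 : d <= d2 by rewrite /d !ge_min lexx !orbT.
have dd3 : d <= d3 by rewrite /d !ge_min lexx !orbT.
have dd4 : d <= 1 by rewrite /d !ge_min lexx !orbT.
have dd5 : d <= (2 * w)^-1 by rewrite /d !ge_min lexx !orbT.
pose l := d / 2.
have l0 : 0 < l by rewrite divr_gt0.
have ld : l < d by rewrite /l; lra.
have lw : l < w^-1.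
  apply: (lt_le_trans ld); apply: (le_trans dd5).
  by rewrite lef_pV2 ?posrE ?mulr_gt0// ler_peMl ?ler1n// ltW.
pose m := Num.truncn (s / l); pose n := Num.truncn (t / l).
have ms : `|m%:R * l - s| <= l by exact: truncn_mesh.
have nt : `|n%:R * l - t| <= l by exact: truncn_mesh.
have A1 : `|iter (m + n) (J l) x - S (s + t) x| <= e / 4.
  apply: H1; first by rewrite l0/=; lra.
  rewrite natrD mulrDl.
  move: ms nt; rewrite ler_norml ltr_norml ler_norml => /andP[? ?] /andP[? ?].
  lra.
have A2 : `|iter n (J l) x - S t x| <= c * (e / 4).
  by apply: H2; [rewrite l0/=|apply: le_lt_trans nt _]; lra.
have A3 : `|iter m (J l) (S t x) - S s (S t x)| <= e / 4.
  by apply: H3; [rewrite l0/=|apply: le_lt_trans ms _]; lra.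
have A4 : `|iter m (J l) (iter n (J l) x) - iter m (J l) (S t x)| <= e / 4.
  rewrite -(ler_pM2l c0); apply: le_trans A2.
  apply: le_trans (iter_resolvent_lipschitz m _ _ l0 lw).
  rewrite ler_wpM2r//; apply: step_expR => //.
    by rewrite -ler_pdivlMr// -invfM (le_trans (ltW ld)).
  by move: ms; rewrite ler_norml => /andP[? ?]; lra.
move: A1; rewrite iterD distrC => A1.
have := ler_distD (iter m (J l) (iter n (J l) x)) (S (s + t) x) (S s (S t x)).
have := ler_distD (iter m (J l) (S t x)) (iter m (J l) (iter n (J l) x)) (S s (S t x)).
lra.
Qed.

(** For s close to t, a fine pair (l, m) with m l near s is also admissible for t, so one iterate is
    close to both values. *)
Lemma semigroup_of_continuous x :
  {within `[0, +oo[, continuous (fun t => S t x)}.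
Proof.
apply/subspace_continuousP => t /=; rewrite in_itv/= andbT => t0.
apply/cvgrPdist_le => e e0.
have e2 : 0 < e / 2 by rewrite divr_gt0.
have [d d0 H] := semigroup_ofP x t0 e2.
rewrite near_withinE.
have d20 : 0 < d / 2 by rewrite divr_gt0.
near=> s => /=; rewrite in_itv/= andbT => s0.
have st : `|s - t| < d / 2.
  by near: s; apply/nbhs_ballP; exists (d / 2) => //= y; rewrite /ball/= distrC.
have [d' d'0 H'] := semigroup_ofP x s0 e2.
have m0 : 0 < Num.min d' (d / 2) by rewrite lt_min d'0.
have [l [m [/andP[l0 +] +]]] := mesh_near s0 m0.
rewrite !lt_min => /andP[l1 l2] /andP[m1 m2].
have A1 : `|iter m (J l) x - S s x| <= e / 2 by apply: H' => //; rewrite l0.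
have A2 : `|iter m (J l) x - S t x| <= e / 2.
  apply: H; first by rewrite l0/=; lra.
  move: st m2; rewrite !ltr_norml => /andP[? ?] /andP[? ?].
  lra.
have := ler_distD (iter m (J l) x) (S t x) (S s x); rewrite (distrC _ (iter _ _ _)).
lra.
Unshelve. all: by end_near.
Qed.

Lemma op_pow_resolvent l n x : 0 < l -> l < w^-1 ->
  [set v | op_pow ((op_add op_id (op_scale l G))^-1)%relation n (x, v)] =
  [set iter n (J l) x].
Proof.
move=> l0 lw.
have E (a b : V) : op_add op_id (op_scale l G) (b, a) <-> b = J l a.
  split.
    rewrite /op_add /op_id /op_scale /= => -[v [v' [<- [[u1 u2] Gu [<- <-]] ->]]].
    by rewrite (resolvent_unique l0 lw Gu).
  move=> ->; exists (J l a), (a - J l a); split => //=.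
    exists (J l a, l^-1 *: (a - J l a)); first exact: resolventP.
    by rewrite /= scalerA divff ?gt_eqF// scale1r.
  by rewrite addrC subrK.
elim: n x => [|n ih] x.
  by apply/seteqP; split => v /=; rewrite /op_pow /=.
apply/seteqP; split => v /=.
  move=> [y /= Hy /E ->]; congr (J l _).
  by have := ih x; rewrite predeqE => /(_ y) [/(_ Hy)].
move=> ->; exists (iter n (J l) x) => /=; last exact/E.
by have := ih x; rewrite predeqE => /(_ (iter n (J l) x)) [_]; exact.
Qed.

Lemma semigroup_of_generates : generates G S.
Proof.
move=> x _ t t0; exists (fun n => iter n (J (t / n%:R)) x).
  near=> n.
  have n0 : (0 < n)%N by near: n; exact: nbhs_infty_gt.
  apply: op_pow_resolvent; first by rewrite divr_gt0// ltr0n.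
  rewrite ltr_pdivrMr ?ltr0n// mulrC -ltr_pdivrMr ?invr_gt0// invrK.
  by near: n; exact: nbhs_infty_gtr.
apply/cvgrPdist_le => e e0.
have [d d0 H] := semigroup_ofP x (ltW t0) e0.
near=> n.
have n0 : 0 < n%:R :> R by rewrite ltr0n; near: n; exact: nbhs_infty_gt.
rewrite distrC; apply: H.
  rewrite divr_gt0//= ltr_pdivrMr// mulrC -ltr_pdivrMr//.
  by near: n; exact: nbhs_infty_gtr.
by rewrite mulrC mulfVK ?gt_eqF// subrr normr0.
Unshelve. all: by end_near.
Qed.

End exponential_formula.

Lemma exponential_formula (R : realType) (V : completeNormedModType R)
    (G : set (V * V)) (w : R) : 0 < w ->
  (forall l : R, 0 < l -> l < w^-1 ->
    forall u1 v1 u2 v2, G (u1, v1) -> G (u2, v2) ->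
    (1 - l * w) * `|u1 - u2| <= `|u1 - u2 + l *: (v1 - v2)|) ->
  (forall l : R, 0 < l -> l < w^-1 ->
    forall f, exists u v, G (u, v) /\ u + l *: v = f) ->
  closure (op_dom G) = setT ->
  exists S : R -> V -> V, continuous_semigroup S /\ generates G S.
Proof.
move=> w0 quasi range dom.
exists (semigroup_of w0 quasi range dom); split; last exact: semigroup_of_generates.
split; first exact: semigroup_of0.
- by move=> s t s0 t0; apply/funext => x; exact: semigroup_ofD.
- exact: semigroup_of_continuous.
Qed.

(** * Lipschitz perturbations *)

Lemma contraction_fixpoint (R : realType) (V : completeNormedModType R)
    (f : V -> V) (q : R) : 0 <= q -> q < 1 ->
  (forall x y, `|f x - f y| <= q * `|x - y|) -> exists x, x = f x.
Proof.
move=> q0 q1 fq.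
have ff : isFun V V setT setT f by constructor.
pose F : {fun [set: V] >-> [set: V]} := HB.pack f ff.
have [] := @banach_fixed_point R V setT F _ closedT _.
- exists (NngNum q0); split => // -[x y] _ /=; exact: fq.
- by exists 0.
- by move=> x _ xE; exists x.
Qed.

Lemma op_dom_perturbation (R : realType) (V : normedModType R)
    (A : set (V * V)) (B : V -> V) :
  op_dom A `<=` op_dom (op_add A (op_graph B)).
Proof. by move=> y [v Ayv]; exists (v + B y), v, (B y). Qed.

Section lipschitz_perturbation.
Context {R : realType} {V : completeNormedModType R}.
Variables (A : set (V * V)) (B : V -> V) (L : R).
Hypothesis L_gt0 : 0 < L.
Hypothesis A_accretive : accretive A.
Hypothesis A_range : forall (l : R), 0 < l -> forall f, exists u v, A (u, v) /\ u + l *: v = f.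
Hypothesis B_lipschitz : forall x y, `|B x - B y| <= L * `|x - y|.

Let G := op_add A (op_graph B).

Lemma perturbation_quasi (l : R) : 0 < l -> forall u1 v1 u2 v2,
  G (u1, v1) -> G (u2, v2) ->
  (1 - l * L) * `|u1 - u2| <= `|u1 - u2 + l *: (v1 - v2)|.
Proof.
move=> l0 u1 v1 u2 v2; rewrite /G /op_add /op_graph /=.
move=> [a1 [_ [Aa1 -> ->]]] [a2 [_ [Aa2 -> ->]]].
have H := A_accretive Aa1 Aa2 l0; have HB := B_lipschitz u1 u2.
have -> : u1 - u2 + l *: (a1 + B u1 - (a2 + B u2)) =
  (u1 - u2 + l *: (a1 - a2)) - (- (l *: (B u1 - B u2))).
  by rewrite opprK -[RHS]addrA -scalerDr opprD addrACA.
apply: le_trans (lerB_dist _ _).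
rewrite normrN normrZ (gtr0_norm l0) mulrBl mul1r lerB// -mulrA.
by rewrite ler_wpM2l// ltW.
Qed.

(** A solution is a fixed point of x |-> J (f - l B x), where J, the resolvent of [A], is
    nonexpansive; the map contracts because l L < 1. *)
Lemma perturbation_range (l : R) : 0 < l -> l < L^-1 ->
  forall f, exists u v, G (u, v) /\ u + l *: v = f.
Proof.
move=> l0 lL f.
have J_ex g : exists u, A (u, l^-1 *: (g - u)).
  have [u [v [Auv <-]]] := A_range l0 g; exists u.
  by rewrite addrAC subrr add0r scalerA mulVf ?scale1r ?gt_eqF.
pose J g := sval (cid (J_ex g)).
have JP g : A (J g, l^-1 *: (g - J g)) by rewrite /J; case: cid.
have J1 g h : `|J g - J h| <= `|g - h|.
  apply: (le_trans (A_accretive (JP g) (JP h) l0)).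
  rewrite -scalerBr scalerA divff ?gt_eqF// scale1r.
  by rewrite opprD opprK addrACA (addrC (J g)) subrK (addrC (- h)) addKr.
have lL1 : l * L < 1 by rewrite -ltr_pdivlMr// div1r.
have [x xE] : exists x, x = J (f - l *: B x).
  apply: (@contraction_fixpoint _ _ _ (l * L)) => //; first by rewrite mulr_ge0 ?ltW.
  move=> x y; apply: (le_trans (J1 _ _)).
  rewrite opprB addrC addrA subrK -scalerBr normrZ gtr0_norm// -mulrA.
  by rewrite ler_wpM2l ?(ltW l0)// distrC.
exists x, (l^-1 *: (f - l *: B x - x) + B x); split.
  exists (l^-1 *: (f - l *: B x - x)), (B x); split => //=.
  by rewrite {1 3}xE; exact: JP.
rewrite scalerDr scalerA divff ?gt_eqF// scale1r.
by rewrite addrC -addrA (addrC (l *: _)) addrA subrK subrK.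
Qed.

Lemma perturbation_quasi_m_accretive : quasi_m_accretive G.
Proof.
split.
  by exists L => // l l0 _ u1 v1 u2 v2; exact: perturbation_quasi.
have shiftP u v : op_add G (op_scale L op_id) (u, v) <-> G (u, v - L *: u).
  split=> [[a [b []]]|Guv].
    rewrite /op_scale /op_id /= => Ga [[x y] /= <- [-> <-]] ->.
    by rewrite addrK.
  exists (v - L *: u), (L *: u); split => //=; last by rewrite subrK.
  by exists (u, u).
exists L => //; split.
  move=> u1 v1 u2 v2 /shiftP G1 /shiftP G2 l l0.
  have c0 : 0 < 1 + l * L by rewrite ltr_wpDr// mulr_ge0 ?ltW.
  (* Dividing by 1 + l L turns a step [l] for G + L I into the step l / (1 + l L) for G, and the
     factor 1 - l L / (1 + l L) is exactly the inverse of 1 + l L. *)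
  have k0 : 0 < l / (1 + l * L) by rewrite divr_gt0.
  have := perturbation_quasi k0 G1 G2; rewrite -(ler_pM2l c0) mulrA.
  have -> : (1 + l * L) * (1 - l / (1 + l * L) * L) = 1 by field; rewrite gt_eqF.
  rewrite mul1r => /le_trans; apply.
  rewrite -{1}(gtr0_norm c0) -normrZ le_eqVlt; apply/orP; left; apply/eqP.
  congr (`|_|); rewrite [in LHS]scalerDr scalerA mulrCA divff ?gt_eqF// mulr1.
  have -> : v1 - L *: u1 - (v2 - L *: u2) = v1 - v2 - L *: (u1 - u2).
    by rewrite opprD opprK addrACA scalerBr opprB (addrC (_ *: u2)).
  rewrite [l *: (v1 - v2 - _)]scalerBr scalerA scalerDl scale1r.
  by rewrite -addrA (addrC ((l * L) *: _)) subrK.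
apply/seteqP; split => // f _.
have c0 : 0 < 1 + L by rewrite ltr_wpDl.
(* The equation u + (v + L u) = f, divided by 1 + L, is a resolvent equation for G with step 1 / (1
   + L), which is below 1 / L. *)
have [||u [v [Guv E]]] := @perturbation_range (1 + L)^-1 _ _ ((1 + L)^-1 *: f).
- by rewrite invr_gt0.
- by rewrite ltf_pV2 ?posrE// ltrDr.
exists u, u, (v + L *: u); split => //=; first by apply/shiftP; rewrite addrK.
have := congr1 (fun x => (1 + L) *: x) E; rewrite scalerDr !scalerA divff ?gt_eqF//.
by rewrite !scale1r scalerDl scale1r => <-; rewrite -addrA (addrC v).
Qed.

Lemma perturbation_generates : closure (op_dom A) = setT ->
  exists S : R -> V -> V, continuous_semigroup S /\ generates G S.
Proof.
move=> domA; apply: (exponential_formula L_gt0).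
- by move=> l l0 _ u1 v1 u2 v2; exact: perturbation_quasi.
- exact: perturbation_range.
apply/seteqP; split => // x _.
have : closure (op_dom A) x by rewrite domA.
exact/closureS/op_dom_perturbation.
Qed.


End lipschitz_perturbation.

(** * Uniqueness of the generated semigroup *)

Lemma generates_unique (R : realType) (V : normedModType R) (G : set (V * V))
    (S S' : R -> V -> V) : closure (op_dom G) = setT ->
  continuous_semigroup S -> continuous_semigroup S' ->
  generates G S -> generates G S' ->
  forall t u, 0 <= t -> S t u = S' t u.
Proof.
move=> domG [S0 _ _] [S'0 _ _] GS GS' t u; rewrite le_eqVlt => /predU1P[<-|t0].
  by rewrite S0 S'0.
have du : closure (op_dom G) u by rewrite domG.
have [a Ea ca] := GS u du t t0; have [b Eb cb] := GS' u du t t0.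
apply: (@cvg_unique _ (@norm_hausdorff _ V) (a @ \oo)) => //.
apply: cvg_trans cb; apply: near_eq_cvg; near=> n.
have : [set a n] = [set b n].
  by transitivity [set v | op_pow ((op_add op_id (op_scale (t / n%:R) G))^-1)%relation n
                 (u, v)]; [apply/esym; near: n|near: n].
by rewrite predeqE => /(_ (a n)) [/(_ erefl)].
Unshelve. all: by end_near.
Qed.

(** * The space L1 *)

Section L1_basics.
Context {R : realType}.
Local Notation mu := (@lebesgue_measure R).
Local Notation TR := (measurableTypeR R).
Implicit Types u v : L1 R.

Lemma measurable_L1 u : measurable_fun [set: TR] (u : TR -> R).
Proof. exact: (@measurable_funPT _ _ _ _ (fromL1 u)). Qed.

Lemma integrable_L1 u : mu.-integrable setT (EFin \o u).
Proof. exact/Lfun1_integrable/fromL1_subproof. Qed.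

Lemma L1_ex (f : R -> R) : mu.-integrable setT (EFin \o f) ->
  exists u : L1 R, (u : R -> R) = f %[ae mu].
Proof.
move=> intf; have Lf : f \in Lfun mu 1 by apply/Lfun1_integrable.
by exists (toL1 (Lfun_Sub (lexx _) Lf)); exact: toL1E.
Qed.

Lemma ae_app (P Q : TR -> Prop) : (\forall x \ae mu, P x) ->
  (\forall x \ae mu, P x -> Q x) -> \forall x \ae mu, Q x.
Proof. by move=> aeP aePQ; apply: filter_app aePQ aeP. Qed.

Lemma ae_mono (P Q : TR -> Prop) : (forall x, P x -> Q x) ->
  (\forall x \ae mu, P x) -> \forall x \ae mu, Q x.
Proof. by move=> PQ aeP; apply: ae_app aeP _; exact: aeW. Qed.

Lemma ae_and (P Q : TR -> Prop) : (\forall x \ae mu, P x) ->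
  (\forall x \ae mu, Q x) -> \forall x \ae mu, P x /\ Q x.
Proof. by move=> aeP aeQ; apply: (ae_app aeP); apply: ae_mono aeQ => x; split. Qed.

Lemma L1B u v : (u - v : R -> R) = (u \- v) %[ae mu].
Proof.
apply: (ae_app (L1D u (- v))); apply: ae_mono (L1N v) => x H /(_ I) /= -> _.
by rewrite H.
Qed.

Lemma L1_distE u v : (`|u - v|%:E = \int[mu]_x `|(u x - v x)%:E|)%E.
Proof.
rewrite L1_normE; apply: ae_eq_integral => //.
- apply: measurableT_comp => //; apply/measurable_EFinP; exact: measurable_L1.
- apply: measurableT_comp => //; apply/measurable_EFinP.
  by apply: measurable_funB; exact: measurable_L1.
- by apply: ae_mono (L1B u v) => x + xT => /(_ xT) ->.
Qed.

Lemma L1_dist u v : `|u - v| = \int[mu]_x `|u x - v x|.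
Proof. by rewrite /Rintegral -[LHS]/(fine (`|u - v|%:E)) L1_distE. Qed.

(** The Riesz-Fischer argument: the increments have an integrable sum [g], so the sequence converges
    almost everywhere, and |u 0| + g dominates it. *)
Lemma L1_series_cvg (u : nat -> L1 R) :
  (forall n, `|u n.+1 - u n| <= 2^-1 ^+ n) -> cvgn u.
Proof.
move=> du.
pose d n (x : TR) : \bar R := `|(u n.+1 x - u n x)%:E|%E.
have d0 n x : (0 <= d n x)%E by exact: abse_ge0.
have md n : measurable_fun setT (d n).
  apply: measurableT_comp => //; apply/measurable_EFinP.
  by apply: measurable_funB; exact: measurable_L1.
pose g x := (\sum_(n <oo) d n x)%E.
have mg : measurable_fun setT g by apply: ge0_emeasurable_sum.
have g0 x : (0 <= g x)%E by apply: nneseries_ge0.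
have ig : mu.-integrable setT g.
  apply/integrableP; split => //.
  under eq_integral do rewrite gee0_abs//.
  rewrite integral_nneseries//.
  apply: (@le_lt_trans _ _ 2%:E); last exact: ltry.
  apply: lime_le; first by apply: is_cvg_nneseries => n _ _; exact: integral_ge0.
  apply: nearW => n; rewrite (eq_bigr (fun k => `|u k.+1 - u k|%:E)); last first.
    by move=> k _; rewrite L1_distE.
  rewrite sumEFin lee_fin.
  apply: (@le_trans _ _ (2 - 2 * 2^-1 ^+ n)); last by rewrite gerBl mulr_ge0// exprn_ge0.
  rewrite big_mkord; elim: n => [|n ih]; first by rewrite big_ord0 expr0; lra.
  rewrite big_ord_recr /=; have := du n; rewrite exprS; lra.
(* The limit superior is measurable on the whole line and agrees with the limit wherever the latter
   exists. *)
have mf : measurable_fun setT (fun x : TR => fine (limn_esup (fun n => (u n x)%:E))).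
  apply: (measurableT_comp (@fine_measurable R setT measurableT)).
  apply: measurable_fun_limn_esup => n.
  by apply/measurable_EFinP; exact: measurable_L1.
have gS n x : (\sum_(0 <= k < n) d k x <= g x)%E.
  by apply: nneseries_lim_ge => k _ _; exact: d0.
have cv : {ae mu, forall x, setT x -> (fun n => (u n x)%:E) @ \oo -->
    (fine (limn_esup (fun n => (u n x)%:E)))%:E}.
  apply: ae_mono (integrable_ae measurableT ig) => x /(_ I) gx _.
  pose ux n := u n x.
  have /normed_cvg : cvgn [normed series (telescope ux)].
    apply: nondecreasing_is_cvgn.
      by apply: nondecreasing_series => n _ _; exact: normr_ge0.
    exists (fine (g x)) => _ [n _ <-] /=.
    rewrite -lee_fin fineK//; apply: le_trans (gS n x).
    by rewrite sumEFin lexx.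
  rewrite telescopeK => /cvg_ex[l ul].
  have cux : ux @ \oo --> l + ux 0%N.
    have H : (fun n => ux n - ux 0%N + ux 0%N) @ \oo --> l + ux 0%N.
      by apply: cvgD; [exact: ul|exact: cvg_cst].
    apply: cvg_trans H; apply: near_eq_cvg; apply: nearW => n /=.
    by rewrite subrK.
  have ce : (EFin \o ux) @ \oo --> (l + ux 0%N)%:E.
    by apply/fine_cvgP; split; [exact: nearW|exact: cux].
  by have [_ ->] := cvg_limn_einf_sup ce.
have ig0 : mu.-integrable setT (fun x => `|(u 0%N x)%:E| + g x)%E.
  apply: integrableD => //; apply: (@integrable_abse _ _ _ mu setT (EFin \o u 0%N)).
  exact: integrable_L1.
have bd : {ae mu, forall x n, setT x -> (`|(u n x)%:E| <= `|(u 0%N x)%:E| + g x)%E}.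
  apply: aeW => x n _; apply: le_trans (leeD (lexx _) (gS n x)).
  rewrite sumEFin -EFinD lee_fin.
  elim: n => [|n ih]; first by rewrite big_nil addr0.
  rewrite big_nat_recr//= addrA.
  apply: (le_trans _ (lerD ih (lexx _))).
  by rewrite -[X in `|X| <= _](subrKC (u n x)) ler_normD.
have [] := @dominated_convergence _ _ _ mu setT measurableT _ _ _ _ _ cv ig0 bd.
- move=> n; apply/measurable_EFinP; exact: measurable_L1.
- exact/measurable_EFinP.
move=> il H _; have [v vE] := L1_ex il.
apply/cvg_ex; exists v; apply/cvgrPdist_le => e e0.
have : (fun n => `|u n - v|%:E) @ \oo --> 0%E.
  apply: cvg_trans H; apply: near_eq_cvg; apply: nearW => n /=.
  rewrite L1_distE; apply: ae_eq_integral => //.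
  - apply/measurable_EFinP.
    apply: (@measurableT_comp _ _ _ _ _ _ (@Num.norm R R)) => //.
    by apply: measurable_funB; [exact: measurable_L1|exact: mf].
  - apply: (@measurableT_comp _ _ _ _ _ _ (@abse R)) => //.
    by apply/measurable_EFinP; apply: measurable_funB; exact: measurable_L1.
  - by apply: ae_mono vE => x + xT => /(_ xT) /= ->.
move=> /fine_cvgP [_ /cvgrPdist_le /(_ _ e0)]; apply: filterS => n /=.
by rewrite sub0r normrN normr_id distrC.
Qed.

Lemma L1_complete (F : set_system (L1 R)) : ProperFilter F -> cauchy F -> cvg F.
Proof.
move=> FF /cauchyP cF.
have r0 n : 0 < (2^-1 ^+ n / 4 : R) by rewrite divr_gt0// exprn_gt0.
pose c n := sval (cid (cF _ (r0 n))).
have cP n : F (ball (c n) (2^-1 ^+ n / 4)) by rewrite /c; case: cid.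
(* Two sets of a proper filter meet, so consecutive centres differ by less than the sum of the two
   radii. *)
have /L1_series_cvg/cvg_ex[l cl] n : `|c n.+1 - c n| <= 2^-1 ^+ n.
  have [x []] := filter_ex (filterI (cP n) (cP n.+1)).
  rewrite -!ball_normE /= => h1 h2.
  have := ler_distD x (c n.+1) (c n); rewrite (distrC x) => /le_trans; apply.
  have i2 : 0 < 2^-1 :> R by rewrite invr_gt0.
  have := exprn_gt0 n i2; rewrite exprS in h2; lra.
apply/cvg_ex; exists l; apply/cvgrPdist_le => e e0.
have e2 : 0 < e / 2 by rewrite divr_gt0.
have [n /= [h1 h2]] : exists n, `|l - c n| <= e / 2 /\ 2^-1 ^+ n / 4 <= e / 2.
  near \oo => n; exists n; split.
    by near: n; move/cvgrPdist_le : cl => /(_ _ e2).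
  suff : 2^-1 ^+ n <= e by move=> ?; lra.
  near: n; have /cvgrPdist_le /(_ _ e0) : GRing.exp (2^-1 : R) @ \oo --> 0.
    by apply: cvg_expr; rewrite ger0_norm ?invr_ge0//; lra.
  by apply: filterS => n; rewrite sub0r normrN ger0_norm ?exprn_ge0// invr_ge0.
apply: filterS (cP n) => x; rewrite -ball_normE /= => h3.
have := ler_distD (c n) l x; lra.
Unshelve. all: by end_near.
Qed.

End L1_basics.

HB.instance Definition _ (R : realType) := Uniform_isComplete.Build (L1 R) (@L1_complete R).

(** * Lipschitz bound for the convolution with K' *)

Section convolution_bound.
Context {R : realType}.
Local Notation mu := (@lebesgue_measure R).
Local Notation TR := (measurableTypeR R).

Let e (x : R) : R := expR (- `|x|).

Let e_cont : continuous e.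
Proof.
move=> x; apply: continuous_comp; last exact: continuous_expR.
by apply: continuousN; exact: norm_continuous.
Qed.

Let e_shift_cont y : continuous (fun x => e (x - y)).
Proof.
move=> x; apply: continuous_comp; last exact: e_cont.
by apply: continuousB; [exact: cvg_id|exact: cst_continuous].
Qed.

Let integral_e_shift y :
  (\int[mu]_x (e (x - y))%:E = \int[mu]_x (e x)%:E)%E.
Proof.
have dF : (fun x : R => x - y)^`()%classic = cst (1 : R).
  by apply/funext => x; rewrite derive1E derive_val/= subr0.
rewrite [RHS](@increasing_ge0_integration_by_substitutionT _ (fun x => x - y))//.
- by apply: eq_integral => x _; rewrite dF /= mulr1.
- by move=> a b ab; rewrite ltrD2r.
- by rewrite dF; exact: cst_continuous.
- by rewrite dF; exact: is_cvg_cst.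
- by rewrite dF; exact: is_cvg_cst.
- exact: cvg_addrr_Ny.
- exact: cvg_addrr.
- by move=> x; exact: expR_ge0.
Qed.

Let integral_e : (\int[mu]_x (e x)%:E = 2%:E)%E.
Proof.
rewrite ge0_symfun_integralT//; last 2 first.
  by move=> x; exact: expR_ge0.
  by move=> x; rewrite /e /= normrN.
rewrite -set_itvcy (@ge0_continuous_FTC2y _ _ (fun x => - expR (- x)) _ 0)//.
- by rewrite oppr0 expR0 -EFinB sub0r opprK mule1.
- by move=> x _; exact: expR_ge0.
- by apply: continuous_subspaceT; exact: e_cont.
- by rewrite -oppr0; apply: cvgN; exact: cvgr_expR.
- by apply: cvg_at_right_filter; apply: cvgN; apply: continuous_comp;
    [exact: opp_continuous|exact: continuous_expR].
- move=> x; rewrite in_itv/= andbT => x0.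
  by rewrite derive1E derive_val /e gtr0_norm// mulrN1 opprK.
Qed.

Let mw (f : R -> R) : measurable_fun [set: TR] (f : TR -> R) ->
  measurable_fun [set: TR * TR] (fun z : TR * TR => `|(dK (z.1 - z.2) * f z.2)%:E|%E).
Proof.
move=> mf; apply: (@measurableT_comp _ _ _ _ _ _ (@abse R)) => //.
apply/measurable_EFinP; apply: measurable_funM.
  apply: (measurableT_comp (@measurable_dK R)).
  by apply: measurable_funB; [exact: measurable_fst|exact: measurable_snd].
exact: (measurableT_comp mf measurable_snd).
Qed.

Let integrable_dK_app (u : L1 R) x :
  mu.-integrable setT (EFin \o (fun y => dK (x - y) * u y)).
Proof.
have mu_ := measurable_L1 u.
apply: (@le_integrable _ _ _ mu _ _ _ (EFin \o u)) => //.
- apply/measurable_EFinP; apply: measurable_funM => //.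
  apply: (measurableT_comp (@measurable_dK R)).
  by apply: measurable_funB => //; exact: measurable_cst.
- move=> y _ /=; rewrite lee_fin normrM ler_piMl//.
  apply: (le_trans (normr_dK_le _)).
  by rewrite -expR0 ler_expR oppr_le0.
- exact: integrable_L1.
Qed.

(* Young's inequality, with [|K'| <= exp(-|x|)], whose integral is 2. *)
Lemma conv_dK_lipschitz (u v : L1 R) : `|conv_dK u - conv_dK v| <= 2 * `|u - v|.
Proof.
rewrite -lee_fin L1_distE EFinM L1_distE.
pose w x := u x - v x.
have mu_ := measurable_L1 u; have mv := measurable_L1 v.
have mw' : measurable_fun [set: TR] (w : TR -> R) by exact: measurable_funB.
pose F (z : TR * TR) : \bar R := `|(dK (z.1 - z.2) * w z.2)%:E|%E.
have mF : measurable_fun setT F by exact: mw.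
have F0 z : (0 <= F z)%E by exact: abse_ge0.
apply: (@le_trans _ _ (\int[mu]_x \int[mu]_y F (x, y))%E).
  apply: ae_ge0_le_integral => //.
  - apply: (@measurableT_comp _ _ _ _ _ _ (@abse R)) => //.
    by apply/measurable_EFinP; apply: measurable_funB; exact: measurable_L1.
  - by move=> x _; exact: integral_ge0.
  - exact: (@measurable_fun_fubini_tonelli_F _ _ TR TR R mu F).
  - have Hu := toL1E (Lfun_Sub (lexx _) (Lfun_conv_dK u)).
    have Hv := toL1E (Lfun_Sub (lexx _) (Lfun_conv_dK v)).
    apply: ae_mono (ae_and Hu Hv) => x [/(_ Logic.I) -> /(_ Logic.I) ->] _ /=.
    rewrite -RintegralB//.
    apply: (@le_trans _ _ `|(\int[mu]_y (dK (x - y) * w y))%:E|%E).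
      rewrite le_eqVlt; apply/orP; left; apply/eqP; congr (`|_%:E|%E).
      by apply: eq_Rintegral => y _; rewrite /w mulrBr.
    have mF' : measurable_fun setT (fun y : TR => (dK (x - y) * w y)%:E).
      apply/measurable_EFinP; apply: measurable_funM => //.
      apply: (measurableT_comp (@measurable_dK R)).
      by apply: measurable_funB => //; exact: measurable_cst.
    rewrite abse_EFin EFin_normr_Rintegral//; first exact: le_abse_integral.
    have := integrableB measurableT (integrable_dK_app u x) (integrable_dK_app v x).
    by apply: eq_integrable => // y _; rewrite /w /= -EFinB mulrBr.
rewrite (@fubini_tonelli _ _ TR TR R mu mu F)//.
rewrite -ge0_integralZl//; last first.
  apply: (@measurableT_comp _ _ _ _ _ _ (@abse R)) => //; exact/measurable_EFinP.
apply: ge0_le_integral => //.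
- by move=> y _; exact: integral_ge0.
- exact: (@measurable_fun_fubini_tonelli_G _ _ TR TR R mu F).
- apply: measurable_funeM; apply: (@measurableT_comp _ _ _ _ _ _ (@abse R)) => //.
  exact/measurable_EFinP.
move=> y _.
rewrite -integral_e -(integral_e_shift y) muleC -ge0_integralZl//; last 2 first.
- by apply/measurable_EFinP; apply: continuous_measurable_fun; exact: e_shift_cont.
- by move=> x _; rewrite lee_fin expR_ge0.
apply: ge0_le_integral => //.
- by apply: (measurableT_comp mF); exact: measurable_pair2.
- apply: measurable_funeM.
  by apply/measurable_EFinP; apply: continuous_measurable_fun; exact: e_shift_cont.
- by move=> x _; rewrite /F/= -EFinM lee_fin normrM mulrC ler_wpM2l// normr_dK_le.
Qed.

End convolution_bound.

(** * Integrals over intervals and primitives *)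

Section interval_integral.
Context {R : realType}.
Local Notation mu := (@lebesgue_measure R).
Local Notation TR := (measurableTypeR R).
Implicit Types (w f g : R -> R) (x y z : R).

Definition loc_int w := measurable_fun [set: TR] (w : TR -> TR) /\
  forall x y, mu.-integrable `[x, y] (EFin \o w).

(** For y < x the interval is empty and the value is 0, not the negative of the integral from y to
    x; statements about increments therefore order their endpoints. *)
Definition itg w x y : R := \int[mu]_(z in `[x, y]) w z.

Lemma loc_int_sub w (A : set TR) x y : loc_int w -> measurable A ->
  A `<=` `[x, y] -> mu.-integrable A (EFin \o w).
Proof. by move=> [_ iw] mA Axy; apply: (integrableS _ mA Axy (iw x y)); exact: measurable_itv. Qed.

Lemma integrable_loc_int w : mu.-integrable setT (EFin \o w) -> loc_int w.
Proof.
move=> iw; split; first by have /measurable_int/measurable_EFinP := iw.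
by move=> x y; apply: (integrableS _ _ _ iw) => //; exact: measurable_itv.
Qed.

Lemma continuous_loc_int w : continuous w -> loc_int w.
Proof.
move=> cw; split; first exact: continuous_measurable_fun.
move=> x y; apply: continuous_compact_integrable; first exact: segment_compact.
exact: continuous_subspaceT.
Qed.

Lemma open_positive w : continuous w -> open [set x | 0 < w x].
Proof.
move=> cw; rewrite (_ : [set _ | _] = w @^-1` [set x | 0 < x])//.
by apply: open_comp => // x _; exact: (@cw x).
Qed.

Lemma measurable_positive w : continuous w -> measurable [set x : TR | 0 < w x].
Proof. by move=> cw; apply: open_measurable; exact: open_positive. Qed.

Lemma loc_int_cst (c : R) : loc_int (cst c).
Proof. by apply: continuous_loc_int; exact: cst_continuous. Qed.

Lemma loc_intD f g : loc_int f -> loc_int g -> loc_int (fun x => f x + g x).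
Proof.
move=> [mf intf] [mg intg]; split; first exact: measurable_funD.
by move=> x y; apply: (integrableD _ (intf x y) (intg x y)).
Qed.

Lemma loc_intB f g : loc_int f -> loc_int g -> loc_int (fun x => f x - g x).
Proof.
move=> [mf intf] [mg intg]; split; first exact: measurable_funB.
by move=> x y; apply: (integrableB _ (intf x y) (intg x y)).
Qed.

Lemma loc_intM f g : measurable_fun [set: TR] (f : TR -> TR) ->
  (forall x y, exists M, forall z, x <= z <= y -> `|f z| <= M) ->
  loc_int g -> loc_int (fun x => f x * g x).
Proof.
move=> mf bf [mg intg]; split; first exact: measurable_funM.
move=> x y; have [M fM] := bf x y.
apply: (@le_integrable _ _ _ mu _ _ _ (fun z => (`|M| * g z)%:E)) => //.
- apply/measurable_EFinP; apply: (measurable_funS measurableT) => //.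
  exact: measurable_funM.
- move=> z; rewrite /= in_itv /= => zxy; rewrite lee_fin !normrM normr_id.
  by rewrite ler_wpM2r// (le_trans (fM _ zxy))// ler_norm.
have := @integrableZl _ _ _ mu `[x, y] (measurable_itv _) `|M| _ (intg x y).
exact: eq_integrable.
Qed.

Lemma loc_int_norm f : loc_int f -> loc_int (fun x => `|f x|).
Proof.
move=> [mf intf]; split; first exact: (@measurableT_comp _ _ _ _ _ _ (@Num.norm R R)).
by move=> x y; exact: (integrable_abse (intf x y)).
Qed.

Lemma loc_int_indic w (A : set TR) : measurable A -> loc_int w ->
  loc_int (fun x => \1_A x * w x).
Proof.
move=> mA iw; apply: loc_intM => // x y; exists 1 => z _.
by rewrite indicE ger0_norm// lern1 leq_b1.
Qed.

Lemma itg_xx w x : itg w x x = 0.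
Proof. by rewrite /itg set_itv1 Rintegral_set1. Qed.

Lemma itg_oo w x y : loc_int w -> itg w x y = \int[mu]_(z in `]x, y[) w z.
Proof.
move=> iw; rewrite /itg -Rintegral_itv_obnd_cbnd; last first.
  by apply: (loc_int_sub (x := x) (y := y)) => //; exact: subset_itv_oc_cc.
rewrite -Rintegral_itv_bndo_bndc//.
by apply: (loc_int_sub (x := x) (y := y)) => //; exact: subset_itv_oo_cc.
Qed.

Lemma itg_chasles w x y z : loc_int w -> x <= y -> y <= z ->
  itg w x z = itg w x y + itg w y z.
Proof.
move=> iw xy yz; have := @Rintegral_itvB R w (BLeft x) (BRight z) y (iw.2 x z).
rewrite !bnd_simp => /(_ xy yz) E.
rewrite /itg -[X in _ = _ + X]Rintegral_itv_obnd_cbnd.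
  by rewrite -E addrC subrK.
by apply: (loc_int_sub (x := y) (y := z)) => //; exact: subset_itv_oc_cc.
Qed.

Lemma itgD f g x y : loc_int f -> loc_int g ->
  itg (fun z => f z + g z) x y = itg f x y + itg g x y.
Proof. by move=> [_ intf] [_ intg]; exact: RintegralD. Qed.

Lemma itgB f g x y : loc_int f -> loc_int g ->
  itg (fun z => f z - g z) x y = itg f x y - itg g x y.
Proof. by move=> [_ intf] [_ intg]; exact: RintegralB. Qed.

Lemma itgZ c f x y : loc_int f -> itg (fun z => c * f z) x y = c * itg f x y.
Proof. by move=> [_ intf]; exact: RintegralZl. Qed.

Lemma eq_itg f g x y : (forall z, x <= z <= y -> f z = g z) -> itg f x y = itg g x y.
Proof. by move=> fg; apply: eq_Rintegral => z; rewrite inE/= in_itv/=; exact: fg. Qed.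

Lemma eq_itg_oo f g x y : loc_int f -> loc_int g ->
  (forall z, x < z < y -> f z = g z) -> itg f x y = itg g x y.
Proof.
move=> intf intg fg; rewrite !itg_oo//; apply: eq_Rintegral => z.
by rewrite inE/= in_itv/=; exact: fg.
Qed.

Lemma ae_eq_itg f g x y : loc_int f -> loc_int g ->
  (\forall z \ae mu, x < z < y -> f z = g z) -> itg f x y = itg g x y.
Proof.
move=> intf intg fg; rewrite !itg_oo// /Rintegral; congr fine.
apply: ae_eq_integral => //.
- by apply/measurable_EFinP; exact: measurable_funS intf.1.
- by apply/measurable_EFinP; exact: measurable_funS intg.1.
- by apply: ae_mono fg => z fg; rewrite /= in_itv/= => /fg ->.
Qed.

Lemma itg_ge0 f x y : (forall z, x <= z <= y -> 0 <= f z) -> 0 <= itg f x y.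
Proof. by move=> f0; apply: Rintegral_ge0 => z; rewrite /= in_itv/=; exact: f0. Qed.

Lemma le_itg f g x y : loc_int f -> loc_int g ->
  (forall z, x <= z <= y -> f z <= g z) -> itg f x y <= itg g x y.
Proof.
by move=> [_ intf] [_ intg] fg; exact: le_Rintegral.
Qed.

Lemma itg_cst c x y : x <= y -> itg (cst c) x y = c * (y - x).
Proof.
move=> xy; rewrite /itg Rintegral_cst//= lebesgue_measure_itv /= lte_fin.
move: xy; rewrite le_eqVlt => /predU1P[->|xy]; first by rewrite ltxx subrr.
by rewrite xy.
Qed.

Lemma le_norm_itg f x y : loc_int f -> `|itg f x y| <= itg (fun z => `|f z|) x y.
Proof. by move=> [_ intf]; exact: le_normr_Rintegral. Qed.

Lemma loc_int_support f x y : loc_int f -> (forall z, ~~ (x <= z <= y) -> f z = 0) ->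
  mu.-integrable setT (EFin \o f) /\ \int[mu]_z f z = itg f x y.
Proof.
move=> intf f0; have fE : f = f \_ `[x, y].
  apply/funext => z; rewrite patchE; case: ifPn => //.
  by rewrite notin_setE/= in_itv/= => /negP /f0.
split; last by rewrite {1}fE -Rintegral_mkcond.
rewrite fE -restrict_EFin; apply/integrable_restrict => //; rewrite setTI.
exact: intf.2.
Qed.

(** Absolute continuity of the integral, applied to the restriction of [w] to [a, b], which is
    integrable on the line. *)
Lemma itg_small w a b : loc_int w -> forall e : R, 0 < e -> exists2 d : R, 0 < d &
  forall x y, a <= x -> x <= y -> y <= b -> y - x < d ->
  itg (fun z => `|w z|) x y < e.
Proof.
move=> iw e e0; pose f := w \_ `[a, b].
have intf : mu.-integrable setT (EFin \o f).
  by rewrite -restrict_EFin; apply/integrable_restrict => //; rewrite setTI; exact: iw.2.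
have [d [d0 H]] := integral_normr_continuous intf e0.
exists d => // x y ax xy yb xyd.
have -> : itg (fun z => `|w z|) x y = \int[mu]_(z in `[x, y]) `|f z|.
  apply: eq_Rintegral => z; rewrite inE/= in_itv/= => /andP[xz zy].
  by rewrite /f patchE mem_set//= in_itv/= (le_trans ax)//= (le_trans zy).
apply: H => //; rewrite [X in (X < _)%E](lebesgue_measure_itv `[x, y])/=; case: ifPn => _; last by rewrite lte_fin.
by rewrite -EFinB lte_fin.
Qed.

End interval_integral.

(** * Increments across the zero set of a dominating function *)

Lemma open_interval_inf_sup (R : realType) (A : set R) :
  open A -> is_interval A -> A !=set0 -> has_lbound A -> has_ubound A ->
  A = `]inf A, sup A[%classic.
Proof.
move=> oA iA A0 lA uA; apply/seteqP; split => x /=; rewrite in_itv/=.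
  move=> Ax; have /nbhs_ballP [e /= e0 eA] : nbhs x A by exact: open_nbhs_nbhs.
  have Ae y : `|x - y| < e -> A y by move=> xy; apply: eA; rewrite /ball/=.
  apply/andP; split.
    have : A (x - e / 2) by apply: Ae; rewrite opprB addrCA subrr addr0 gtr0_norm; lra.
    by move=> /(ge_inf lA); lra.
  have : A (x + e / 2) by apply: Ae; rewrite opprD addrA subrr sub0r normrN gtr0_norm; lra.
  by move=> /(ub_le_sup uA); lra.
move=> /andP[ax xb].
have [|a Aa axa] := @inf_adherent R A (x - inf A) _ (conj A0 lA); first lra.
have [|b Ab bxb] := @sup_adherent R A (sup A - x) _ (conj A0 uA); first lra.
by apply: (iA a b) => //; lra.
Qed.

Section engine.
Context {R : realType}.
Local Notation mu := (@lebesgue_measure R).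
Variables (E q w : R -> R) (G : set R).
Hypothesis cE : continuous E.
Hypothesis E0 : forall x, 0 <= E x.
Hypothesis iw : loc_int w.
Hypothesis G_dense : forall a b : R, a < b -> exists2 g, G g & a < g < b.
Hypothesis q_le : forall x, G x -> `|q x| <= E x.
Hypothesis q_decr : forall x y, G x -> G y -> x < y ->
  (forall z, x <= z <= y -> 0 < E z) -> q y - q x <= itg w x y.

Let p x := if E x == 0 then 0 else q x.

Let pG x : G x -> p x = q x.
Proof.
move=> Gx; rewrite /p; case: eqP => // Ex0.
by have := q_le Gx; rewrite Ex0 normr_le0 => /eqP.
Qed.

Let E_small x (e : R) : E x = 0 -> 0 < e ->
  exists2 d : R, 0 < d & forall y, `|x - y| < d -> E y < e.
Proof.
move=> Ex0 e0; have := @cE x; move=> /cvgrPdist_lt/(_ _ e0)/nbhs_ballP[d /= d0 H].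
exists d => // y xy; have := H y xy; rewrite /= Ex0 sub0r normrN.
by rewrite ger0_norm.
Qed.

(** An endpoint where [E] vanishes is approached by points of [G] inside the interval: there |q| <=
    E is small, and so is the integral over the gap. The midpoint [c] keeps the two approximating
    points apart. *)
Let between a b : a < b -> (forall z, a < z < b -> 0 < E z) ->
  (E a = 0 \/ G a) -> (E b = 0 \/ G b) -> p b - p a <= itg w a b.
Proof.
move=> ab Eab Ga Gb; apply/ler_addgt0Pr => e e0.
have e4 : 0 < e / 4 by rewrite divr_gt0.
have [d d0 Hd] := itg_small a b iw e4.
pose c := (a + b) / 2.
have ac : a < c by rewrite /c; lra.
have cb : c < b by rewrite /c; lra.
have itgn u v : a <= u -> u <= v -> v <= b -> v - u < d -> `|itg w u v| <= e / 4.
  by move=> au uv vb uvd; apply: (le_trans (le_norm_itg _ _ iw)); exact/ltW/Hd.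
have [s [Gs [as_ sc] Es ps ws]] : exists s, [/\ G s, a <= s /\ s < c, 0 < E s,
    `|q s - p a| <= e / 4 & `|itg w a s| <= e / 4].
  have [Ea0|Ea0] := eqVneq (E a) 0; last first.
    have {}Ga : G a by case: Ga Ea0 => // ->; rewrite eqxx.
    exists a; split => //; first by rewrite lt_def Ea0 E0.
      by rewrite pG// subrr normr0 ltW.
    by rewrite itg_xx normr0 ltW.
  have [r r0 Hr] := E_small Ea0 e4.
  have [|s Gs /andP[as_]] := G_dense (a := a) (b := Num.min c (Num.min (a + r) (a + d))).
    by rewrite !lt_min ac/= !ltrDl r0 d0.
  rewrite !lt_min => /and3P[sc sr sd]; exists s; split => //.
  - by split=> //; exact: ltW.
  - by apply: Eab; rewrite as_ (lt_trans sc cb).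
  - rewrite /p Ea0 eqxx subr0; apply: (le_trans (q_le Gs)); apply/ltW/Hr.
    by rewrite ltr_norml; lra.
  - by apply: itgn => //; lra.
have [t [Gt [ct tb] Et pt wt]] : exists t, [/\ G t, c < t /\ t <= b, 0 < E t,
    `|p b - q t| <= e / 4 & `|itg w t b| <= e / 4].
  have [Eb0|Eb0] := eqVneq (E b) 0; last first.
    have {}Gb : G b by case: Gb Eb0 => // ->; rewrite eqxx.
    exists b; split => //; first by rewrite lt_def Eb0 E0.
      by rewrite pG// subrr normr0 ltW.
    by rewrite itg_xx normr0 ltW.
  have [r r0 Hr] := E_small Eb0 e4.
  have [|t Gt /andP[+ tb]] := G_dense (a := Num.max c (Num.max (b - r) (b - d))) (b := b).
    by rewrite !gt_max cb/= !ltrBlDr !ltrDl r0 d0.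
  rewrite !gt_max => /and3P[ct tr td]; exists t; split => //.
  - by split=> //; exact: ltW.
  - by apply: Eab; rewrite tb (lt_trans ac ct).
  - rewrite /p Eb0 eqxx sub0r normrN; apply: (le_trans (q_le Gt)); apply/ltW/Hr.
    by rewrite ltr_norml; lra.
  - by apply: itgn => //; lra.
have st : s < t by lra.
have H : q t - q s <= itg w s t.
  apply: q_decr => // z /andP[sz zt].
  move: sz; rewrite le_eqVlt => /predU1P[<-//|sz].
  move: zt; rewrite le_eqVlt => /predU1P[->//|zt].
  by apply: Eab; lra.
have C1 := itg_chasles iw as_ (ltW (lt_le_trans st tb)).
have C2 := itg_chasles iw (ltW st) tb.
move: ps pt ws wt; rewrite !ler_norml => /andP[? ?] /andP[? ?] /andP[? ?] /andP[? ?].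
lra.
Qed.

Let w1 z := \1_[set z | 0 < E z] z * w z.

Let iw1 : loc_int w1.
Proof. by apply: loc_int_indic => //; exact: measurable_positive. Qed.

Let w1E z : 0 < E z -> w1 z = w z.
Proof. by move=> Ez; rewrite /w1 indicE mem_set// mul1r. Qed.

(** On each component of the set E > 0 inside (a, b), [p] vanishes at both ends, so [between] makes
    the integral of [w] nonnegative there. Countable additivity sums the components. *)
Let middle a b : E a = 0 -> E b = 0 -> a <= b -> 0 <= itg w1 a b.
Proof.
move=> Ea Eb ab.
pose O := [set z | 0 < E z] `&` `]a, b[%classic.
have oO : open O by apply: openI; [exact: open_positive|exact: itv_open].
have mO : measurable O by exact: open_measurable.
have -> : itg w1 a b = \int[mu]_(z in O) w z.
  rewrite itg_oo// /O setIC Rintegral_mkcondr; apply: eq_Rintegral => z _.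
  rewrite /w1 patchE indicE; by case: (z \in _); rewrite ?mul1r ?mul0r.
have [I [oI tI OI]] := OpenSetDisjointItvs.open_disjoint_itv oO.
have mI k : measurable (I k) by apply: open_measurable; case: (oI k).
have iO : mu.-integrable O (EFin \o w).
  apply: (loc_int_sub (x := a) (y := b)) => // z [_] /=.
  exact: subset_itv_oo_cc.
rewrite /Rintegral fine_ge0// OI integral_bigcup//; last by rewrite -OI.
apply: nneseries_ge0 => k _ _.
have IO : I k `<=` O by rewrite OI; exact: bigcup_sup.
have [->|/set0P Ik0] := eqVneq (I k) set0; first by rewrite integral_set0.
have lI : has_lbound (I k).
  by exists a => z /IO[_]; rewrite /= in_itv/= => /andP[/ltW].
have uI : has_ubound (I k).
  by exists b => z /IO[_]; rewrite /= in_itv/= => /andP[_ /ltW].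
have IE := open_interval_inf_sup (oI k).1 (oI k).2 Ik0 lI uI.
set al := inf (I k) in IE; set be := sup (I k) in IE.
have aal : a <= al by apply: lb_le_inf => // z /IO[_]; rewrite /= in_itv/= => /andP[/ltW].
have beb : be <= b by apply: ge_sup => // z /IO[_]; rewrite /= in_itv/= => /andP[_ /ltW].
have [z0] := Ik0; rewrite IE /= in_itv/= => /andP[alz zbe].
have al_be : al < be by lra.
(* An endpoint inside [O] would belong to another component, meeting this one. *)
have notO z : al <= z <= be -> ~ I k z -> ~ O z.
  move=> zab nIz; rewrite OI => -[j _ Ijz].
  have jk : j != k by apply/eqP => jk; apply: nIz; rewrite -jk.
  have /nbhs_ballP[r /= r0 rI] : nbhs z (I j) by apply: open_nbhs_nbhs; split => //; case: (oI j).
  have [s [sz abs_]] : exists s, `|z - s| < r /\ al < s < be.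
    move/andP: zab => [alz1]; rewrite le_eqVlt => /predU1P[->|zb].
      exists (be - Num.min r (be - al) / 2).
      have m0 : 0 < Num.min r (be - al) by rewrite lt_min r0 subr_gt0.
      have mr : Num.min r (be - al) <= r by rewrite ge_min lexx.
      have mb : Num.min r (be - al) <= be - al by rewrite ge_min lexx orbT.
      by split; [rewrite opprB addrC subrK gtr0_norm; lra|lra].
    exists (z + Num.min r (be - z) / 2).
    have m0 : 0 < Num.min r (be - z) by rewrite lt_min r0 subr_gt0.
    have mr : Num.min r (be - z) <= r by rewrite ge_min lexx.
    have mb : Num.min r (be - z) <= be - z by rewrite ge_min lexx orbT.
    split; last lra.
    by rewrite opprD addrA subrr sub0r normrN gtr0_norm; lra.
  move/trivIsetP : tI => /(_ j k Logic.I Logic.I jk); apply/eqP/set0P.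
  by exists s; split; [exact: rI|rewrite IE/= in_itv].
have E_end z : al <= z <= be -> ~ I k z -> E z = 0.
  move=> zab nIz; have nO := notO z zab nIz.
  have [->//|za] := eqVneq z a; have [->//|zb] := eqVneq z b.
  apply/eqP; rewrite eq_le E0 andbT leNgt; apply/negP => Ez; apply: nO; split => //=.
  move: zab => /andP[z1 z2].
  by rewrite in_itv/= !lt_def za (eq_sym b) zb/=; lra.
have Eal : E al = 0.
  by apply: E_end; rewrite ?lexx ?(ltW al_be)// IE/= in_itv/= ltxx.
have Ebe : E be = 0.
  by apply: E_end; rewrite ?lexx ?(ltW al_be)// IE/= in_itv/= ltxx andbF.
have := @between al be al_be _ (or_introl Eal) (or_introl Ebe).
rewrite {1 2}/p Eal Ebe eqxx subrr itg_oo// -IE => H.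
have {}H : 0 <= \int[mu]_(z in I k) w z.
  by apply: H => z zab; have [] : O z by apply: IO; rewrite IE/= in_itv.
rewrite -[X in (_ <= X)%E]fineK ?lee_fin//.
by apply: integrable_fin_num; [exact: mI|apply: (integrableS _ _ _ iO); [exact: mO|exact: mI|exact: IO]].
Qed.

(** If [E] vanishes somewhere, [x, y] is cut at the first zero a and the last zero b. Since [q] is
    squeezed to 0 there, [between] gives - q x and q y as lower bounds for the outer integrals, and
    the middle integral is nonnegative by [middle], however complicated the zeros between a and
    b. *)
Lemma engine x y : G x -> G y -> x <= y ->
  q y - q x <= itg (fun z => \1_[set z | 0 < E z] z * w z) x y.
Proof.
move=> Gx Gy; rewrite le_eqVlt => /predU1P[->|xy]; first by rewrite itg_xx subrr.
rewrite -/w1.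
pose Z := [set z | x <= z <= y /\ E z = 0].
have [[z0 Zz0]|nZ] := pselect (Z !=set0); last first.
  have Epos z : x <= z <= y -> 0 < E z.
    move=> xzy; rewrite lt_def E0 andbT; apply/eqP => Ez; apply: nZ.
    by exists z.
  rewrite (@eq_itg _ w1 w); last by move=> z /Epos/w1E.
  exact: q_decr.
have lZ : has_lbound Z by exists x => z [/andP[]].
have uZ : has_ubound Z by exists y => z [/andP[]].
have Z0 : Z !=set0 by exists z0.
have iZ z : x <= z <= y -> (forall d : R, 0 < d -> exists2 t, Z t & `|z - t| < d) ->
    Z z.
  move=> xzy zcl; split => //; apply/eqP; rewrite eq_le E0 andbT leNgt.
  apply/negP => Ez.
  have := @cE z; move=> /cvgrPdist_lt/(_ _ Ez)/nbhs_ballP[d /= d0 H].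
  have [t [_ Et] zt] := zcl d d0.
  by have := H t zt; rewrite /= Et subr0 gtr0_norm ?ltxx.
have [ZA ZB] : Z (inf Z) /\ Z (sup Z).
  split; apply: iZ.
  - apply/andP; split; first by apply: lb_le_inf => // z [/andP[]].
    by apply: (le_trans (ge_inf lZ Zz0)); case: Zz0 => /andP[].
  - move=> d d0; have [z Zz zd] := inf_adherent d0 (conj Z0 lZ); exists z => //.
    by have := ge_inf lZ Zz; rewrite ltr_norml => ?; lra.
  - apply/andP; split; last by apply: ge_sup => // z [/andP[]].
    by apply: (le_trans _ (ub_le_sup uZ Zz0)); case: Zz0 => /andP[].
  - move=> d d0; have [z Zz zd] := sup_adherent d0 (conj Z0 uZ); exists z => //.
    by have := ub_le_sup uZ Zz; rewrite ltr_norml => ?; lra.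
set a := inf Z in ZA; set b := sup Z in ZB.
have ab : a <= b by apply: (le_trans (ge_inf lZ Zz0)); exact: (ub_le_sup uZ).
case: (ZA) => /andP[xa ay] Ea; case: (ZB) => /andP[xb yb] Eb.
have C1 := itg_chasles iw1 xa ay; have C2 := itg_chasles iw1 ab yb.
have M := middle Ea Eb ab.
have A1 : - q x <= itg w1 x a.
  move: xa; rewrite le_eqVlt => /predU1P[xa|xa].
    rewrite xa itg_xx; have := q_le Gx; rewrite xa Ea normr_le0 => /eqP ->.
    by rewrite oppr0.
  have pos z : x < z < a -> 0 < E z.
    move=> /andP[xz za]; rewrite lt_def E0 andbT; apply/eqP => Ez.
    have : Z z by split => //; lra.
    by move=> /(ge_inf lZ); rewrite -/a; lra.
  rewrite (@eq_itg_oo _ w1 w)//; last by move=> z /pos/w1E.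
  have := between xa pos (or_intror Gx) (or_introl Ea).
  by rewrite (pG Gx) /p Ea eqxx sub0r.
have A2 : q y <= itg w1 b y.
  move: yb; rewrite le_eqVlt => /predU1P[yb|yb].
    rewrite -yb itg_xx; have := q_le Gy; rewrite -yb Eb normr_le0 => /eqP ->.
    by [].
  have pos z : b < z < y -> 0 < E z.
    move=> /andP[bz zy]; rewrite lt_def E0 andbT; apply/eqP => Ez.
    have : Z z by split => //; lra.
    by move=> /(ub_le_sup uZ); rewrite -/b; lra.
  rewrite (@eq_itg_oo _ w1 w)//; last by move=> z /pos/w1E.
  have := between yb pos (or_introl Eb) (or_intror Gy).
  by rewrite (pG Gy) /p Eb eqxx subr0.
lra.
Qed.

End engine.

(** * Absolutely continuous functions and sign changes *)

Section primitives.
Context {R : realType}.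
Local Notation mu := (@lebesgue_measure R).
Local Notation TR := (measurableTypeR R).
Implicit Types (f g F H : R -> R) (x y z : R).

(** Local absolute continuity of [F] with density [f], stated by increments so that pointwise
    differentiation is avoided. *)
Definition prim F f := loc_int f /\ forall x y, x <= y -> F y - F x = itg f x y.

Lemma prim_dist F f x y : prim F f -> x <= y ->
  `|F y - F x| <= itg (fun z => `|f z|) x y.
Proof. by move=> [intf Ff] xy; rewrite Ff// le_norm_itg. Qed.

Lemma prim_uniform F f a b : prim F f -> forall e : R, 0 < e -> exists2 d : R, 0 < d &
  forall x y, a <= x -> x <= y -> y <= b -> y - x < d -> `|F y - F x| < e.
Proof.
move=> pF e e0; have [d d0 K] := itg_small a b pF.1 e0; exists d => // x y ax xy yb yx.
exact: le_lt_trans (prim_dist pF xy) (K _ _ ax xy yb yx).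
Qed.

Lemma prim_continuous F f : prim F f -> continuous F.
Proof.
move=> pF x; apply/cvgrPdist_lt => e e0.
have [d d0 H] := prim_uniform (x - 1) (x + 1) pF e0.
apply/nbhs_ballP; exists (Num.min d 1) => /=; first by rewrite lt_min d0 ltr01.
move=> y; rewrite /ball/= lt_min => /andP[yd y1].
have [xy|/ltW yx] := leP x y.
  rewrite distrC; move: yd y1; rewrite (distrC x y) (ger0_norm (x := y - x)) ?subr_ge0// => yd y1.
  by apply: H => //; lra.
by move: yd y1; rewrite (ger0_norm (x := x - y)) ?subr_ge0// => yd y1; apply: H => //; lra.
Qed.

Lemma continuous_loc_bounded F : continuous F -> forall x y, exists M,
  forall z, x <= z <= y -> `|F z| <= M.
Proof.
move=> cF x y; have [M [_ HM]] := compact_bounded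
  (continuous_compact (continuous_subspaceT cF) (@segment_compact R x y)).
exists (M + 1) => z xzy; apply: (HM (M + 1)); first by rewrite ltrDl.
by exists z.
Qed.

Lemma loc_intMc F f : continuous F -> loc_int f -> loc_int (fun x => F x * f x).
Proof.
move=> cF intf; apply: loc_intM => //; first exact: continuous_measurable_fun.
exact: continuous_loc_bounded.
Qed.

(** Chaining finitely many steps shorter than [d]. It adds up estimates that hold on short intervals
    without any explicit sum over a partition. *)
Lemma small_scale_homo (h : R -> R) (a b d : R) : 0 < d -> a <= b ->
  (forall x y, a <= x -> x <= y -> y <= b -> y - x < d -> h x <= h y) ->
  h a <= h b.
Proof.
move=> d0 ab H.
pose n := (Num.truncn ((b - a) / d)).+1.
have n0 : 0 < n%:R :> R by rewrite ltr0n.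
pose s (k : nat) : R := a + k%:R * ((b - a) / n%:R).
have ba0 : 0 <= (b - a) / n%:R by rewrite divr_ge0 ?subr_ge0 ?(ltW n0).
have bad : (b - a) / n%:R < d.
  rewrite ltr_pdivrMr// mulrC -ltr_pdivrMr//.
  have /truncn_itv/andP[_] : 0 <= (b - a) / d by rewrite divr_ge0 ?subr_ge0 ?(ltW d0).
  by [].
have sb k : (k <= n)%N -> s k <= b.
  move=> kn; rewrite /s -lerBrDl mulrA ler_pdivrMr// mulrC ler_wpM2l ?subr_ge0//.
  by rewrite ler_nat.
have : forall k, (k <= n)%N -> h a <= h (s k).
  elim=> [|k ih] kn; first by rewrite /s mul0r addr0.
  apply: le_trans (ih (ltnW kn)) _; apply: H.
  - by rewrite /s lerDl mulr_ge0.
  - by rewrite /s lerD2l ler_wpM2r// ler_nat.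
  - exact: sb.
  - by rewrite /s opprD addrACA subrr add0r -mulrBl -natrB// subSnn mul1r.
by move=> /(_ n (leqnn _)); rewrite /s mulrC divfK ?gt_eqF// addrC subrK.
Qed.

(* Over a short interval [D(FG) = G(x) DF + F(y) DG], which differs from
   [int (f G + F g)] by the oscillation of [F] and [G] times the variations. *)
Lemma primM F f H g : prim F f -> prim H g ->
  prim (fun x => F x * H x) (fun x => F x * g x + f x * H x).
Proof.
move=> pF pG; have cF := prim_continuous pF; have cG := prim_continuous pG.
have iFg := loc_intMc cF pG.1.
have ifG : loc_int (fun x => f x * H x).
  by have := loc_intMc cG pF.1; under eq_fun do rewrite mulrC.
have ih := loc_intD iFg ifG.
split=> // a b ab.
pose h := fun x => F x * g x + f x * H x; rewrite -/h.
pose k := fun z => `|f z| + `|g z|.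
have ik : loc_int k by apply: loc_intD; apply: loc_int_norm; [case: pF|case: pG].
have ik0 : 0 <= itg k a b by apply: itg_ge0 => z _; rewrite addr_ge0.
have small (e : R) : 0 < e -> `|F b * H b - F a * H a - itg h a b| <= e * itg k a b.
  move=> e0.
  have [d1 d10 K1] := prim_uniform a b pF e0.
  have [d2 d20 K2] := prim_uniform a b pG e0.
  pose d := Num.min d1 d2; have d0 : 0 < d by rewrite lt_min d10.
  have step x y : a <= x -> x <= y -> y <= b -> y - x < d ->
      `|F y * H y - F x * H x - itg h x y| <= e * itg k x y.
    move=> ax xy yb; rewrite lt_min => /andP[yd1 yd2].
    have -> : F y * H y - F x * H x - itg h x y =
        itg (fun z => (F y - F z) * g z + (H x - H z) * f z) x y.
      have -> : F y * H y - F x * H x = F y * itg g x y + H x * itg f x y.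
        by rewrite -pF.2// -pG.2//; ring.
      have i1 : loc_int (fun z => F y * g z) by apply: loc_intMc => //; [exact: cst_continuous|exact: pG.1].
      have i2 : loc_int (fun z => H x * f z) by apply: loc_intMc => //; [exact: cst_continuous|exact: pF.1].
      rewrite -(itgZ _ _ _ pG.1) -(itgZ _ _ _ pF.1) -itgD// -itgB//; last exact: loc_intD.
      by apply: eq_itg => z _; rewrite /h; ring.
    have i3 : loc_int (fun z => (F y - F z) * g z + (H x - H z) * f z).
      apply: loc_intD; apply: loc_intMc; [|exact: pG.1| |exact: pF.1].
        by move=> z; apply: cvgB; [exact: cvg_cst|exact: cF].
      by move=> z; apply: cvgB; [exact: cvg_cst|exact: cG].
    apply: (le_trans (le_norm_itg _ _ i3)); rewrite -itgZ//.
    apply: le_itg; [exact: loc_int_norm| by apply: loc_intMc => //; exact: cst_continuous|].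
    move=> z /andP[xz zy]; apply: (le_trans (ler_normD _ _)); rewrite !normrM mulrDr addrC.
    apply: lerD; rewrite ler_wpM2r// ltW//.
      by rewrite distrC; apply: K2 => //; lra.
    by apply: K1 => //; lra.
  rewrite ler_norml; apply/andP; split.
    have := @small_scale_homo (fun z => F z * H z - F a * H a - itg h a z + e * itg k a z)
      a b d d0 ab.
    rewrite !itg_xx subrr !mulr0 subrr addr0 => mono.
    suff : 0 <= F b * H b - F a * H a - itg h a b + e * itg k a b by lra.
    apply: mono => x y ax xy yb yx.
    rewrite (itg_chasles (y := x) ih ax xy) (itg_chasles (y := x) ik ax xy).
    have := step x y ax xy yb yx; rewrite ler_norml => /andP[? ?]; lra.
  have := @small_scale_homo (fun z => e * itg k a z - (F z * H z - F a * H a - itg h a z))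
    a b d d0 ab.
  rewrite !itg_xx !subrr !mulr0 !subrr => mono.
  suff : 0 <= e * itg k a b - (F b * H b - F a * H a - itg h a b) by lra.
  apply: mono => x y ax xy yb yx.
  rewrite (itg_chasles (y := x) ih ax xy) (itg_chasles (y := x) ik ax xy).
  have := step x y ax xy yb yx; rewrite ler_norml => /andP[? ?]; lra.
apply/eqP; rewrite -subr_eq0 -normr_eq0 eq_le normr_ge0 andbT.
apply/ler_addgt0Pr => e e0; rewrite add0r.
have e1 : 0 < e / (itg k a b + 1) by rewrite divr_gt0// ltr_wpDl.
apply: (le_trans (small _ e1)).
by rewrite mulrAC ler_pdivrMr ?ltr_wpDl// ler_wpM2l ?(ltW e0)// lerDl.
Qed.

Implicit Types (P p s : R -> R) (G : set R).

Lemma prim_C1 F : (forall x, derivable F x 1) -> continuous F^`()%classic ->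
  prim F F^`()%classic.
Proof.
move=> dF cF'; split; first exact: continuous_loc_int.
move=> x y; rewrite le_eqVlt => /predU1P[->|xy]; first by rewrite itg_xx subrr.
have cF : continuous F.
  by move=> z; apply: differentiable_continuous; apply/derivable1_diffP.
have c' : {within `[x, y], continuous F^`()%classic} by exact: continuous_subspaceT.
have d' : derivable_oo_LRcontinuous F x y.
  split; first by move=> z _; exact: dF.
  - by apply: cvg_at_right_filter; exact: cF.
  - by apply: cvg_at_left_filter; exact: cF.
have := continuous_FTC2 xy c' d' (in1W (fun=> erefl)).
by rewrite /itg /Rintegral => ->.
Qed.

Lemma prim_derive F f : (forall x, is_derive x 1 F (f x)) -> continuous f -> prim F f.
Proof.
move=> dF cf; have E : f = F^`()%classic.
  by apply/funext => x; rewrite derive1E; have [_ ->] := dF x.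
by rewrite E in cf *; apply: prim_C1 => // x; have [] := dF x.
Qed.

Lemma loc_int_locally_integrable f : loc_int f -> locally_integrable setT f.
Proof.
move=> intf; split; [exact: intf.1|exact: openT|].
move=> K _ cK; have [M [_ HM]] := compact_bounded cK.
have KM : K `<=` `[- (M + 1), M + 1].
  move=> z Kz; have := HM (M + 1) _ z Kz; rewrite ltrDl => /(_ ltr01) /=.
  by rewrite in_itv/= ler_norml.
have mK : measurable K by exact: compact_measurable.
have /integrableP[_] := loc_int_sub intf mK KM.
by [].
Qed.

Lemma loc_int_lebesgue_pt f : loc_int f -> \forall x \ae mu, lebesgue_pt f x.
Proof. by move=> /loc_int_locally_integrable/lebesgue_differentiation. Qed.

(** At a Lebesgue point the value is the limit of averages over shrinking balls, which are
    intervals. *)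
Lemma itg_le0_ae f : loc_int f -> (forall x y, x < y -> itg f x y <= 0) ->
  \forall x \ae mu, f x <= 0.
Proof.
move=> intf f0.
have locf := loc_int_locally_integrable intf.
pose E x (n : nat) := ball x (n.+1%:R^-1 : R).
have hE x : nicely_shrinking x (E x).
  split; first by move=> n; exact: measurable_ball.
  have p0 n : 0 < n.+1%:R^-1 :> R by rewrite invr_gt0.
  exists (1, fun n => PosNum (p0 n)); split => //=.
    apply/cvgrPdist_lt => e e0; near=> n; rewrite sub0r normrN gtr0_norm//.
    by near: n; exact: near_infty_natSinv_lt (PosNum e0).
    by move=> n.
  by move=> n; rewrite mul1e.
apply: ae_mono (loc_int_lebesgue_pt intf) => x lx.
have H := nice_lebesgue_differentiation hE locf lx.
rewrite -lee_fin; apply: (cvge_le _ H); apply: nearW => n.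
rewrite mule_ge0_le0 ?inve_ge0//.
have -> : (\int[mu]_(y in E x n) (f y)%:E)%E =
    (itg f (x - n.+1%:R^-1) (x + n.+1%:R^-1))%:E.
  rewrite itg_oo// /E ball_itv /Rintegral fineK//; apply: integrable_fin_num => //.
  apply: (loc_int_sub (x := x - n.+1%:R^-1) (y := x + n.+1%:R^-1)) => //.
  exact: subset_itv_oo_cc.
rewrite lee_fin; apply: f0.
by rewrite ltrD2l (@lt_trans _ _ 0)// ?oppr_lt0 invr_gt0.
Unshelve. all: by end_near.
Qed.

Lemma ae_dense G : (\forall x \ae mu, G x) -> forall a b : R, a < b ->
  exists2 g, G g & a < g < b.
Proof.
move=> [N [mN N0 GN]] a b ab; apply: contrapT => nG.
have : (mu `]a, b[ <= mu N)%E.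
  apply: le_measure; rewrite ?inE//.
  move=> z /=; rewrite in_itv/= => zab; apply: GN => Gz.
  by apply: nG; exists z.
rewrite N0 lebesgue_measure_itv/= lte_fin ab -EFinB lee_fin; lra.
Qed.

(** [engine] with E = |P|, applied to P and to - P, shows that the increments of P are already the
    integrals of [p] over the set where P does not vanish. So the part of [p] on the zero set has
    integral 0 over every interval. *)
Lemma prim_zero_ae P p : prim P p -> \forall x \ae mu, P x = 0 -> p x = 0.
Proof.
move=> pP; have cP := prim_continuous pP.
have cE : continuous (fun x => `|P x|).
  by move=> x; apply: continuous_comp; [exact: cP|exact: norm_continuous].
have dT (a b : R) : a < b -> exists2 g, [set: R] g & a < g < b.
  by move=> ab; exists ((a + b) / 2) => //; lra.
have ip := pP.1.
have iN : loc_int (fun z => - p z).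
  by have := loc_intB (loc_int_cst 0) ip; under eq_fun do rewrite sub0r.
pose A := [set z | 0 < `|P z|].
have mA : measurable A.
  apply: open_measurable; rewrite (_ : A = (fun x => `|P x|) @^-1` [set z | 0 < z]); last by [].
  by apply: open_comp => //; move=> z _; exact: cE.
have iA := loc_int_indic mA ip.
have E1 x y : x <= y -> P y - P x = itg (fun z => \1_A z * p z) x y.
  move=> xy; apply/eqP; rewrite eq_le; apply/andP; split.
    apply: (@engine R (fun x => `|P x|) P p setT) => // u v _ _ uv _.
    by rewrite pP.2// ltW.
  have := @engine R (fun x => `|P x|) (fun z => - P z) (fun z => - p z) setT cE _ iN dT _ _ x y I I xy.
  have -> : itg (fun z => \1_[set z | 0 < `|P z|] z * - p z) x y = - itg (fun z => \1_A z * p z) x y.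
    rewrite -[RHS]mulN1r -itgZ//; apply: eq_itg => z _.
    by rewrite mulrN mulN1r.
  move=> H; suff : - P y - - P x <= - itg (fun z => \1_A z * p z) x y by lra.
  apply: H => //; first by move=> z _; rewrite normrN.
  move=> u v _ _ uv _; have -> : - P v - - P u = - (P v - P u) by ring.
  rewrite pP.2 ?(ltW uv)// -[X in X <= _]mulN1r -itgZ//.
  by rewrite le_eqVlt; apply/orP; left; apply/eqP; apply: eq_itg => z _; rewrite mulN1r.
have E2 x y : x < y -> itg (fun z => p z - \1_A z * p z) x y = 0.
  by move=> xy; rewrite itgB// -E1 ?(ltW xy)// -pP.2 ?(ltW xy)// subrr.
have i2 := loc_intB ip iA.
have H1 : \forall x \ae mu, p x - \1_A x * p x <= 0.
  by apply: itg_le0_ae => // x y xy; rewrite E2.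
have H2 : \forall x \ae mu, - 1 * (p x - \1_A x * p x) <= 0.
  apply: itg_le0_ae; first by apply: loc_intMc => //; exact: cst_continuous.
  by move=> x y xy; rewrite itgZ// E2// mulr0.
apply: ae_mono (ae_and H1 H2) => x [h1 h2] Px0.
have A0 : \1_A x = 0 :> R by rewrite indicE memNset// /A/= Px0 normr0 ltxx.
by move: h1 h2; rewrite A0; lra.
Qed.

Lemma nonzero_sign P x y : continuous P -> (forall z, x <= z <= y -> P z != 0) ->
  forall a b, x <= a <= y -> x <= b <= y -> 0 < P a -> 0 < P b.
Proof.
move=> cP P0 a b axy bxy Pa; rewrite lt_def P0//= leNgt; apply/negP => Pb.
have mixed u v : x <= u -> u <= v -> v <= y -> P u * P v < 0 -> False.
  move=> xu uv vy uv0; have [||z] := @IVT _ P u v 0 uv.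
  - exact: continuous_subspaceT.
  - rewrite ge_min le_max; apply/andP; split; apply/orP.
      by have [|Pu] := leP (P u) 0; [left|right; rewrite ltW// -(pmulr_rlt0 _ Pu)].
    have [|Pu] := leP 0 (P u); [by left|right].
    by rewrite ltW// -(nmulr_rlt0 _ Pu).
  - rewrite in_itv/= => /andP[uz zv] Pz0.
    have : P z != 0 by apply: P0; lra.
    by rewrite Pz0 eqxx.
case/andP: axy bxy => xa ay /andP[xb yb].
have [ab|/ltW ba] := leP a b; [apply: (mixed a b)|apply: (mixed b a)] => //.
  by rewrite pmulr_rlt0.
by rewrite nmulr_rlt0.
Qed.

(* [s] jumps at most once on an interval where [P] does not vanish, and the jump
   makes [s P] decrease; where [P] vanishes, so does [p], almost everywhere. *)
Lemma sign_lemma G P p s : prim P p -> (\forall x \ae mu, G x) ->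
  measurable_fun [set: TR] (s : TR -> TR) -> (forall x, `|s x| <= 1) ->
  (forall x, G x -> P x != 0 -> `|s x| = 1) ->
  (forall x y, G x -> G y -> x < y -> (forall z, x <= z <= y -> P z != 0) ->
    0 < s y * P y -> 0 < s x * P x) ->
  forall x y, G x -> G y -> x <= y ->
    s y * P y - s x * P x <= itg (fun z => s z * p z) x y.
Proof.
move=> pP aG ms s1 sP mono x y Gx Gy xy.
have cP := prim_continuous pP.
have cE : continuous (fun x => `|P x|).
  by move=> z; apply: continuous_comp; [exact: cP|exact: norm_continuous].
have isp : loc_int (fun z => s z * p z).
  by apply: loc_intM => //; [move=> a b; exists 1 => z _|exact: pP.1].
have mA := measurable_positive cE.
have -> : itg (fun z => s z * p z) x y =
    itg (fun z => \1_[set z | 0 < `|P z|] z * (s z * p z)) x y.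
  apply: ae_eq_itg => //; first exact: loc_int_indic.
  apply: ae_mono (prim_zero_ae pP) => z Pp.
  rewrite indicE; case: (boolP (z \in _)) => [|/negP]; first by rewrite mul1r.
  rewrite inE/= => /negP; rewrite normr_gt0 negbK mul0r => /eqP /Pp ->.
  by rewrite mulr0.
apply: (@engine R (fun x => `|P x|) (fun z => s z * P z) (fun z => s z * p z) G) => //.
  exact: ae_dense.
  by move=> z _; rewrite normrM ler_piMl.
move=> {Gx Gy xy} {}x {}y Gx Gy xy Pxy.
have P0 z : x <= z <= y -> P z != 0 by move=> /Pxy; rewrite normr_gt0.
(* [c] is the constant sign of P on [x, y]; at points of G, [s] is then c where [T] holds and - c
   where it fails. *)
have [c [c1 cP0]] : exists c : R, `|c| = 1 /\ forall z, x <= z <= y -> c * P z = `|P z|.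
  have xx : x <= x <= y by rewrite lexx ltW.
  have [Px|Px] := ltP 0 (P x).
    exists 1; rewrite normr1; split => // z zxy.
    by rewrite mul1r gtr0_norm// (nonzero_sign cP P0 xx).
  have {}Px : 0 < - P x by rewrite oppr_gt0 lt_def Px andbT eq_sym P0.
  have cN : continuous (fun z => - P z) by move=> z; apply: cvgN; exact: cP.
  exists (- 1); rewrite normrN1; split => // z zxy.
  rewrite mulN1r -normrN gtr0_norm// (nonzero_sign cN _ xx)// => t txy.
  by rewrite oppr_eq0 P0.
have cc : c * c = 1.
  by rewrite -expr2 -real_normK ?num_real// c1 expr1n.
pose T z := 0 < s z * P z.
have scP z : G z -> x <= z <= y -> s z = c \/ s z = - c.
  move=> Gz zxy; have := sP z Gz (P0 z zxy).
  move=> sz1; have : s z * s z = c * c.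
    by rewrite cc -expr2 -real_normK ?num_real// sz1 expr1n.
  move=> /eqP; rewrite -subr_eq0 -!expr2 subr_sqr mulf_eq0 subr_eq0 addr_eq0.
  by move=> /orP[] /eqP; [left|right].
have PT z : G z -> x <= z <= y -> T z -> s z = c.
  move=> Gz zxy; rewrite /T; have [//|->] := scP z Gz zxy.
  by rewrite mulNr cP0// oppr_gt0 ltNge normr_ge0.
have PnT z : G z -> x <= z <= y -> ~~ T z -> s z = - c.
  move=> Gz zxy; rewrite /T; have [->|//] := scP z Gz zxy.
  by rewrite cP0// normr_gt0 P0.
have piece k a b : a <= b -> (forall z, G z -> a < z < b -> s z = k) ->
    itg (fun z => s z * p z) a b = k * (P b - P a).
  move=> ab sk; rewrite pP.2// -itgZ; last exact: pP.1.
  apply: ae_eq_itg => //.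
    by apply: loc_intMc; [exact: cst_continuous|exact: pP.1].
  by apply: ae_mono aG => z Gz zab; rewrite sk.
have Tmono u v : G u -> G v -> x <= u -> u < v -> v <= y -> T v -> T u.
  move=> Gu Gv xu uv vy; apply: mono => // z /andP[uz zv].
  by apply: P0; lra.
have xx : x <= x <= y by rewrite lexx ltW.
have yy : x <= y <= y by rewrite lexx ltW.
have [Ty|nTy] := boolP (T y).
  rewrite (piece c _ _ (ltW xy))//; last first.
    move=> z Gz /andP[xz zy]; apply: PT => //; first by rewrite !ltW.
    exact: (Tmono z y Gz Gy (ltW xz) zy (lexx y) Ty).
  by rewrite (PT y Gy yy Ty) (PT x Gx xx (Tmono x y Gx Gy (lexx _) xy (lexx _) Ty)) mulrBr.
have [Tx|nTx] := boolP (T x); last first.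
  rewrite (piece (- c) _ _ (ltW xy))//.
    by rewrite (PnT y Gy yy nTy) (PnT x Gx xx nTx) mulrBr.
  move=> z Gz /andP[xz zy]; apply: PnT => //; first by rewrite !ltW.
  by apply: contra nTx; exact: (Tmono x z Gx Gz (lexx x) xz (ltW zy)).
(* In the remaining case [T] holds on G before d = sup Z and fails after it. Splitting the integral
   of s p at d makes the right-hand side exceed the left-hand side by 2 |P d|. *)
pose Z := [set z | [/\ G z, x <= z <= y & T z]].
have Zx : Z x by [].
have uZ : has_ubound Z by exists y => z [_ /andP[]].
have Z0 : Z !=set0 by exists x.
pose d := sup Z.
have xd : x <= d by exact: ub_le_sup.
have dy : d <= y by apply: ge_sup => // z [_ /andP[]].
rewrite (itg_chasles isp xd dy) (piece c)//; last first.
  move=> z Gz /andP[xz zd].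
  have [|t [Gt /andP[xt ty] Tt] zt] := @sup_adherent R Z (d - z) _ (conj Z0 uZ).
    by rewrite subr_gt0.
  rewrite -/d opprB addrCA subrr addr0 in zt.
  have zy : z < y by exact: lt_le_trans zd dy.
  apply: PT => //; first by rewrite !ltW.
  exact: (Tmono z t Gz Gt (ltW xz) zt ty Tt).
rewrite (piece (- c))//; last first.
  move=> z Gz /andP[dz zy]; have xz : x < z by exact: le_lt_trans dz.
  apply: PnT => //; first by rewrite !ltW.
  apply/negP => Tz; have : Z z by split => //; rewrite !ltW.
  by move=> /(ub_le_sup uZ); rewrite -/d; lra.
rewrite (PnT y Gy yy nTy) (PT x Gx xx Tx).
have : 0 <= c * P d by rewrite cP0// xd.
lra.
Qed.

End primitives.

(** * Pointwise description of entropy pairs *)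

Section profiles.
Context {R : realType}.
Local Notation mu := (@lebesgue_measure R).
Local Notation TR := (measurableTypeR R).
Implicit Types (f g u v W : R -> R) (x y z : R) (G : set R).

(* A solution of [(u^2/2)' = v] whose sign may only switch from + to -. *)
Record profile G W u v : Prop := Profile {
  profile_ae : \forall x \ae mu, G x;
  profile_measurable : measurable_fun [set: TR] (u : TR -> TR);
  profile_prim : prim W v;
  profile_sqr : forall x, G x -> W x = u x ^+ 2 / 2;
  profile_sign : forall x y, G x -> G y -> x < y ->
    (forall z, x <= z <= y -> 0 < W z) -> 0 < u y -> 0 < u x }.

Lemma measurable_sg : measurable_fun [set: TR] (@Num.sg R : TR -> TR).
Proof.
rewrite (_ : Num.sg = (fun x : R => \1_`]0, +oo[ x - \1_`]-oo, 0[ x)); last first.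
  apply/funext => x; rewrite !indicE !mem_setE !in_itv/= andbT.
  by case: (ltgtP x 0) => [x0|x0|->]; rewrite ?subr0 ?sub0r ?sgr0
    ?(gtr0_sg x0) ?(ltr0_sg x0).
by apply: measurable_funB; exact: measurable_indic.
Qed.

(** Kruzhkov constants are profiles themselves, so the entropy inequality becomes a comparison of
    two profiles. *)
Lemma profile_cst (c : R) : profile setT (cst (c ^+ 2 / 2)) (cst c) (cst 0).
Proof.
split => //; first exact: aeW.
split; first exact: loc_int_cst.
by move=> x y xy; rewrite itg_cst// mul0r /= subrr.
Qed.

Lemma ae_dense_ge0 G W : (\forall x \ae mu, G x) -> continuous W ->
  (forall x, G x -> 0 <= W x) -> forall x, 0 <= W x.
Proof.
move=> aG cW W0 x; rewrite leNgt; apply/negP => Wx.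
have NW : 0 < - W x by rewrite oppr_gt0.
have := @cW x; move=> /cvgrPdist_lt/(_ _ NW)/nbhs_ballP[d /= d0 H].
have [|g Gg /andP[xg gd]] := @ae_dense R _ aG x (x + d); first by rewrite ltrDl.
have := H g; rewrite /ball/= => /(_ _) /=; have := W0 g Gg => Wg.
have xgd : `|x - g| < d by rewrite ltr_norml; lra.
by move=> /(_ xgd); rewrite ltr_norml => /andP[]; lra.
Qed.

Lemma profile_ge0 G W u v : profile G W u v -> forall x, 0 <= W x.
Proof.
move=> [aG mu_ pW sq _]; apply: (ae_dense_ge0 aG (prim_continuous pW)) => x Gx.
by rewrite sq// divr_ge0// sqr_ge0.
Qed.

(* Where [W1 > W2], the sign of [u1 - u2] is that of [u1]. *)
Lemma profile_kato G1 W1 u1 v1 G2 W2 u2 v2 (phi psi : R -> R) :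
  profile G1 W1 u1 v1 -> profile G2 W2 u2 v2 ->
  prim phi psi -> (forall x, 0 <= phi x) ->
  forall x y, (G1 `&` G2) x -> (G1 `&` G2) y -> x <= y ->
  Num.sg (u1 y - u2 y) * ((W1 y - W2 y) * phi y) -
    Num.sg (u1 x - u2 x) * ((W1 x - W2 x) * phi x) <=
  itg (fun z => Num.sg (u1 z - u2 z) *
    ((W1 z - W2 z) * psi z + (v1 z - v2 z) * phi z)) x y.
Proof.
move=> p1 p2 pphi phi0.
have W10 := profile_ge0 p1; have W20 := profile_ge0 p2.
case: p1 => aG1 m1 pW1 sq1 sg1; case: p2 => aG2 m2 pW2 sq2 sg2.
have pD : prim (fun x => W1 x - W2 x) (fun x => v1 x - v2 x).
  split; first exact: loc_intB pW1.1 pW2.1.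
  move=> x y xy; rewrite itgB; [|exact: pW1.1|exact: pW2.1].
  by rewrite -pW1.2// -pW2.2//; ring.
apply: (sign_lemma (primM pD pphi)).
- exact: ae_and.
- apply: (@measurableT_comp _ _ _ _ _ _ (@Num.sg R)); last exact: measurable_funB.
  exact: measurable_sg.
- by move=> x; rewrite normr_sg; case: (_ != _).
- move=> x [G1x G2x] P0; rewrite normr_sg; case: (eqVneq (u1 x) (u2 x)) => [E|E].
    by move: P0; rewrite sq1// sq2// E subrr mul0r eqxx.
  by rewrite subr_eq0 E.
move=> x y [G1x G2x] [G1y G2y] xy P0.
have phip z : x <= z <= y -> 0 < phi z.
  move=> /P0; rewrite mulf_eq0 negb_or => /andP[_ ?].
  by rewrite lt_def phi0 andbT.
have xx : x <= x <= y by rewrite lexx ltW.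
have yy : x <= y <= y by rewrite lexx ltW.
rewrite !mulrA (pmulr_lgt0 _ (phip _ yy)) (pmulr_lgt0 _ (phip _ xx)).
have D0 z : x <= z <= y -> W1 z - W2 z != 0.
  by move=> /P0; rewrite mulf_eq0 negb_or => /andP[].
have cD := prim_continuous pD.
have [Dy|Dy] := ltP 0 (W1 y - W2 y).
  have Dz z : x <= z <= y -> 0 < W1 z - W2 z.
    by move=> zxy; exact: (nonzero_sign cD D0 yy zxy).
  have Dx := Dz x xx.
  rewrite !pmulr_lgt0// !sgr_gt0 => uy.
  have W1p z : x <= z <= y -> 0 < W1 z by move=> /Dz; have := W20 z; lra.
  have sq (a b : R) : b ^+ 2 / 2 < a ^+ 2 / 2 -> (0 < a - b) = (0 < a).
    by move=> ab; apply/idP/idP => h; nra.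
  have ux : 0 < u1 x.
    apply: (sg1 x y) => //; rewrite -(sq _ (u2 y))//.
    by rewrite -sq1// -sq2//; lra.
  by rewrite sq// -sq1// -sq2//; lra.
have {}Dy : 0 < - (W1 y - W2 y) by rewrite oppr_gt0 lt_def Dy andbT eq_sym D0.
have cN : continuous (fun z => - (W1 z - W2 z)) by move=> z; apply: cvgN; exact: cD.
have Dz z : x <= z <= y -> W1 z - W2 z < 0.
  move=> zxy; rewrite -oppr_gt0; apply: (nonzero_sign cN _ yy zxy) => // t txy.
  by rewrite oppr_eq0 D0.
rewrite !nmulr_lgt0 ?Dz// !sgr_lt0 => uy.
have W2p z : x <= z <= y -> 0 < W2 z by move=> /Dz; have := W10 z; lra.
have sq (a b : R) : a ^+ 2 / 2 < b ^+ 2 / 2 -> (a - b < 0) = (0 < b).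
  by move=> ab; apply/idP/idP => h; nra.
have ux : 0 < u2 x.
  apply: (sg2 x y) => //; rewrite -(sq (u1 y))//.
  by rewrite -sq1// -sq2//; have := Dz y yy; lra.
by rewrite sq// -sq1// -sq2//; have := Dz x xx; lra.
Qed.

End profiles.

(** * Comparison of profiles and the entropy inequality *)

Section entropy_profiles.
Context {R : realType}.
Local Notation mu := (@lebesgue_measure R).
Local Notation TR := (measurableTypeR R).
Implicit Types (f g W : R -> R) (x y z : R) (G : set R) (u v : L1 R).

Lemma itg_cvg f (a b : nat -> R) : mu.-integrable setT (EFin \o f) ->
  (forall n, a n <= - n%:R) -> (forall n, n%:R <= b n) ->
  itg f (a n) (b n) @[n --> \oo] --> \int[mu]_x f x.
Proof.
move=> intf an bn.
have mf : measurable_fun setT (EFin \o f) by case/integrableP : intf.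
pose F n x := ((f \_ `[a n, b n]) x)%:E.
have mF n : measurable_fun setT (F n).
  apply/measurable_EFinP; apply/(measurable_restrict _ _ _) => //.
  by rewrite setTI; apply: measurable_funTS; exact/measurable_EFinP.
have cF : {ae mu, forall x, setT x -> F ^~ x @ \oo --> (EFin \o f) x}.
  apply: aeW => x _; apply: cvg_near_cst; near=> n.
  have xn : `|x| <= n%:R by near: n; exact: nbhs_infty_ger.
  rewrite /F patchE mem_set//= in_itv/=.
  by move: xn; rewrite ler_norml => /andP[x1 x2]; rewrite (le_trans (an n))//= (le_trans x2).
have bF : {ae mu, forall x n, setT x -> (`|F n x| <= `|(EFin \o f) x|)%E}.
  apply: aeW => x n _; rewrite /F patchE; case: ifPn => //= _.
  by rewrite normr0 lee_fin.
have [_ _] := @dominated_convergence _ TR R mu setT measurableT F (EFin \o f) _ mF mf cF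
  (integrable_abse intf) bF.
rewrite -[X in _ --> X]fineK; last exact: integrable_fin_num.
move=> /fine_cvgP[_].
apply: cvg_trans; apply: near_eq_cvg; apply: nearW => n /=.
by rewrite /itg Rintegral_mkcond.
Unshelve. all: by end_near. Qed.

(** Chebyshev's argument: if |f| exceeded [e] almost everywhere on an interval of length (I + 1) /
    e, its integral would exceed I. An integrable function need not tend to 0 at infinity, so good
    points are chosen instead. *)
Lemma small_somewhere f G (e : R) : mu.-integrable setT (EFin \o f) ->
  (\forall x \ae mu, G x) -> 0 < e ->
  exists2 N : R, 0 < N & forall a, exists2 x, G x & a <= x <= a + N /\ `|f x| <= e.
Proof.
move=> intf aG e0.
pose I : R := \int[mu]_x `|f x|.
have I0 : 0 <= I by apply: Rintegral_ge0.
exists ((I + 1) / e); first by rewrite divr_gt0// ltr_wpDl.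
move=> a; set N := _ / e; apply: contrapT => nx.
have N0 : 0 < N by rewrite divr_gt0// ltr_wpDl.
have iloc := loc_int_norm (integrable_loc_int intf).
have : itg (cst e) a (a + N) <= itg (fun z => `|f z|) a (a + N).
  (* [h] equals |f| where |f| >= e and is above [e] elsewhere; it turns an almost everywhere bound
     into one that holds everywhere. *)
  pose h z := `|f z| + `| `|f z| - e| - (`|f z| - e).
  have ie := loc_intB iloc (loc_int_cst e).
  have ih : loc_int h by apply: loc_intB => //; apply: loc_intD => //; exact: loc_int_norm.
  rewrite (@ae_eq_itg _ (fun z => `|f z|) h)//.
    apply: le_itg => //; first exact: loc_int_cst.
    move=> z _; rewrite /h /cst; have [h0|h0] := leP 0 (`|f z| - e).
      by rewrite (ger0_norm h0); lra.
    by rewrite (ltr0_norm h0); lra.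
  apply: ae_mono aG => z Gz /andP[az zN]; rewrite /h (ger0_norm (x := `|f z| - e)) ?addrK//.
  rewrite subr_ge0 leNgt; apply/negP => fz; apply: nx; exists z => //.
  by split; [rewrite !ltW|exact: ltW].
rewrite itg_cst; last by rewrite lerDl ltW.
rewrite addrAC subrr add0r /N mulrC divfK ?gt_eqF// => H.
have : itg (fun z => `|f z|) a (a + N) <= I.
  have in1 : mu.-integrable setT (EFin \o (fun z => `|f z|)) by exact: (integrable_abse intf).
  rewrite /itg Rintegral_mkcond; apply: le_Rintegral => //.
    rewrite -restrict_EFin; apply/integrable_restrict => //; rewrite setTI.
    exact: iloc.2.
  by move=> z _; rewrite patchE; case: ifPn => // _; exact: normr_ge0.
lra.
Qed.

(** [profile_kato] with phi = 1 bounds the integral over [a n, b n] by boundary terms. These are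
    small when the endpoints, tending to - oo and + oo, are chosen where the integrable function W1
    - W2 is small. *)
Lemma profile_integral_ge0 G1 W1 (u1 v1 : R -> R) G2 W2 (u2 v2 : R -> R) :
  profile G1 W1 u1 v1 -> profile G2 W2 u2 v2 ->
  mu.-integrable setT (EFin \o (fun x => u1 x ^+ 2 / 2)) ->
  mu.-integrable setT (EFin \o (fun x => u2 x ^+ 2 / 2)) ->
  mu.-integrable setT (EFin \o v1) -> mu.-integrable setT (EFin \o v2) ->
  0 <= \int[mu]_x (Num.sg (u1 x - u2 x) * (v1 x - v2 x)).
Proof.
move=> p1 p2 i1 i2 j1 j2.
pose f x := Num.sg (u1 x - u2 x) * (v1 x - v2 x).
have [m1 m2] := (profile_measurable p1, profile_measurable p2).
have mf : measurable_fun [set: TR] (f : TR -> TR).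
  apply: measurable_funM; last first.
    by case: (loc_intB (integrable_loc_int j1) (integrable_loc_int j2)).
  apply: (@measurableT_comp _ _ _ _ _ _ (@Num.sg R)); first exact: measurable_sg.
  exact: measurable_funB.
have jB := integrableB measurableT j1 j2.
have intf : mu.-integrable setT (EFin \o f).
  apply: le_integrable jB => //; first exact/measurable_EFinP.
  move=> x _ /=; rewrite lee_fin normrM ler_piMl// normr_sg.
  by case: (_ != _).
have aG := ae_and (profile_ae p1) (profile_ae p2).
have iD : mu.-integrable setT (EFin \o (fun x => u1 x ^+ 2 / 2 - u2 x ^+ 2 / 2)).
  exact: (integrableB measurableT i1 i2).
rewrite leNgt; apply/negP => I0.
(* If the integral I were negative, the bound - 2 e = I / 2 would lie strictly above it. *)
pose e := - (\int[mu]_x f x) / 4.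
have e0 : 0 < e by rewrite divr_gt0// oppr_gt0.
have [N N0 HN] := small_somewhere iD aG e0.
pose a n := projT1 (cid2 (HN (- n%:R - N))).
pose b n := projT1 (cid2 (HN n%:R)).
have aP n : [/\ (G1 `&` G2) (a n), a n <= - n%:R & `|W1 (a n) - W2 (a n)| <= e].
  rewrite /a; case: cid2 => x /= [Gx1 Gx2] [/andP[_ xn]].
  by rewrite (profile_sqr p1)// (profile_sqr p2)// => ?; split => //; move: xn; rewrite subrK.
have bP n : [/\ (G1 `&` G2) (b n), n%:R <= b n & `|W1 (b n) - W2 (b n)| <= e].
  rewrite /b; case: cid2 => x /= [Gx1 Gx2] [/andP[xn _]].
  by rewrite (profile_sqr p1)// (profile_sqr p2)// => ?; split.
have cv : itg f (a n) (b n) @[n --> \oo] --> \int[mu]_x f x.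
  by apply: itg_cvg => // n; [case: (aP n)|case: (bP n)].
have p01 : prim (cst (1 : R)) (cst 0).
  by split; [exact: loc_int_cst|move=> x y xy; rewrite itg_cst// mul0r subrr].
have lower n : - (2 * e) <= itg f (a n) (b n).
  have [Ga an ea] := aP n; have [Gb bn eb] := bP n.
  have ab : a n <= b n.
    by apply: le_trans an (le_trans _ bn); rewrite -subr_ge0 opprK addr_ge0.
  have := profile_kato p1 p2 p01 (fun=> ler01) Ga Gb ab.
  have -> : itg (fun z => Num.sg (u1 z - u2 z) *
      ((W1 z - W2 z) * cst 0 z + (v1 z - v2 z) * cst 1 z)) (a n) (b n) = itg f (a n) (b n).
    by apply: eq_itg => z _; rewrite /f /cst mulr0 add0r mulr1.
  apply: le_trans.
  have sgle (t d : R) : `|d| <= e -> `|Num.sg t * (d * 1)| <= e.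
    by move=> h; rewrite mulr1 normrM (le_trans _ h)// ler_piMl// normr_sg; case: (_ != _).
  have := sgle (u1 (a n) - u2 (a n)) _ ea; have := sgle (u1 (b n) - u2 (b n)) _ eb.
  rewrite !ler_norml /cst => /andP[? ?] /andP[? ?]; lra.
have : - (2 * e) <= \int[mu]_x f x.
  rewrite -(cvg_lim _ cv)//; apply: limr_ge; first exact: cvgP cv.
  exact: nearW.
by move: e0; rewrite /e; lra.
Qed.

(** Pointwise |a + l d| >= |a| + l sg(a) d, also at a = 0 because sg(0) = 0; the integral of the
    last term is nonnegative. *)
Lemma profile_dist (u1 v1 u2 v2 : L1 R) G1 W1 G2 W2 (l : R) :
  profile G1 W1 u1 v1 -> profile G2 W2 u2 v2 ->
  mu.-integrable setT (EFin \o (fun x => u1 x ^+ 2 / 2)) ->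
  mu.-integrable setT (EFin \o (fun x => u2 x ^+ 2 / 2)) -> 0 < l ->
  `|u1 - u2| <= `|u1 - u2 + l *: (v1 - v2)|.
Proof.
move=> p1 p2 i1 i2 l0.
have := profile_integral_ge0 p1 p2 i1 i2 (integrable_L1 v1) (integrable_L1 v2).
pose f x := Num.sg (u1 x - u2 x) * (v1 x - v2 x); rewrite -/f => f0.
have mf : measurable_fun [set: TR] (f : TR -> TR).
  apply: measurable_funM; last by apply: measurable_funB; exact: measurable_L1.
  apply: (@measurableT_comp _ _ _ _ _ _ (@Num.sg R)); first exact: measurable_sg.
  by apply: measurable_funB; exact: measurable_L1.
have jB := integrableB measurableT (integrable_L1 v1) (integrable_L1 v2).
have intf : mu.-integrable setT (EFin \o f).
  apply: le_integrable jB => //; first exact/measurable_EFinP.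
  move=> x _ /=; rewrite lee_fin normrM ler_piMl// normr_sg.
  by case: (_ != _).
have iu : mu.-integrable setT (EFin \o (fun x => `|u1 x - u2 x|)).
  exact: (integrable_abse (integrableB measurableT (integrable_L1 u1) (integrable_L1 u2))).
have ilf : mu.-integrable setT (EFin \o (fun x => l * f x)).
  by have := integrableZl measurableT l intf; exact: eq_integrable.
have iw0 : mu.-integrable setT (EFin \o (fun x => u1 x - u2 x + l * (v1 x - v2 x))).
  have H1 := integrableB measurableT (integrable_L1 u1) (integrable_L1 u2).
  have H2 := integrableZl measurableT l jB.
  by have := integrableD measurableT H1 H2; exact: eq_integrable.
have iw : mu.-integrable setT (EFin \o (fun x => `|u1 x - u2 x + l * (v1 x - v2 x)|)).
  exact: (integrable_abse iw0).
have -> : `|u1 - u2 + l *: (v1 - v2)| =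
    \int[mu]_x `|u1 x - u2 x + l * (v1 x - v2 x)|.
  rewrite /Rintegral -[LHS]/(fine (`|_|%:E)) L1_normE; congr fine.
  apply: ae_eq_integral => //.
  - apply: (@measurableT_comp _ _ _ _ _ _ (@abse R)) => //.
    by apply/measurable_EFinP; exact: measurable_L1.
  - by case/integrableP : iw.
  - have H1 := L1D (u1 - u2) (l *: (v1 - v2)); have H2 := L1B u1 u2.
    have H3 := L1Z l (v1 - v2); have H4 := L1B v1 v2.
    apply: ae_mono (ae_and (ae_and H1 H2) (ae_and H3 H4)) => x.
    by move=> [[/(_ I) -> /(_ I) h2] [/(_ I) h3 /(_ I) h4]] _ /=; rewrite h2 h3 /= h4.
rewrite L1_dist; apply: (@le_trans _ _ (\int[mu]_x (`|u1 x - u2 x| + l * f x))).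
  by rewrite RintegralD// lerDl RintegralZl// mulr_ge0// ltW.
have is_ : mu.-integrable setT (EFin \o (fun x => `|u1 x - u2 x| + l * f x)).
  by have := integrableD measurableT iu ilf; exact: eq_integrable.
apply: (le_Rintegral measurableT is_ iw) => x _; rewrite /f; set a := u1 x - u2 x; set d := v1 x - v2 x.
have [a0|a0|->] := ltrgt0P a.
- by rewrite (gtr0_sg a0) mul1r ler_norm.
- by rewrite (ltr0_sg a0) mulN1r mulrN -opprD -normrN ler_norm.
- by rewrite sgr0 mul0r mulr0 addr0.
Qed.

Lemma test_prim (phi : R -> R) : test_function phi ->
  prim phi phi^`()%classic /\ continuous phi^`()%classic.
Proof.
move=> [dphi _].
have c' : continuous phi^`()%classic.
  by move=> x; apply: differentiable_continuous; apply/derivable1_diffP; exact: (dphi 1%N x).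
by split => //; apply: prim_C1 => // x; exact: (dphi 0%N x).
Qed.

Lemma test_support (phi : R -> R) : test_function phi ->
  exists M, forall z, M < `|z| -> phi z = 0 /\ phi^`()%classic z = 0.
Proof.
move=> [_ cphi]; have [M [_ HM]] := compact_bounded cphi.
exists (M + 1) => z Mz; have nz : ~ closure [set x | phi x != 0] z.
  move=> cz; have := HM (M + 1) _ z cz; rewrite ltrDl => /(_ ltr01) /=.
  by rewrite leNgt Mz.
have nearz : \forall t \near z, phi t = cst 0 t.
  have : nbhs z (~` closure [set x | phi x != 0]).
    by apply: open_nbhs_nbhs; split => //; apply: closed_openC; exact: closed_closure.
  apply: filterS => t nt; apply/eqP; rewrite -[_ == _]negbK; apply/negP => ?.
  by apply: nt; apply: subset_closure.
split; first exact: nbhs_singleton nearz.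
by rewrite derive1E (near_eq_derive _ nearz) derive_cst.
Qed.

(** This is [profile_kato] against the constant profile [l], between two points of [G] outside the
    support of [phi], where the boundary terms vanish. *)
Lemma profile_entropy_pair G W (u v : L1 R) : profile G W u v ->
  mu.-integrable setT (fun x => ((u x) ^+ 2 / 2)%:E) -> entropy_pair u v.
Proof.
move=> p iu; split => // l phi [dphi cphi] phi0.
have [pphi cont'] := test_prim (conj dphi cphi).
have [M phiM] := test_support (conj dphi cphi).
have aG := profile_ae p.
have [|x Gx /andP[_ xM]] := @ae_dense R G aG (- `|M| - 1) (- `|M|); first lra.
have [|y Gy /andP[My _]] := @ae_dense R G aG (`|M|) (`|M| + 1); first lra.
have M1 := ler_norm (M).
have N1 : 0 <= `|M| by exact: normr_ge0.
have [px px'] : phi x = 0 /\ phi^`()%classic x = 0.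
  by apply: phiM; rewrite -normrN (lt_le_trans _ (ler_norm _))//; lra.
have [py py'] : phi y = 0 /\ phi^`()%classic y = 0.
  by apply: phiM; rewrite (lt_le_trans _ (ler_norm _))//; lra.
have xy : x <= y.
  lra.
have := profile_kato p (profile_cst l) pphi phi0 (conj Gx Logic.I) (conj Gy Logic.I) xy.
rewrite px py !mulr0 subrr /cst; set f := fun z => _.
pose g z := Num.sg (u z - l) *
  ((u z ^+ 2 - l ^+ 2) / 2 * phi^`()%classic z + v z * phi z).
suff -> : \int[mu]_z g z = itg f x y by [].
rewrite /itg [RHS]Rintegral_mkcond /Rintegral; congr fine.
have [mu_ mv] := (measurable_L1 u, measurable_L1 v).
have mphi : measurable_fun [set: TR] (phi : TR -> TR).
  by apply: continuous_measurable_fun; exact: prim_continuous pphi.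
have mphi' : measurable_fun [set: TR] (phi^`()%classic : TR -> TR).
  exact: continuous_measurable_fun.
have mW : measurable_fun [set: TR] (W : TR -> TR).
  by apply: continuous_measurable_fun; exact: prim_continuous (profile_prim p).
have msg : measurable_fun [set: TR] (fun z : TR => Num.sg (u z - l) : TR).
  apply: (@measurableT_comp _ _ _ _ _ _ (@Num.sg R)); first exact: measurable_sg.
  exact: measurable_funB.
apply: ae_eq_integral => //.
- apply/measurable_EFinP; apply: measurable_funM => //; apply: measurable_funD.
    apply: measurable_funM => //; apply: measurable_funM => //.
    by apply: measurable_funB => //; exact: measurable_funX.
  exact: measurable_funM.
- apply/measurable_EFinP; apply/(measurable_restrict _ _ _) => //.
  rewrite setTI; apply: measurable_funTS.
  apply: measurable_funM => //; apply: measurable_funD.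
    by apply: measurable_funM => //; apply: measurable_funB.
  by apply: measurable_funM => //; apply: measurable_funB.
apply: ae_mono aG => z Gz _ /=; congr (_%:E).
rewrite patchE; case: ifPn => zxy.
  by rewrite /g /f (profile_sqr p Gz) subr0 mulrBl.
have [pz pz'] : phi z = 0 /\ phi^`()%classic z = 0.
  apply: phiM; move: zxy; rewrite notin_setE/= in_itv/= => /negP.
  rewrite negb_and -!ltNge => /orP[zx|yz].
    by rewrite -normrN (lt_le_trans _ (ler_norm _))//; lra.
  by rewrite (lt_le_trans _ (ler_norm _))//; lra.
by rewrite /g pz pz' !mulr0 addr0 mulr0.
Qed.

End entropy_profiles.

(** * Smooth test functions *)

Section smooth_functions.
Context {R : realType}.
Local Notation mu := (@lebesgue_measure R).
Local Notation TR := (measurableTypeR R).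
Implicit Types (f g : R -> R) (x y z : R) (n m : nat).

(** The recursion passes to the derivative, so that sums, products and affine changes of variable
    follow by induction. Index [n] means n + 1 derivatives. *)
Fixpoint smooth_upto n f : Prop := (forall x, derivable f x 1) /\
  if n is m.+1 then smooth_upto m f^`()%classic else True.

Lemma smooth_upto_derivable n f x : smooth_upto n f -> derivable f x 1.
Proof. by case: n => [|n] []. Qed.

Lemma derivable_derive1n n f : smooth_upto n f ->
  forall x, derivable (derive1n n f) x 1.
Proof.
elim: n f => [|n ih] f [df sf] x; first by rewrite derive1n0; exact: df.
by rewrite /derive1n iterSr; exact: (ih _ sf).
Qed.

Lemma smooth_uptoW n f : smooth_upto n.+1 f -> smooth_upto n f.
Proof.
elim: n f => [|n ih] f; first by move=> [df _]; split; [exact: df|exact: I].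
by move=> [df sf]; split; [exact: df|exact: (ih _ sf)].
Qed.

Lemma smooth_uptoD n f g : smooth_upto n f -> smooth_upto n g ->
  smooth_upto n (fun x => f x + g x).
Proof.
elim: n f g => [|n ih] f g [df sf] [dg sg].
  by split; [move=> x; exact: (derivableD (df x) (dg x))|exact: I].
split; first by move=> x; exact: (derivableD (df x) (dg x)).
have -> : (fun x => f x + g x)^`()%classic = (fun x => f^`()%classic x + g^`()%classic x).
  by apply/funext => x; rewrite !derive1E (deriveD (df x) (dg x)).
exact: (ih _ _ sf sg).
Qed.

Lemma smooth_uptoM n f g : smooth_upto n f -> smooth_upto n g ->
  smooth_upto n (fun x => f x * g x).
Proof.
elim: n f g => [|n ih] f g sf sg.
  case: sf => df _; case: sg => dg _; split; last exact: I.
  by move=> x; exact: (derivableM (df x) (dg x)).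
have [sf' sg'] := (smooth_uptoW sf, smooth_uptoW sg).
case: sf => df sf; case: sg => dg sg; split.
  by move=> x; exact: (derivableM (df x) (dg x)).
have -> : (fun x => f x * g x)^`()%classic =
    (fun x => f x * g^`()%classic x + g x * f^`()%classic x).
  by apply/funext => x; rewrite !derive1E (deriveM (df x) (dg x)).
exact: (smooth_uptoD (ih _ _ sf' sg) (ih _ _ sg' sf)).
Qed.

Lemma smooth_upto_cst n (c : R) : smooth_upto n (cst c).
Proof.
elim: n c => [|n ih] c; split => //.
have -> : (cst c)^`()%classic = cst (0 : R) by apply/funext => x; exact: derive1_cst.
exact: ih.
Qed.

Lemma smooth_upto_affine n f (a b : R) : smooth_upto n f ->
  smooth_upto n (fun x => f (a * x + b)).
Proof.
have aff x : is_derive x 1 (fun x : R => a * x + b) a.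
  by apply: is_derive_eq; rewrite addr0 /GRing.scale/= mulr1.
have comp (h : R -> R) : (forall x, derivable h x 1) ->
    forall x, is_derive x 1 (h \o (fun x : R => a * x + b)) (h^`()%classic (a * x + b) * a).
  move=> dh x; apply: is_derive1_comp => //.
  by rewrite derive1E; apply/derivableP; exact: dh.
elim: n f => [|n ih] f [df sf].
  by split; [move=> x; have [] := comp f df x|exact: I].
split; first by move=> x; have [] := comp f df x.
have -> : (fun x => f (a * x + b))^`()%classic = (fun x => f^`()%classic (a * x + b) * cst a x).
  by apply/funext => x; rewrite derive1E; have [_ ->] := comp f df x.
exact: (smooth_uptoM (ih _ sf) (smooth_upto_cst n a)).
Qed.

(** [flat 0] is the classical exp (- 1 / x). The powers are included because the derivative of
    [flat n] is a combination of [flat n.+2] and [flat n.+1], which makes smoothness an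
    induction. *)
Definition flat n x : R := if 0 < x then (x^-1) ^+ n * expR (- x^-1) else 0.

(** With t = 1 / x, exp t dominates t^(n+1) / (n+1)!. The spare factor |x|, used at index n + 1,
    makes the difference quotient of [flat n] at 0 tend to 0. *)
Lemma flat_bound n x : 0 <= flat n x <= n.+1`!%:R * `|x|.
Proof.
rewrite /flat; have [x0|x0] := ltP 0 x; last by rewrite lexx mulr_ge0.
have t0 : 0 < x^-1 by rewrite invr_gt0.
rewrite mulr_ge0 ?exprn_ge0 ?expR_ge0 ?(ltW t0)//= (gtr0_norm x0).
have := expR_ge1Dxn n (ltW t0).
set t := x^-1 in t0 *; have -> : x = t^-1 by rewrite invrK.
rewrite expRN ler_pdivrMr ?expR_gt0// -mulrA (mulrC t^-1) mulrA ler_pdivlMr//.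
move=> H; rewrite -exprSr -ler_pdivrMl ?ltr0n ?fact_gt0// mulrC.
by apply: le_trans H; rewrite lerDr.
Qed.

Lemma is_derive_flat n x : is_derive x 1 (flat n) (flat n.+2 x - n%:R * flat n.+1 x).
Proof.
have [x0|x0|->] := ltrgt0P x.
- have nearx : \forall y \near x, ((fun y => y^-1 ^+ n * expR (- y^-1)) : R -> R) y = flat n y.
    near=> y; rewrite /flat ifT//; near: y; exact: lt_nbhsr.
  apply: near_eq_is_derive nearx _.
  have d1 : is_derive x 1 (fun y : R => y^-1) (- x^-1 ^+ 2).
    have xn0 : x != 0 by rewrite gt_eqF.
    split; first exact: (@derivableV _ _ id).
    by rewrite (@deriveV _ _ id)// derive_id -exprVn /GRing.scale/= mulr1.
  have d2 (t : R) : is_derive t 1 (fun t : R => t ^+ n * expR (- t))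
      (n%:R * t ^+ n.-1 * expR (- t) - t ^+ n * expR (- t)).
    have dX := @is_deriveX _ _ id n t 1 1 (is_derive_id _ _).
    have dE : is_derive t 1 (fun t : R => expR (- t)) (- expR (- t)).
      by apply: is_derive_eq; rewrite mulrN1.
    have -> : (fun t : R => t ^+ n * expR (- t)) = (id ^+ n) * (fun t : R => expR (- t)).
      by apply/funext => z; rewrite exprfctE.
    apply: (is_derive_eq (is_deriveM dX dE)).
    by rewrite exprfctE /GRing.scale /=; ring.
  have -> : flat n.+2 x - n%:R * flat n.+1 x =
    (n%:R * x^-1 ^+ n.-1 * expR (- x^-1) - x^-1 ^+ n * expR (- x^-1)) * - x^-1 ^+ 2.
    rewrite /flat x0; case: (n) => [|k] /=; first by rewrite !mul0r expr0; ring.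
    by rewrite -natr1 !exprS; ring.
  exact: (@is_derive1_comp _ (fun t : R => t ^+ n * expR (- t)) (fun y : R => y^-1)).
- have nearx : \forall y \near x, (cst 0 : R -> R) y = flat n y.
    near=> y; rewrite /flat ifF//; apply/negbTE; rewrite -leNgt ltW//; near: y; exact: lt_nbhsl.
  have -> : flat n.+2 x - n%:R * flat n.+1 x = 0.
    by rewrite /flat !ifF ?mulr0 ?subr0//; apply/negbTE; rewrite -leNgt ltW.
  by apply: near_eq_is_derive nearx _; exact: is_derive_cst.
- have -> : flat n.+2 0 - n%:R * flat n.+1 0 = 0.
    by rewrite /flat ltxx mulr0 subrr.
  have H : h^-1 *: ((flat n \o shift 0) (h *: 1) - flat n 0) @[h --> 0^'] --> (0 : R).
    apply/cvgrPdist_le => e e0; near=> h.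
    rewrite sub0r normrN /= {2}/flat ltxx subr0 addr0 /GRing.scale/= mulr1.
    have C0 : 0 < n.+2`!%:R :> R by rewrite ltr0n fact_gt0.
    have he : `|h| <= e / n.+2`!%:R.
      near: h; apply: dnbhs0_le; first by rewrite divr_gt0.
    have [h0|h0] := ltP 0 h; last first.
      by rewrite /flat ltNge h0 /= mulr0 normr0 ltW.
    have -> : h^-1 * flat n h = flat n.+1 h by rewrite /flat h0 exprS mulrA.
    have /andP[f0 f1] := flat_bound n.+1 h; rewrite ger0_norm// (le_trans f1)//.
    by rewrite mulrC -ler_pdivlMr.
  split; first by apply/cvg_ex; exists 0.
  exact: cvg_lim H.
Unshelve. all: by end_near.
Qed.

Lemma smooth_flat n m : smooth_upto m (flat n).
Proof.
elim: m n => [|m ih] n; split => //.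
- by move=> x; have := is_derive_flat n x; move=> [].
- by move=> x; have := is_derive_flat n x; move=> [].
rewrite (_ : _^`()%classic = (fun x => flat n.+2 x + (- n%:R) * flat n.+1 x)).
  apply: smooth_uptoD; first exact: ih.
  by apply: (smooth_uptoM (smooth_upto_cst m (- n%:R))); exact: ih.
by apply/funext => x; have [_] := is_derive_flat n x; rewrite derive1E => ->; rewrite mulNr.
Qed.

(** A smooth bump on (0, 1); [- 1 * x + 1] has the shape expected by [smooth_upto_affine]. *)
Definition mollifier x : R := flat 0 x * flat 0 (- 1 * x + 1).

Lemma smooth_mollifier m : smooth_upto m mollifier.
Proof. apply: smooth_uptoM; [exact: smooth_flat|apply: smooth_upto_affine; exact: smooth_flat]. Qed.

Lemma mollifier_ge0 x : 0 <= mollifier x.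
Proof. by rewrite mulr_ge0//; case/andP: (flat_bound 0 x); case/andP: (flat_bound 0 (- 1 * x + 1)). Qed.

Lemma mollifier_out x : ~~ (0 < x < 1) -> mollifier x = 0.
Proof.
rewrite /mollifier /flat negb_and -!leNgt => /orP[x0|x1].
  by rewrite ifF ?mul0r//; apply/negbTE; rewrite -leNgt.
by rewrite [X in _ * X]ifF ?mulr0//; apply/negbTE; rewrite -leNgt; lra.
Qed.

End smooth_functions.

(** * Monotonicity at Lebesgue points from smooth tests *)

Section distributional_monotonicity.
Context {R : realType}.
Local Notation mu := (@lebesgue_measure R).
Local Notation TR := (measurableTypeR R).
Implicit Types (f g H : R -> R) (x y z a b : R) (n m : nat).

Lemma mollifier_continuous : continuous (@mollifier R).
Proof.
move=> x; apply: differentiable_continuous; apply/derivable1_diffP.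
exact: (smooth_upto_derivable (smooth_mollifier 0%N)).
Qed.

Lemma mollifier_le1 x : mollifier x <= 1.
Proof.
have [x01|/mollifier_out ->//] := boolP (0 < x < 1).
have f1 (y : R) : flat 0 y <= 1.
  rewrite /flat; case: ifPn => // y0; rewrite expr0 mul1r -expR0 ler_expR.
  by rewrite oppr_le0 invr_ge0 ltW.
have f0 (y : R) : 0 <= flat 0 y by case/andP: (flat_bound 0 y).
by rewrite /mollifier -[leRHS]mulr1 ler_pM.
Qed.

Definition smooth_step x : R := \int[mu]_(t in `]-oo, x]) mollifier t.

Lemma integrable_mollifier : mu.-integrable setT (EFin \o @mollifier R).
Proof.
have [] // := @loc_int_support R mollifier 0 1 (continuous_loc_int mollifier_continuous).
by move=> x x01; apply: mollifier_out; apply: contra x01 => /andP[x0 x1]; rewrite !ltW.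
Qed.

Lemma is_derive_smooth_step x : is_derive x 1 smooth_step (mollifier x).
Proof.
have ib : mu.-integrable [set` `]-oo, x + 1]] (EFin \o @mollifier R).
  apply: (integrableS _ _ _ integrable_mollifier) => //.
have x1 : x < x + 1 by rewrite ltrDl.
have lx : (BInfty R true < BRight x)%E by rewrite ltNyr.
have [d1 d2] := continuous_FTC1 x1 ib lx (@mollifier_continuous x).
split; [exact: d1|by rewrite -derive1E].
Qed.

Lemma smooth_smooth_step m : smooth_upto m smooth_step.
Proof.
case: m => [|m]; (split; first by move=> x; have [] := is_derive_smooth_step x); first exact: I.
have -> : smooth_step^`()%classic = @mollifier R.
  by apply/funext => x; rewrite derive1E; have [_ ->] := is_derive_smooth_step x.
exact: smooth_mollifier.
Qed.

Lemma prim_smooth_step : prim smooth_step (@mollifier R).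
Proof. exact: (prim_derive is_derive_smooth_step mollifier_continuous). Qed.

Lemma smooth_step_le0 x : x <= 0 -> smooth_step x = 0.
Proof.
move=> x0; rewrite /smooth_step (@eq_Rintegral _ _ _ _ _ (cst 0)).
  by rewrite /Rintegral integral0.
move=> y; rewrite inE/= in_itv/= => yx; apply: mollifier_out.
by rewrite negb_and -!leNgt (le_trans yx x0).
Qed.

(** The mass of [mollifier]. It is not normalised to 1 but cancelled once, in [test_decreasing]. *)
Definition step_height : R := smooth_step 1.

Lemma smooth_step_ge1 x : 1 <= x -> smooth_step x = step_height.
Proof.
move=> x1; apply/eqP; rewrite -subr_eq0 prim_smooth_step.2// (@eq_itg _ _ (cst 0)).
  by rewrite itg_cst// mul0r.
move=> y /andP[y1 _]; apply: mollifier_out; by rewrite negb_and -!leNgt y1 orbT.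
Qed.

Lemma smooth_step_homo x y : x <= y -> smooth_step x <= smooth_step y.
Proof.
move=> xy; rewrite -subr_ge0 prim_smooth_step.2//; apply: itg_ge0 => z _.
exact: mollifier_ge0.
Qed.

(** On [1/4, 3/4] both factors of [mollifier] are at least exp (- 4). *)
Lemma step_height_gt0 : 0 < step_height.
Proof.
have lb := continuous_loc_int mollifier_continuous.
have : step_height - smooth_step 0 = itg (@mollifier R) 0 1 by exact: prim_smooth_step.2.
rewrite smooth_step_le0// subr0 => ->.
rewrite (@itg_chasles _ _ 0 4^-1 1 lb) ?(@itg_chasles _ _ 4^-1 (3 / 4) 1 lb); try lra.
have a1 : 0 <= itg (@mollifier R) 0 4^-1 by apply: itg_ge0 => z _; exact: mollifier_ge0.
have a2 : 0 <= itg (@mollifier R) (3 / 4) 1 by apply: itg_ge0 => z _; exact: mollifier_ge0.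
suff : itg (cst (expR (- 4) * expR (- 4) : R)) 4^-1 (3 / 4) <= itg (@mollifier R) 4^-1 (3 / 4).
  rewrite itg_cst; last by lra.
  have : 0 < expR (- 4 : R) * expR (- 4) by rewrite mulr_gt0 ?expR_gt0.
  lra.
apply: le_itg => //; first exact: loc_int_cst.
have f4 (y : R) : 4^-1 <= y -> expR (- 4) <= flat 0 y.
  move=> y4; have y0 : 0 < y by lra.
  rewrite /flat y0 expr0 mul1r ler_expR lerN2 -[4]invrK lef_pV2 ?posrE//; lra.
move=> z /andP[z1 z2]; rewrite /mollifier /cst ler_pM ?expR_ge0// f4//; lra.
Qed.

(* A smooth approximation of the indicator of [a, b]; [k] is the inverse width
   of the two transitions. *)
Definition plateau k a b x : R :=
  smooth_step (k * x - k * a) - smooth_step (k * x - k * b).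

Lemma plateau_test k a b : 0 < k -> a < b -> test_function (plateau k a b).
Proof.
move=> k0 ab.
have sm m : smooth_upto m (plateau k a b).
  have -> : plateau k a b = (fun x => smooth_step (k * x + - (k * a)) +
      cst (- 1) x * smooth_step (k * x + - (k * b))).
    by apply/funext => x; rewrite /plateau /cst mulN1r.
  apply: smooth_uptoD; first exact/smooth_upto_affine/smooth_smooth_step.
  apply: smooth_uptoM; first exact: smooth_upto_cst.
  exact/smooth_upto_affine/smooth_smooth_step.
split; first by move=> n x; exact: (derivable_derive1n (sm n)).
have sub : [set x | plateau k a b x != 0] `<=` `[a, b + k^-1].
  move=> x /=; rewrite in_itv/=; apply: contraTT; rewrite negb_and -!ltNge negbK.
  move=> /orP[xa|xb]; rewrite /plateau.
    rewrite !smooth_step_le0 ?subrr// -mulrBr pmulr_rle0// subr_le0; lra.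
  have xb' : 1 <= k * x - k * b.
    by rewrite -mulrBr mulrC -ler_pdivrMr// div1r; lra.
  rewrite !smooth_step_ge1 ?subrr// (le_trans xb')// lerB// ler_pM2l//; lra.
apply: (subclosed_compact (@closed_closure _ _) (@segment_compact R a (b + k^-1))).
rewrite [X in _ `<=` X](closure_id _).1; last exact: itv_closed.
exact: closureS.
Qed.

Lemma plateau_ge0 k a b x : 0 < k -> a <= b -> 0 <= plateau k a b x.
Proof.
by move=> k0 ab; rewrite subr_ge0; apply: smooth_step_homo; rewrite lerB// ler_pM2l.
Qed.

Lemma derive1_plateau k a b x : (plateau k a b)^`()%classic x =
  k * mollifier (k * x - k * a) - k * mollifier (k * x - k * b).
Proof.
have aff c : is_derive x 1 (fun x : R => k * x - c) k.
  by apply: is_derive_eq; rewrite oppr0 addr0 /GRing.scale/= mulr1.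
have comp c : is_derive x 1 (smooth_step \o (fun x : R => k * x - c)) (mollifier (k * x - c) * k).
  exact: (is_derive1_comp (is_derive_smooth_step _) (aff c)).
have [_ D] := is_deriveB (comp (k * a)) (comp (k * b)).
by rewrite derive1E [LHS]D !(mulrC k).
Qed.

Lemma scaled_mollifier_continuous k c : continuous (fun x => k * mollifier (k * x - c)).
Proof.
move=> x; apply: cvgM; first exact: cvg_cst.
apply: (@continuous_comp _ _ _ (fun x : R => k * x - c) mollifier); last exact: mollifier_continuous.
apply: cvgB; last exact: cvg_cst.
by apply: cvgM; [exact: cvg_cst|exact: cvg_id].
Qed.

Lemma prim_step k c : prim (fun x => smooth_step (k * x - c))
  (fun x => k * mollifier (k * x - c)).
Proof.
have aff x : is_derive x 1 (fun x : R => k * x - c) k.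
  by apply: is_derive_eq; rewrite oppr0 addr0 /GRing.scale/= mulr1.
have comp x : is_derive x 1 (smooth_step \o (fun x : R => k * x - c)) (mollifier (k * x - c) * k).
  exact: (is_derive1_comp (is_derive_smooth_step _) (aff x)).
apply: prim_derive => [x|]; first by rewrite mulrC; exact: comp.
exact: scaled_mollifier_continuous.
Qed.

(** Since [mollifier] is at most 1, the error is at most k times the integral of |H - H a| over
    [a, a + 1 / k], which the Lebesgue point property sends to 0. *)
Lemma lebesgue_pt_mollify H a : loc_int H -> lebesgue_pt H a ->
  itg (fun x => H x * (n.+1%:R * mollifier (n.+1%:R * x - n.+1%:R * a))) a (a + n.+1%:R^-1)
    @[n --> \oo] --> H a * step_height.
Proof.
move=> iH lH.
pose r n : R := n.+1%:R^-1.
have r0 n : 0 < r n by rewrite invr_gt0.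
(* The open ball of radius 2 r contains the closed interval [a, a + r]; its measure 4 r is the
   origin of the factor 4 in [bound]. *)
have cvd : davg H a (2 * r n) @[n --> \oo] --> 0%E.
  move/cvge_at_rightP : lH => /(_ (fun n => 2 * r n)) lH'; apply: lH'; split.
    by move=> n; rewrite mulr_gt0.
  rewrite -(mulr0 (2 : R)); apply: cvgM; first exact: cvg_cst.
  apply/cvgrPdist_lt => e e0; near=> n; rewrite sub0r normrN gtr0_norm//.
  by near: n; exact: near_infty_natSinv_lt (PosNum e0).
have bound n : (`|H a * step_height -
    itg (fun x => H x * (n.+1%:R * mollifier (n.+1%:R * x - n.+1%:R * a))) a (a + r n)|%:E
    <= 4%:E * davg H a (2 * r n))%E.
  set k : R := n.+1%:R.
  have k0 : 0 < k by rewrite ltr0n.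
  have kr : k * r n = 1 by rewrite /r divff ?gt_eqF.
  have ar : a <= a + r n by rewrite lerDl ltW.
  pose m x := k * mollifier (k * x - k * a).
  have pm := prim_step k (k * a).
  have cm : itg m a (a + r n) = step_height.
    rewrite -pm.2// mulrDr addrAC subrr add0r kr.
    by rewrite (smooth_step_le0 (lexx 0)) subr0.
  have cmc : continuous m by exact: scaled_mollifier_continuous.
  have iHm : loc_int (fun x => H x * m x).
    by have := loc_intMc cmc iH; under eq_fun do rewrite mulrC.
  have iHa : loc_int (fun x => H x - H a) by apply: loc_intB => //; exact: loc_int_cst.
  have iHam : loc_int (fun x => H a * m x).
    by apply: loc_intMc; [exact: cst_continuous|exact: pm.1].
  have -> : H a * step_height - itg (fun x => H x * m x) a (a + r n) =
      itg (fun x => H a * m x - H x * m x) a (a + r n).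
    by rewrite itgB// itgZ ?cm//; exact: pm.1.
  apply: (@le_trans _ _ (k * itg (fun x => `|H x - H a|) a (a + r n))%:E).
    rewrite lee_fin -itgZ; last exact: loc_int_norm.
    apply: (le_trans (le_norm_itg _ _ (loc_intB iHam iHm))).
    apply: le_itg.
    - exact: loc_int_norm (loc_intB iHam iHm).
    - by apply: loc_intMc; [exact: cst_continuous|exact: loc_int_norm].
    move=> z _; rewrite -mulrBl normrM mulrC distrC ler_wpM2r//.
    rewrite /m normrM (gtr0_norm k0) (ger0_norm (mollifier_ge0 _)).
    by rewrite -[leRHS]mulr1 ler_wpM2l ?(ltW k0)// mollifier_le1.
  have -> : davg H a (2 * r n) =
      ((k / 4)%:E * \int[mu]_(y in ball a (2 * r n)) `|(H y - H a)%:E|)%E.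
    rewrite /davg /iavg lebesgue_measure_ball ?mulr_ge0 ?(ltW (r0 n))// inver.
    rewrite gt_eqF ?mulrn_wgt0 ?mulr_gt0//; congr (_%:E * _)%E.
    rewrite /r -/k; field; rewrite gt_eqF//.
  rewrite muleA -EFinM (mulrC 4) divfK// EFinM lee_pmul2l//.
  rewrite /itg /Rintegral fineK; last first.
    by apply: integrable_fin_num => //; exact: (loc_int_norm iHa).2.
  apply: ge0_subset_integral => //.
  - exact: measurable_ball.
  - by apply/measurable_EFinP; apply: measurable_funTS; exact: (loc_int_norm iHa).1.
  move=> z; rewrite /= in_itv/= /ball/= => /andP[az zr].
  rewrite distrC ger0_norm ?subr_ge0//; have := r0 n; lra.
move/fine_cvgP : cvd => [fd /cvgrPdist_le cvd].
apply/cvgrPdist_le => e e0.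
have e4 : 0 < e / 4 by rewrite divr_gt0.
near=> n.
have fn : davg H a (2 * r n) \is a fin_num by near: n.
have : `|0 - fine (davg H a (2 * r n))| <= e / 4 by near: n; exact: cvd.
rewrite sub0r normrN => dn; have := bound n; rewrite -(fineK fn) -EFinM lee_fin.
by have := ler_norm (fine (davg H a (2 * r n))); lra.
Unshelve. all: by end_near. Qed.

(** The derivative of [plateau] is a bump just right of a minus a bump just right of b, so the
    tested inequality tends to a positive multiple of H a - H b >= 0. *)
Lemma test_decreasing H a b : loc_int H ->
  (forall phi, test_function phi -> (forall x, 0 <= phi x) ->
    0 <= \int[mu]_x (H x * phi^`()%classic x)) ->
  lebesgue_pt H a -> lebesgue_pt H b -> a < b -> H b <= H a.
Proof.
move=> iH H0 la lb ab.
have supp (k c : R) : 0 < k -> mu.-integrable setT (EFin \o (fun x => H x * (k * mollifier (k * x - k * c)))) /\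
    \int[mu]_x (H x * (k * mollifier (k * x - k * c))) =
    itg (fun x => H x * (k * mollifier (k * x - k * c))) c (c + k^-1).
  move=> k0; apply: loc_int_support.
    by have := loc_intMc (@scaled_mollifier_continuous k (k * c)) iH; under eq_fun do rewrite mulrC.
  move=> z; rewrite negb_and -!ltNge => zc; rewrite mollifier_out ?mulr0//.
  rewrite negb_and -!leNgt -mulrBr; case/orP: zc => zc; apply/orP; [left|right].
    by rewrite pmulr_rle0// subr_le0 ltW.
  by rewrite mulrC -ler_pdivrMr// div1r; lra.
suff : 0 <= H a * step_height - H b * step_height.
  by rewrite -mulrBl pmulr_lge0 ?step_height_gt0// subr_ge0.
pose M c n := itg (fun x => H x * (n.+1%:R * mollifier (n.+1%:R * x - n.+1%:R * c))) c (c + n.+1%:R^-1).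
have cv : (fun n => M a n - M b n) @ \oo --> H a * step_height - H b * step_height.
  by apply: cvgB; exact: lebesgue_pt_mollify.
rewrite -(cvg_lim _ cv)//; apply: limr_ge; first exact: cvgP cv.
apply: nearW => n /=.
have k0 : 0 < n.+1%:R :> R by rewrite ltr0n.
have [i1 e1] := supp _ a k0; have [i2 e2] := supp _ b k0.
rewrite /M -e1 -e2 -RintegralB//.
have := H0 _ (plateau_test k0 ab) (fun x => plateau_ge0 x k0 (ltW ab)).
congr (0 <= _); apply: eq_Rintegral => x _.
by rewrite derive1_plateau mulrBr.
Qed.

End distributional_monotonicity.

(** * Entropy pairs are profiles *)

Section entropy_to_profile.
Context {R : realType}.
Local Notation mu := (@lebesgue_measure R).
Local Notation TR := (measurableTypeR R).
Implicit Types (f g w W S : R -> R) (x y z a b : R) (n m : nat).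

Lemma prim_ex w x0 c : loc_int w -> exists2 S, prim S w & S x0 = c.
Proof.
(* The signed integral has to be written by cases, since [itg] vanishes on reversed intervals. *)
move=> iw; exists (fun x => c + (if x0 <= x then itg w x0 x else - itg w x x0)); last first.
  by rewrite lexx itg_xx addr0.
split => // x y xy; case: ifPn => [x0y|]; last rewrite -ltNge => yx0; case: ifPn => [x0x|].
- by rewrite (itg_chasles iw x0x xy); ring.
- by rewrite -ltNge => /ltW xx0; rewrite (itg_chasles iw xx0 x0y); ring.
- by have := le_lt_trans (le_trans x0x xy) yx0; rewrite ltxx.
- by move=> _; rewrite (itg_chasles iw xy (ltW yx0)); ring.
Qed.

Lemma test_by_parts S w (phi : R -> R) : prim S w -> test_function phi ->
  [/\ mu.-integrable setT (EFin \o (fun x => S x * phi^`()%classic x)),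
      mu.-integrable setT (EFin \o (fun x => w x * phi x)) &
      \int[mu]_x (S x * phi^`()%classic x) = - \int[mu]_x (w x * phi x)].
Proof.
move=> pS tphi; have [pphi c'] := test_prim tphi; have [M HM] := test_support tphi.
pose N := `|M| + 1.
have N0 : 0 < N by rewrite ltr_wpDl.
have MN : M < N by rewrite /N; have := ler_norm M; lra.
have out z : ~~ (- N <= z <= N) -> phi z = 0 /\ phi^`()%classic z = 0.
  by rewrite -ler_norml -ltNge => zN; apply: HM; exact: lt_trans zN.
have l1 : loc_int (fun x => S x * phi^`()%classic x).
  by apply: loc_intMc; [exact: prim_continuous pS|exact: continuous_loc_int].
have l2 : loc_int (fun x => w x * phi x).
  by have := loc_intMc (prim_continuous pphi) pS.1; under eq_fun do rewrite mulrC.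
have [|i1 e1] := @loc_int_support R _ (- N) N l1.
  by move=> z /out[_ ->]; rewrite mulr0.
have [|i2 e2] := @loc_int_support R _ (- N) N l2.
  by move=> z /out[-> _]; rewrite mulr0.
split => //; rewrite e1 e2; apply/eqP; rewrite -addr_eq0 -itgD//.
have pP := primM pS pphi; rewrite -pP.2; last lra.
(* [phi] vanishes at the end points, being continuous *)
have [E1 E2] : phi N = 0 /\ phi (- N) = 0.
  by split; apply: (HM _ _).1; rewrite ?normrN gtr0_norm.
by rewrite E1 E2 !mulr0 subrr.
Qed.

Lemma itg_dominated_cvg (F : nat -> R -> R) f g a b : (forall n, loc_int (F n)) ->
  loc_int f -> loc_int g -> (forall n x, `|F n x| <= g x) ->
  (forall x, F n x @[n --> \oo] --> f x) ->
  itg (F n) a b @[n --> \oo] --> itg f a b.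
Proof.
move=> iF intf intg Fg cF.
have me h : loc_int h -> measurable_fun `[a, b] (EFin \o h).
  by move=> ih; apply/measurable_EFinP; apply: measurable_funTS; exact: ih.1.
have cF' : {ae mu, forall x, `[a, b]%classic x ->
    (fun n => (EFin \o F n) x) @ \oo --> (EFin \o f) x}.
  apply: aeW => x _; apply/fine_cvgP; split; first exact: nearW.
  exact: cF.
have bF : {ae mu, forall x n, `[a, b]%classic x -> (`|(EFin \o F n) x| <= (EFin \o g) x)%E}.
  by apply: aeW => x n _; rewrite /= lee_fin.
have [_ _] := @dominated_convergence _ TR R mu `[a, b]%classic (measurable_itv _)
  (fun n => EFin \o F n) _ _ (fun n => me _ (iF n)) (me _ intf) cF' (intg.2 a b) bF.
have fin : (\int[mu]_(x in `[a, b]) (f x)%:E)%E \is a fin_num.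
  by apply: integrable_fin_num => //; exact: intf.2.
by rewrite /= -(fineK fin) => /fine_cvgP[_].
Qed.

Lemma itg_cvg_factor v (s : nat -> R -> R) (c a b : R) : loc_int v ->
  (forall n, measurable_fun [set: TR] (s n : TR -> TR)) ->
  (forall n x, `|s n x| <= 1) -> (forall x, \forall n \near \oo, s n x = c) ->
  itg (fun x => s n x * v x) a b @[n --> \oo] --> c * itg v a b.
Proof.
move=> iv ms s1 sc; rewrite -itgZ//; apply: itg_dominated_cvg.
- by move=> n; apply: loc_intM => // x y; exists 1.
- by apply: loc_intMc => //; exact: cst_continuous.
- exact: loc_int_norm iv.
- by move=> n x; rewrite normrM ler_piMl.
- by move=> x; apply: cvg_near_cst; apply: filterS (sc x) => n ->.
Qed.

Section one_pair.
Variables u v : L1 R.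
Hypothesis uv : entropy_pair u v.

Let iv : loc_int v. Proof. exact: integrable_loc_int (integrable_L1 v). Qed.
Let iu2 : loc_int (fun x => u x ^+ 2 / 2). Proof. exact: integrable_loc_int uv.1. Qed.

Let s (l x : R) : R := Num.sg (u x - l).

Let ms l : measurable_fun [set: TR] (s l : TR -> TR).
Proof.
apply: (@measurableT_comp _ _ _ _ _ _ (@Num.sg R)); first exact: measurable_sg.
by apply: measurable_funB => //; exact: measurable_L1.
Qed.

Let s1 l x : `|s l x| <= 1.
Proof. by rewrite normr_sg; case: (_ != _). Qed.

Let Q l x := s l x * (u x ^+ 2 / 2 - l ^+ 2 / 2).

Let loc_ints l f : loc_int f -> loc_int (fun x => s l x * f x).
Proof. by move=> intf; apply: loc_intM => // x y; exists 1. Qed.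

Let iQ l : loc_int (Q l).
Proof. by apply: loc_ints; apply: loc_intB => //; exact: loc_int_cst. Qed.

(** With S a primitive of sg (u - l) v, integration by parts turns the entropy inequality into the
    statement that Q - S, tested against phi', is nonnegative. Hence Q - S decreases along its
    Lebesgue points. *)
Lemma entropy_pair_pointwise l : exists2 G : set R, (\forall x \ae mu, G x) &
  forall a b, G a -> G b -> a < b -> Q l b - Q l a <= itg (fun x => s l x * v x) a b.
Proof.
have isv := loc_ints l iv.
have [S pS _] := prim_ex 0 0 isv.
pose H x := Q l x - S x.
have iS : loc_int S by apply: continuous_loc_int; exact: prim_continuous pS.
have iH : loc_int H by exact: loc_intB.
exists (lebesgue_pt H); first exact: loc_int_lebesgue_pt.
move=> a b la lb ab; rewrite -pS.2 ?(ltW ab)//.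
suff : H b <= H a by rewrite /H; lra.
apply: test_decreasing iH _ la lb ab => phi tphi phi0.
have [iS1 iw1 E] := test_by_parts pS tphi.
have [pphi c'] := test_prim tphi; have [M HM] := test_support tphi.
have [iQ1 _] : mu.-integrable setT (EFin \o (fun x => Q l x * phi^`()%classic x)) /\
    \int[mu]_x (Q l x * phi^`()%classic x) = itg (fun x => Q l x * phi^`()%classic x) (- (`|M| + 1)) (`|M| + 1).
  apply: loc_int_support.
    by have := loc_intMc c' (iQ l); under eq_fun do rewrite mulrC.
  move=> z; rewrite -ler_norml -ltNge => zN.
  have [|_ ->] := HM z; last by rewrite mulr0.
  by apply: lt_trans zN; have := ler_norm M; lra.
have -> : \int[mu]_x (H x * phi^`()%classic x) =
    \int[mu]_x (Q l x * phi^`()%classic x) + \int[mu]_x (s l x * v x * phi x).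
  rewrite -[X in _ + X]opprK -E -RintegralB//.
  by apply: eq_Rintegral => x _; rewrite /H mulrBl.
rewrite -RintegralD//; have := uv.2 l phi tphi phi0.
congr (0 <= _); apply: eq_Rintegral => x _; rewrite /Q /s; lra.
Qed.

(** Once n exceeds |u a| and |u b|, the signs at a and b agree and n^2 / 2 cancels from the
    increment. The constants - n and n give the two opposite inequalities of the equality. *)
Lemma entropy_pair_sqr : exists2 G : set R, (\forall x \ae mu, G x) &
  forall a b, G a -> G b -> a < b ->
    u b ^+ 2 / 2 - u a ^+ 2 / 2 = itg v a b /\
    Num.sg (u b) * (u b ^+ 2 / 2) - Num.sg (u a) * (u a ^+ 2 / 2) <=
      itg (fun x => Num.sg (u x) * v x) a b.
Proof.
pose G l := sval (cid2 (entropy_pair_pointwise l)).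
have GP l : (\forall x \ae mu, G l x) /\
    forall a b, G l a -> G l b -> a < b -> Q l b - Q l a <= itg (fun x => s l x * v x) a b.
  by rewrite /G; case: cid2.
(* Only integer constants are used, so that countably many null sets are discarded. *)
exists (fun x => G 0 x /\ forall n, G n%:R x /\ G (- n%:R) x).
  apply: ae_and; first exact: (GP 0).1.
  by apply: ae_foralln => n; apply: ae_and; [exact: (GP n%:R).1|exact: (GP (- n%:R)).1].
move=> a b [Ga0 Ga] [Gb0 Gb] ab; split; last first.
  have := (GP 0).2 a b Ga0 Gb0 ab; rewrite /Q /s !subr0 expr0n /= mul0r !subr0.
  by under [X in _ <= X]eq_itg do rewrite subr0.
have near_s x : (\forall n \near \oo, s n%:R x = - 1) /\ (\forall n \near \oo, s (- n%:R) x = 1).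
  split; near=> n.
    have : u x < n%:R by near: n; exact: nbhs_infty_gtr.
    by move=> un; rewrite /s ltr0_sg// subr_lt0.
  have : - u x < n%:R by near: n; exact: nbhs_infty_gtr.
  by move=> un; rewrite /s gtr0_sg// opprK; lra.
have c1 := @itg_cvg_factor v _ _ a b iv (fun n => ms n%:R) (fun n => s1 n%:R) (fun x => (near_s x).1).
have c2 := @itg_cvg_factor v _ _ a b iv (fun n => ms (- n%:R)) (fun n => s1 (- n%:R)) (fun x => (near_s x).2).
apply/eqP; rewrite eq_le; apply/andP; split.
  rewrite -[leRHS]mul1r -(cvg_lim _ c2)//; apply: limr_ge; first exact: cvgP c2.
  near=> n.
  have sa : s (- n%:R) a = 1 by near: n; exact: (near_s a).2.
  have sb : s (- n%:R) b = 1 by near: n; exact: (near_s b).2.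
  have := (GP (- n%:R)).2 a b (Ga n).2 (Gb n).2 ab.
  by rewrite /Q sa sb; lra.
rewrite -[leLHS]opprK -[leRHS]opprK lerN2 -[- itg v a b]mulN1r -(cvg_lim _ c1)//.
apply: limr_ge; first exact: cvgP c1.
near=> n.
have sa : s n%:R a = - 1 by near: n; exact: (near_s a).1.
have sb : s n%:R b = - 1 by near: n; exact: (near_s b).1.
have := (GP n%:R).2 a b (Ga n).1 (Gb n).1 ab.
by rewrite /Q sa sb; lra.
Unshelve. all: by end_near.
Qed.

(** Suppose u passes from negative to positive while W > 0, and let c be the supremum of the
    negative points. Across c, sg(u) W increases by more than W c over an arbitrarily short
    interval, whereas the case l = 0 bounds that increase by the small integral of |v|. *)
Lemma entropy_pair_profile : exists G W, profile G W u v.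
Proof.
have [G aG H] := entropy_pair_sqr.
have [a0 Ga0 _] := ae_dense aG (ltr01 : 0 < 1 :> R).
have [W pW W0] := prim_ex a0 (u a0 ^+ 2 / 2) iv.
have cW := prim_continuous pW.
have WG x : G x -> W x = u x ^+ 2 / 2.
  move=> Gx; have [xa|ax|->//] := ltgtP x a0.
    by have := (H x a0 Gx Ga0 xa).1; rewrite -pW.2 ?(ltW xa)//; lra.
  by have := (H a0 x Ga0 Gx ax).1; rewrite -pW.2 ?(ltW ax)//; lra.
exists G, W; split=> //.
move=> x y Gx Gy xy Wpos uy.
rewrite ltNge; apply/negP => ux.
have un0 z : G z -> x <= z <= y -> u z != 0.
  move=> Gz zxy; apply/eqP => uz0; have := Wpos z zxy.
  by rewrite WG// uz0 expr0n /= mul0r ltxx.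
have xx : x <= x <= y by rewrite lexx ltW.
have {}ux : u x < 0 by rewrite lt_def ux andbT eq_sym un0.
pose Z := [set z | [/\ G z, x <= z <= y & u z < 0]].
have Zx : Z x by [].
have uZ : has_ubound Z by exists y => z [_ /andP[]].
have Z0 : Z !=set0 by exists x.
pose c := sup Z.
have xc : x <= c by exact: ub_le_sup.
have cy : c <= y by apply: ge_sup => // z [_ /andP[]].
have Wc : 0 < W c by apply: Wpos; rewrite xc.
have Wc2 : 0 < W c / 2 by rewrite divr_gt0.
have := @cW c; move=> /cvgrPdist_lt/(_ _ Wc2)/nbhs_ballP[d1 /= d10 K1].
have [d2 d20 K2] := itg_small x y iv Wc2.
(* [z1] and [z2] are both within [d] of c, so half of [d2] keeps z2 - z1 below [d2]. *)
pose d := Num.min d1 (d2 / 2).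
have d0 : 0 < d by rewrite lt_min d10 divr_gt0.
have dd1 : d <= d1 by rewrite ge_min lexx.
have dd2 : d <= d2 / 2 by rewrite ge_min lexx orbT.
have Wnear z : `|c - z| < d -> W c / 2 < W z.
  move=> cz; have := K1 z (lt_le_trans cz dd1); rewrite ltr_norml => /andP[]; lra.
have [z1 [Gz1 /andP[xz1 z1y] uz1] cz1] := sup_adherent d0 (conj Z0 uZ).
have z1c : z1 <= c by apply: ub_le_sup => //; split => //; rewrite xz1.
rewrite -/c in cz1.
have [z2 [Gz2 z12 z2y] [z2c uz2]] : exists2 z2, [/\ G z2, z1 < z2 & z2 <= y] &
    `|c - z2| < d /\ 0 < u z2.
  have [cy'|yc] := ltP c y.
    have [|z2 Gz2 /andP[cz2 z2m]] := ae_dense aG (a := c) (b := Num.min (c + d) y).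
      by rewrite lt_min ltrDl d0.
    move: z2m; rewrite lt_min => /andP[z2d z2y].
    have z2xy : x <= z2 <= y by lra.
    exists z2; split => //; [lra|lra|by rewrite ltr_norml; lra|].
    rewrite lt_def un0//= leNgt; apply/negP => uz2.
    have : Z z2 by [].
    by move=> /(ub_le_sup uZ); rewrite -/c; lra.
  have cyE : c = y by apply/eqP; rewrite eq_le cy yc.
  exists y; split => //; last by rewrite cyE subrr normr0.
  rewrite lt_neqAle z1y andbT; apply/eqP => z1yE.
  by move: uz1; rewrite z1yE; lra.
have E1 := WG z1 Gz1; have E2 := WG z2 Gz2.
have := (H z1 z2 Gz1 Gz2 z12).2.
rewrite (gtr0_sg uz2) (ltr0_sg uz1) -E1 -E2 mul1r mulN1r opprK.
have isv : loc_int (fun x => Num.sg (u x) * v x).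
  have := loc_ints 0 iv; rewrite /s; by under eq_fun do rewrite subr0.
have W1 : W c / 2 < W z1 by apply: Wnear; rewrite ger0_norm ?subr_ge0//; lra.
have W2 : W c / 2 < W z2 by exact: Wnear.
have I1 : itg (fun x => Num.sg (u x) * v x) z1 z2 <= itg (fun x => `|v x|) z1 z2.
  apply: (le_trans (ler_norm _)); apply: (le_trans (le_norm_itg _ _ isv)).
  apply: le_itg; [exact: loc_int_norm|exact: loc_int_norm|].
  by move=> z _; rewrite normrM ler_piMl// normr_sg; case: (_ != _).
have I2 : itg (fun x => `|v x|) z1 z2 < W c / 2.
  apply: K2 => //; first exact: ltW.
  by move: z2c; rewrite ltr_norml => /andP[]; lra.
lra.
Qed.

End one_pair.
End entropy_to_profile.

(** * Reflected equation and approximate resolvent *)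

Section running_infimum.
Context {R : realType}.
Local Notation mu := (@lebesgue_measure R).
Implicit Types (h g : R -> R) (x y z a : R).

(* If H is a primitive of h, this is H x - inf_(y <= x) H y. *)
Definition excess h x : R := sup [set t | exists2 y, y <= x & t = itg h y x].

Section one_function.
Variables (h : R -> R) (a : R).
Hypothesis ih : loc_int h.
Hypothesis ha : forall z, z <= a -> h z <= 0.

Let set_x x := [set t | exists2 y, y <= x & t = itg h y x].

Let itg_le0 y x : y <= x -> x <= a -> itg h y x <= 0.
Proof.
move=> yx xa; rewrite -(mul0r (x - y)) -itg_cst//; apply: le_itg => //; first exact: loc_int_cst.
by move=> z /andP[_ zx]; apply: ha; exact: le_trans xa.
Qed.

(** Integrals that start to the left of [a] gain nothing there, because h <= 0, so the integral of
    |h| over [a, x] bounds them all. *)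
Let has_sup_x x : has_sup (set_x x).
Proof.
split; first by exists (itg h x x), x.
exists (itg (fun z => `|h z|) a x) => _ [y yx ->].
have ab0 u v : 0 <= itg (fun z => `|h z|) u v by apply: itg_ge0 => z _.
have [xa|/ltW ax] := leP x a; first exact: le_trans (itg_le0 yx xa) (ab0 _ _).
have main y' : a <= y' -> y' <= x -> itg h y' x <= itg (fun z => `|h z|) a x.
  move=> ay' y'x; rewrite (@itg_chasles _ _ a y' x (loc_int_norm ih))//.
  apply: ler_wpDl => //; apply: (le_trans (ler_norm _)); exact: le_norm_itg.
have [ya|/ltW ay] := leP y a; last exact: main.
by rewrite (itg_chasles ih ya ax) -[leRHS]add0r lerD// ?itg_le0 ?main.
Qed.

Lemma le_excess y x : y <= x -> itg h y x <= excess h x.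
Proof. by move=> yx; apply: ub_le_sup; [exact: (has_sup_x x).2|exists y]. Qed.

Lemma excess_le x M : (forall y, y <= x -> itg h y x <= M) -> excess h x <= M.
Proof. by move=> H; apply: ge_sup => [|_ [y yx ->]]; [exact: (has_sup_x x).1|exact: H]. Qed.

Lemma excess_ge0 x : 0 <= excess h x.
Proof. by rewrite -(itg_xx h x) le_excess. Qed.

Lemma excess_eq0 x : x <= a -> excess h x = 0.
Proof.
move=> xa; apply/eqP; rewrite eq_le excess_ge0 andbT.
by apply: excess_le => y yx; exact: itg_le0.
Qed.

Lemma excess_super y x : y <= x -> itg h y x <= excess h x - excess h y.
Proof.
move=> yx; rewrite lerBrDr addrC -lerBrDr; apply: excess_le => z zy.
by rewrite lerBrDr -itg_chasles// le_excess// (le_trans zy).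
Qed.

Lemma excess_lip y x : y <= x -> `|excess h x - excess h y| <= itg (fun z => `|h z|) y x.
Proof.
move=> yx; have K z : y <= z -> z <= x -> `|itg h z x| <= itg (fun z => `|h z|) y x.
  move=> yz zx; apply: (le_trans (le_norm_itg _ _ ih)).
  rewrite (@itg_chasles _ _ y z x (loc_int_norm ih))// lerDr.
  by apply: itg_ge0 => t _.
rewrite ler_norml; apply/andP; split.
  apply: le_trans (excess_super yx); rewrite lerNl.
  by have := K y (lexx _) yx; rewrite ler_norml => /andP[]; lra.
rewrite lerBlDr; apply: excess_le => z zx; have [zy|/ltW yz] := leP z y.
  rewrite (itg_chasles ih zy yx) addrC lerD ?le_excess//.
  by apply: le_trans (K y (lexx _) yx); exact: ler_norm.
rewrite -[leLHS]addr0 lerD ?excess_ge0//.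
by apply: le_trans (K z yz zx); exact: ler_norm.
Qed.

Lemma excess_continuous : continuous (excess h).
Proof.
move=> x; apply/cvgrPdist_lt => e e0.
have [d d0 H] := itg_small (x - 1) (x + 1) ih e0.
apply/nbhs_ballP; exists (Num.min d 1) => /=; first by rewrite lt_min d0 ltr01.
move=> y; rewrite /ball/= lt_min => /andP[yd y1].
rewrite ltr_norml in yd; rewrite ltr_norml in y1.
move: yd y1 => /andP[yd yd'] /andP[y1 y1'].
have [xy|/ltW yx] := leP x y.
  by rewrite distrC; apply: (le_lt_trans (excess_lip xy)); apply: H; lra.
by apply: (le_lt_trans (excess_lip yx)); apply: H; lra.
Qed.

(** Reflection acts only at zeros. If the free primitive [S] started at [excess h y] had a
    nonpositive minimum at m, every integral of h ending at m would be at most 0, contradicting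
    positivity of the excess. So S > 0, and then S x bounds all integrals ending at x. *)
Lemma excess_positive y x : y <= x -> (forall z, y <= z <= x -> 0 < excess h z) ->
  excess h x - excess h y = itg h y x.
Proof.
move=> yx pos; apply/eqP; rewrite eq_le excess_super// andbT.
have [S pS Sy] := prim_ex y (excess h y) ih.
have cS := prim_continuous pS.
have E z : y <= z -> S z = excess h y + itg h y z by move=> yz; have := pS.2 y z yz; rewrite Sy; lra.
have [m myx mmin] := @EVT_min R S y x yx (continuous_subspaceT cS).
have /andP[ym mx] : y <= m <= x by rewrite in_itv/= in myx.
have Sm : 0 < S m.
  have := pos m; rewrite ym mx => /(_ isT) pm; rewrite ltNge; apply/negP => Sm.
  suff : excess h m <= 0 by rewrite leNgt pm.
  apply: excess_le => z zm; have [zy|/ltW yz] := leP z y.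
    by apply: le_trans Sm; rewrite (E _ ym) (itg_chasles ih zy ym) lerD2r le_excess.
  by rewrite -pS.2// subr_le0 mmin// in_itv/= yz (le_trans zm mx).
rewrite lerBlDr addrC -E//; apply: excess_le => z zx; have [zy|/ltW yz] := leP z y.
  by rewrite (E _ yx) (itg_chasles ih zy yx) lerD2r le_excess.
rewrite -pS.2// gerBl; apply: (le_trans (ltW Sm)); apply: mmin.
by rewrite in_itv/= yz zx.
Qed.

End one_function.

Lemma excess_mono h g a x : loc_int h -> loc_int g ->
  (forall z, z <= a -> h z <= 0) -> (forall z, z <= a -> g z <= 0) ->
  (forall z, h z <= g z) -> excess h x <= excess g x.
Proof.
move=> ih ig ha ga hg; apply: (excess_le ih ha) => y yx.
by apply: le_trans (le_excess ig ga yx); exact: le_itg.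
Qed.

End running_infimum.

(** * The regularised square root and the reflected equation *)

Section soft_root.
Context {R : realType}.
Implicit Types (d p q : R).

(* A Lipschitz continuous approximation of sqrt (2 p). *)
Definition soft_root d p := Num.sqrt (2 * p + d ^+ 2).

Lemma soft_root0 d : 0 < d -> soft_root d 0 = d.
Proof. by move=> d0; rewrite /soft_root mulr0 add0r sqrtr_sqr gtr0_norm. Qed.

Lemma soft_root_continuous d : continuous (soft_root d).
Proof.
move=> p; apply: (@continuous_comp _ _ _ (fun p : R => 2 * p + d ^+ 2) Num.sqrt).
  by apply: cvgD; [apply: cvgM; [exact: cvg_cst|exact: cvg_id]|exact: cvg_cst].
exact: sqrt_continuous.
Qed.

Lemma soft_root_ge d p : 0 <= p -> Num.sqrt (2 * p) <= soft_root d p.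
Proof. by move=> p0; rewrite ler_wsqrtr// lerDl sqr_ge0. Qed.

Lemma soft_root_le d p : 0 <= d -> 0 <= p -> soft_root d p <= Num.sqrt (2 * p) + d.
Proof.
move=> d0 p0; have s0 := sqrtr_ge0 (2 * p).
rewrite -[leRHS]ger0_norm ?addr_ge0// -sqrtr_sqr ler_wsqrtr// sqrrD sqr_sqrtr ?mulr_ge0//.
by have := mulr_ge0 s0 d0; lra.
Qed.

Lemma soft_root_ge0 d p : 0 <= soft_root d p.
Proof. exact: sqrtr_ge0. Qed.

(** The difference of the roots times their sum is 2 (q - p), and each root is at least [d]. *)
Lemma soft_root_lip d p q : 0 < d -> 0 <= p -> p <= q ->
  soft_root d q - soft_root d p <= (q - p) / d.
Proof.
move=> d0 p0 pq.
have b0 t : 0 <= t -> d <= soft_root d t /\ soft_root d t ^+ 2 = 2 * t + d ^+ 2.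
  move=> t0; split; last by rewrite sqr_sqrtr// addr_ge0 ?sqr_ge0 ?mulr_ge0.
  rewrite -[leLHS](soft_root0 d0) ler_wsqrtr// lerD2r; lra.
have [p1 p2] := b0 p p0; have [q1 q2] := b0 q (le_trans p0 pq).
rewrite ler_pdivlMr//.
have [|qp] := leP (soft_root d q) (soft_root d p).
  by rewrite -subr_le0 => H; rewrite (le_trans (mulr_le0_ge0 H (ltW d0)))// subr_ge0.
have : (soft_root d q - soft_root d p) * (2 * d) <= 2 * (q - p).
  have -> : 2 * (q - p) = (soft_root d q - soft_root d p) * (soft_root d q + soft_root d p).
    by rewrite -subr_sqr q2 p2; ring.
  apply: ler_wpM2l; lra.
lra.
Qed.

End soft_root.

Section reflected_ode.
Context {R : realType}.
Local Notation mu := (@lebesgue_measure R).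
Local Notation TR := (measurableTypeR R).
Implicit Types (h g P Q : R -> R) (x y z : R) (n : nat).

Lemma prim_expR (c : R) : prim (fun x => expR (c * x)) (fun x => c * expR (c * x)).
Proof.
apply: prim_derive => x.
  have aff : is_derive x 1 (fun x : R => c * x) c.
    by apply: is_derive_eq; rewrite /GRing.scale/= mulr1.
  by rewrite mulrC; exact: (is_derive1_comp (is_derive_expR _) aff).
apply: cvgM; first exact: cvg_cst.
apply: (@continuous_comp _ _ _ (fun x : R => c * x) expR); last exact: continuous_expR.
by apply: cvgM; [exact: cvg_cst|exact: cvg_id].
Qed.

Lemma prim_affine (A b : R) : prim (fun x => A + b * x) (cst b).
Proof. by split => [|x y xy]; [exact: loc_int_cst|rewrite itg_cst//; ring]. Qed.

Lemma loc_int_between h g Q : measurable_fun [set: TR] (Q : TR -> TR) ->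
  loc_int h -> loc_int g -> (forall x, h x <= Q x <= g x) -> loc_int Q.
Proof.
move=> mQ ih ig hQg; split => // x y.
apply: (@le_integrable _ _ _ mu _ _ _ (EFin \o (fun z => `|h z| + `|g z|))) => //.
- by apply/measurable_EFinP; exact: measurable_funTS.
- move=> z _; rewrite /= lee_fin [leRHS]ger0_norm// ler_norml.
  have /andP[h1 h2] := hQg z; have := ler_norm (g z); have := lerNnormlW (lexx `|h z|).
  by have := normr_ge0 (g z); have := normr_ge0 (h z); move=> ? ? ? ?; lra.
exact: (loc_intD (loc_int_norm ih) (loc_int_norm ig)).2.
Qed.

Variables (f : R -> R) (k d M C a : R).
Hypothesis cf : continuous f.
Hypotheses (k0 : 0 < k) (d0 : 0 < d) (C0 : 0 <= C).
Hypotheses (fC : forall z, f z <= C) (fa : forall z, z <= a -> f z <= 0).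
Hypothesis fM : forall z, M <= z -> f z <= 0.

Let c := k / d.
Let e x := expR (c * x).
(** The integrating factor exp (k x / d) rewrites P' = k (f - soft_root d P) as (e P)' = rhs P. The
    extra term Q / d outweighs the Lipschitz constant of [soft_root d], so [rhs] increases with Q
    and Picard iterates from 0 increase. *)
Let rhs Q z := k * e z * (f z + Q z / d - soft_root d (Q z)).

Let e0 x : 0 < e x. Proof. exact: expR_gt0. Qed.

Let ce : continuous e. Proof. exact: (prim_continuous (prim_expR c)). Qed.

Let rhs_mono Q P z : 0 <= Q z -> Q z <= P z -> rhs Q z <= rhs P z.
Proof.
move=> Q0 QP; rewrite /rhs ler_pM2l ?mulr_gt0//.
have := soft_root_lip d0 Q0 QP; rewrite mulrBl; lra.
Qed.

Let rhs_continuous Q : continuous Q -> continuous (rhs Q).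
Proof.
move=> cQ x; apply: cvgM; first by apply: cvgM; [exact: cvg_cst|exact: ce].
apply: cvgB; last by apply: continuous_comp; [exact: cQ|exact: soft_root_continuous].
by apply: cvgD; [exact: cf|apply: cvgM; [exact: cQ|exact: cvg_cst]].
Qed.

Let rhs_le0 Q z : f z <= 0 -> Q z = 0 -> rhs Q z <= 0.
Proof.
move=> fz Qz; rewrite /rhs Qz mul0r addr0 soft_root0//.
by apply: mulr_ge0_le0; [rewrite mulr_ge0// ltW|rewrite subr_le0 (le_trans fz)// ltW].
Qed.

Fixpoint picard n : R -> R :=
  if n is n'.+1 then fun x => (e x)^-1 * excess (rhs (picard n')) x else cst 0.

(* [r' = - k / 2] is half the damping; the other half dominates f. The result
   is independent of [d]. *)
Let A := k / 2 * M + 2 * C.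
Let r x := A + (- (k / 2)) * x.
Let z0 := M + 4 * C / k.
Let barrier x := if x <= z0 then r x ^+ 2 / 2 else 0.

Let rE x : r x = k / 2 * (z0 - x).
Proof. by rewrite /r /A /z0; field; rewrite gt_eqF. Qed.

Let r_ge0 x : (0 <= r x) = (x <= z0).
Proof. by rewrite rE pmulr_rge0 ?divr_gt0// subr_ge0. Qed.

Let barrier_ge0 x : 0 <= barrier x.
Proof. by rewrite /barrier; case: ifPn => // _; rewrite divr_ge0// sqr_ge0. Qed.

Let barrierE x : barrier x = Num.max (r x) 0 ^+ 2 / 2.
Proof.
rewrite /barrier -r_ge0; case: (leP 0 (r x)) => rx //.
by rewrite expr0n mul0r.
Qed.

Let barrier_continuous : continuous barrier.
Proof.
have -> : barrier = (fun x => Num.max (r x) 0 ^+ 2 / 2) by apply/funext => x; exact: barrierE.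
move=> x; apply: cvgM; last exact: cvg_cst.
have H : (fun y => Num.max (r y) 0) y @[y --> x] --> Num.max (r x) 0.
  by apply: continuous_max; [exact: (prim_continuous (prim_affine _ _))|exact: cvg_cst].
by apply: cvgM; exact: H.
Qed.

Let i_barrier : loc_int (rhs barrier).
Proof. by apply: continuous_loc_int; exact: rhs_continuous. Qed.

(** [barrier] is a supersolution. As soft_root d (r^2 / 2) >= r, on z <= z0 it suffices that 2 f <=
    r: left of M, r is at least r M = 2 C, and right of M, f <= 0 <= r. Beyond z0 the barrier is 0
    and its [rhs] is nonpositive. *)
Let barrier_super y x : y <= x -> itg (rhs barrier) y x <= e x * barrier x.
Proof.
move=> yx.
have bge x' y' : 0 <= e x' * barrier x' by rewrite mulr_ge0// ltW.
have left x' : x' <= z0 -> y <= x' -> itg (rhs barrier) y x' <= e x' * barrier x'.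
  move=> xz yx'; have pr := primM (prim_expR c) (primM (prim_affine A (- (k / 2))) (prim_affine A (- (k / 2)))).
  have := pr.2 y x' yx'; rewrite -/(r x') -/(r y) -/(e x') -/(e y) => E.
  suff : itg (rhs barrier) y x' <= 2^-1 * (e x' * (r x' * r x') - e y * (r y * r y)).
    rewrite /barrier xz; have := mulr_ge0 (ltW (e0 y)) (sqr_ge0 (r y)); rewrite -!expr2; lra.
  rewrite E -itgZ; last exact: pr.1.
  apply: le_itg => //.
    exact: (loc_intMc (@cst_continuous R R 2^-1) pr.1).
  move=> z /andP[yz zx]; have zz : z <= z0 by exact: le_trans xz.
  rewrite /rhs /barrier zz -/(r z) -/(e z) /cst.
  have rz : 0 <= r z by rewrite r_ge0.
  have h1 : r z <= soft_root d (r z ^+ 2 / 2).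
    apply: le_trans (soft_root_ge _ _); last by rewrite divr_ge0// sqr_ge0.
    by rewrite mulrC divfK ?pnatr_eq0// sqrtr_sqr ler_norm.
  have h2 : 2 * f z <= r z.
    have [zM|/ltW Mz] := leP z M; last by have := fM Mz; lra.
    have := fC z; rewrite /r /A; have : k / 2 * z <= k / 2 * M by rewrite ler_pM2l ?divr_gt0.
    lra.
  rewrite -subr_ge0.
  have -> : 2^-1 * (e z * (r z * - (k / 2) + - (k / 2) * r z) + c * e z * (r z * r z)) -
      k * e z * (f z + r z ^+ 2 / 2 / d - soft_root d (r z ^+ 2 / 2)) =
      k * e z * (soft_root d (r z ^+ 2 / 2) - r z / 2 - f z).
    by rewrite /c; field; rewrite gt_eqF.
  apply: mulr_ge0; [by rewrite mulr_ge0// ltW|lra].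
have [xz|/ltW zx] := leP x z0; first exact: left.
have right y' : z0 <= y' -> y' <= x -> itg (rhs barrier) y' x <= 0.
  move=> zy' y'x; rewrite -(mul0r (x - y')) -itg_cst//; apply: le_itg => //; first exact: loc_int_cst.
  move=> z /andP[y'z _]; apply: rhs_le0.
    apply: fM; apply: le_trans (le_trans zy' y'z).
    by rewrite /z0 lerDl divr_ge0 ?mulr_ge0// ltW.
  rewrite barrierE max_r ?expr0n ?mul0r//.
  by rewrite rE pmulr_rle0 ?divr_gt0// subr_le0 (le_trans zy').
have [yz|/ltW zy] := leP y z0.
  rewrite (itg_chasles i_barrier yz zx).
  have := left z0 (lexx _) yz; have := right z0 (lexx _) zx.
  have -> : barrier z0 = 0 by rewrite barrierE rE subrr mulr0 max_l ?expr0n ?mul0r.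
  by rewrite mulr0; have := bge x x; lra.
by apply: le_trans (right y zy yx) _; exact: bge.
Qed.

Let picardP n : [/\ continuous (picard n), (forall x, 0 <= picard n x <= barrier x)
  & forall x, x <= a -> picard n x = 0].
Proof.
elim: n => [|n [ic ib ia]].
  by split => [|x|//]; [exact: cst_continuous|rewrite lexx barrier_ge0].
have ir : loc_int (rhs (picard n)) by apply: continuous_loc_int; exact: rhs_continuous.
have ra z : z <= a -> rhs (picard n) z <= 0.
  by move=> za; apply: rhs_le0; [exact: fa|exact: ia].
split => /=.
- move=> x; apply: cvgM; last exact: (excess_continuous ir ra).
  by apply: cvgV; [rewrite gt_eqF|exact: ce].
- move=> x; rewrite mulr_ge0 ?invr_ge0 ?(ltW (e0 x)) ?(excess_ge0 ir ra)//=.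
  rewrite ler_pdivrMl//; apply: (excess_le ir ra) => y yx.
  apply: le_trans (barrier_super yx); apply: le_itg => // z _.
  by have /andP[? ?] := ib z; exact: rhs_mono.
- by move=> x xa; rewrite (excess_eq0 ir ra)// mulr0.
Qed.

Let i_picard n : loc_int (rhs (picard n)).
Proof. by have [cp _ _] := picardP n; apply: continuous_loc_int; exact: rhs_continuous. Qed.

Let rhs_a n z : z <= a -> rhs (picard n) z <= 0.
Proof. by have [_ _ pa] := picardP n => za; apply: rhs_le0; [exact: fa|exact: pa]. Qed.

Let picard_homo n x : picard n x <= picard n.+1 x.
Proof.
elim: n x => [|n ih] x; first by have [_ /(_ x) /andP[]] := picardP 1.
rewrite [in leLHS]/= [in leRHS]/= ler_pM2l ?invr_gt0//.
apply: (excess_mono _ (i_picard n) (i_picard n.+1)) => [z|z|z]; [exact: rhs_a|exact: rhs_a|].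
by apply: rhs_mono; [have [_ /(_ z) /andP[]] := picardP n|exact: ih].
Qed.

Let P x : R := limn (picard ^~ x).

Let cvg_picard x : picard ^~ x @ \oo --> P x.
Proof.
have nd : nondecreasing_seq (picard ^~ x) by apply/nondecreasing_seqP => n; exact: picard_homo.
apply: nondecreasing_is_cvgn => //; exists (barrier x) => _ [n _ <-].
by have [_ /(_ x) /andP[]] := picardP n.
Qed.

Let picard_le n x : picard n x <= P x.
Proof.
apply: nondecreasing_cvgn_le; last exact: (@cvg_picard x).
by apply/nondecreasing_seqP => m; exact: picard_homo.
Qed.

Let P0 x : 0 <= P x. Proof. exact: (picard_le 0 x). Qed.

Let P_barrier x : P x <= barrier x.
Proof.
apply: limr_le; first exact: (@cvg_picard x).
by apply: nearW => n; have [_ /(_ x) /andP[]] := picardP n.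
Qed.

Let Pa x : x <= a -> P x = 0.
Proof.
move=> xa; apply: (cvg_lim (@Rhausdorff R)).
by apply: cvg_near_cst; apply: nearW => n; have [_ _ /(_ x xa)] := picardP n.
Qed.

Let cvg_rhs x : rhs (picard n) x @[n --> \oo] --> rhs P x.
Proof.
apply: cvgM; first exact: cvg_cst.
apply: cvgB.
  by apply: cvgD; [exact: cvg_cst|apply: cvgM; [exact: cvg_picard|exact: cvg_cst]].
have H : soft_root d @ P x --> soft_root d (P x) by exact: soft_root_continuous.
exact: (cvg_comp _ _ (@cvg_picard x) H).
Qed.

Let rhsP_between x : rhs (picard 0) x <= rhs P x <= rhs barrier x.
Proof. by apply/andP; split; apply: rhs_mono. Qed.

(** As a mere pointwise limit, P is so far only measurable; its continuity follows later from its
    representation by an excess. *)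
Let i_P : loc_int (rhs P).
Proof.
apply: (loc_int_between _ (i_picard 0) i_barrier rhsP_between).
apply: (@measurable_fun_cvg _ TR R setT (fun n => rhs (picard n))) => [n|x _].
  exact: (i_picard n).1.
exact: cvg_rhs.
Qed.

Let rhsP_a z : z <= a -> rhs P z <= 0.
Proof. by move=> za; apply: rhs_le0; [exact: fa|exact: Pa]. Qed.

(** One inequality is monotonicity of [excess] along the iterates. The other passes to the limit in
    each single integral by dominated convergence, which suffices because the excess is a supremum
    of such integrals. *)
Let P_excess x : e x * P x = excess (rhs P) x.
Proof.
apply/eqP; rewrite eq_le; apply/andP; split.
  rewrite -ler_pdivlMl//; apply: limr_le; first exact: (@cvg_picard x).
  apply: nearW => n; apply: (le_trans (picard_homo n x)); rewrite /= ler_pM2l ?invr_gt0//.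
  apply: (excess_mono _ (i_picard n) i_P (@rhs_a n) rhsP_a) => z.
  by apply: rhs_mono => //; have [_ /(_ z) /andP[]] := picardP n.
apply: (excess_le i_P rhsP_a) => y yx.
have cv : itg (rhs (picard n)) y x @[n --> \oo] --> itg (rhs P) y x.
  apply: (itg_dominated_cvg i_picard i_P (loc_intD (loc_int_norm (i_picard 0)) (loc_int_norm i_barrier))) => [n z|z]; last exact: cvg_rhs.
  have [_ /(_ z) /andP[p1 p2] _] := picardP n.
  have h1 : rhs (picard 0) z <= rhs (picard n) z by apply: rhs_mono.
  have h2 : rhs (picard n) z <= rhs barrier z by apply: rhs_mono.
  have := ler_norm (rhs barrier z); have := lerNnormlW (lexx `|rhs (picard 0) z|).
  have := normr_ge0 (rhs barrier z); have := normr_ge0 (rhs (picard 0) z).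
  by move=> ? ? ? ?; rewrite ler_norml; lra.
rewrite -(cvg_lim (@Rhausdorff R) cv); apply: limr_le; first exact: cvgP cv.
apply: nearW => n; rewrite -ler_pdivrMl//; apply: le_trans (picard_le n.+1 x) => /=.
by rewrite ler_pM2l ?invr_gt0//; exact: (le_excess (i_picard n) (@rhs_a n)).
Qed.

Let PE : P = (fun x => (e x)^-1 * excess (rhs P) x).
Proof. by apply/funext => x; rewrite -P_excess mulKf// gt_eqF. Qed.

Lemma reflected_ode : exists P, [/\ continuous P, (forall x, 0 <= P x),
  (forall x, x <= a \/ M + 4 * C / k <= x -> P x = 0),
  (forall x y, x <= y -> (forall z, x <= z <= y -> 0 < P z) ->
    P y - P x = itg (fun z => k * (f z - soft_root d (P z))) x y)
  & \forall x \ae mu, P x = 0 -> f x <= d].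
Proof.
have cP : continuous P.
  rewrite PE => x; apply: cvgM; last exact: (excess_continuous i_P rhsP_a).
  by apply: cvgV; [rewrite gt_eqF|exact: ce].
exists P; split => //.
- move=> x [/Pa//|zx]; apply/eqP; rewrite eq_le P0 andbT (le_trans (P_barrier x))//.
  rewrite /barrier; case: ifPn => // xz.
  have -> : x = z0 by apply/eqP; rewrite eq_le xz.
  by rewrite rE subrr mulr0 expr0n mul0r.
- move=> x y xy pos.
  have pos' z : x <= z <= y -> 0 < excess (rhs P) z.
    by move=> /pos Pz; rewrite -P_excess mulr_gt0.
  have [S pS Sx] := prim_ex x (excess (rhs P) x) i_P.
  have SE z : x <= z -> z <= y -> S z = e z * P z.
    move=> xz zy; rewrite P_excess.
    have := pS.2 x z xz; rewrite Sx => H2.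
    rewrite -[RHS](subrK (excess (rhs P) x)) (excess_positive i_P rhsP_a xz); first by lra.
    by move=> t /andP[xt tz]; apply: pos'; rewrite xt (le_trans tz).
  (* The product rule with exp (- c x) removes the integrating factor. *)
  have pr := primM (prim_expR (- c)) pS.
  have eN z : expR (- c * z) = (e z)^-1 by rewrite /e mulNr expRN.
  have := pr.2 x y xy; rewrite !eN !SE// !mulKf ?gt_eqF// => ->.
  apply: eq_itg => z /andP[xz zy]; rewrite eN SE// /rhs /c.
  by field; rewrite !gt_eqF.
have cE := @excess_continuous R _ _ i_P rhsP_a.
have E0 := excess_ge0 i_P rhsP_a.
have dense (u v : R) : u < v -> exists2 g, [set: R] g & u < g < v.
  by move=> uv; exists ((u + v) / 2) => //; lra.
have mpos := measurable_positive cE.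
(* The excess grows at least by the integral of [rhs P], and by [engine] at most by its integral
   over the positivity set. So [rhs P] is nonpositive almost everywhere where P = 0, and there it is
   k e (f - d). *)
pose zero z := rhs P z - \1_[set z | 0 < excess (rhs P) z] z * rhs P z.
have izero : loc_int zero by apply: loc_intB => //; exact: loc_int_indic.
have := itg_le0_ae izero; move=> /(_ _)/ae_mono; apply.
  move=> x H Px; move: H.
  rewrite /zero indicE memNset ?mul0r ?subr0 /=; last by rewrite -P_excess Px mulr0 ltxx.
  rewrite /rhs Px mul0r addr0 soft_root0// pmulr_rle0 ?mulr_gt0//; lra.
move=> x y xy; rewrite /zero itgB//; last exact: loc_int_indic.
have sup := excess_super i_P rhsP_a (ltW xy).
rewrite subr_le0; apply: (le_trans sup).
apply: (@engine R _ _ _ setT cE E0 i_P dense _ _ x y I I (ltW xy)).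
- by move=> z _; rewrite ger0_norm.
- by move=> u v _ _ uv pos; rewrite (excess_positive i_P rhsP_a (ltW uv)).
Qed.

End reflected_ode.

(** * Gluing the positive and negative branches *)

Section approximate_profiles.
Context {R : realType}.
Local Notation mu := (@lebesgue_measure R).
Local Notation TR := (measurableTypeR R).
Implicit Types (D P N W u v w f : R -> R) (x y z t : R).

Lemma ae_opp (Q : TR -> Prop) : (\forall x \ae mu, Q x) -> \forall x \ae mu, Q (- x).
Proof.
move=> [B [mB B0 QB]]; exists ((-%R : TR -> TR) @^-1` B); split.
- by rewrite -[_ @^-1` _]setTI; apply: measurable_funN => //; exact: measurable_id.
- by have := lebesgue_measureN mB; rewrite /pushforward B0.
- by move=> x /= nQ; exact: QB.
Qed.

Lemma continuous_reflect w : continuous w -> continuous (fun x => w (- x)).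
Proof.
move=> cw x; apply: (@continuous_comp _ _ _ (fun x : R => - x) w); last exact: cw.
exact: opp_continuous.
Qed.

Lemma itg_opp w x y : continuous w -> x <= y ->
  itg (fun z => w (- z)) x y = itg w (- y) (- x).
Proof.
move=> cw xy; rewrite /itg /Rintegral; congr fine; symmetry.
apply: (@integration_by_substitution_oppr R w x y xy).
exact: continuous_subspaceT.
Qed.

Lemma last_nonpositive D x y : continuous D -> x <= y -> D x <= 0 -> 0 < D y ->
  exists2 c, x <= c < y & D c = 0 /\ forall t, c < t <= y -> 0 < D t.
Proof.
move=> cD xy Dx Dy; pose Z := [set t | x <= t <= y /\ D t <= 0].
have uZ : has_ubound Z by exists y => t [/andP[]].
have Zx : Z x by rewrite /Z/= lexx xy.
pose c := sup Z.
have xc : x <= c by exact: ub_le_sup.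
have cy : c <= y by apply: ge_sup => [|t [/andP[]]//]; exists x.
have pos t : c < t <= y -> 0 < D t.
  move=> /andP[ct ty]; rewrite ltNge; apply/negP => Dt.
  have : t <= c by apply: ub_le_sup => //; split => //; rewrite ty (le_trans xc (ltW ct)).
  by rewrite leNgt ct.
have near_c (e : R) : 0 < e -> exists2 d : R, 0 < d &
    forall t, c - d < t < c + d -> D c - e < D t < D c + e.
  move=> e0; have := @cD c; move=> /cvgrPdist_lt/(_ _ e0)/nbhs_ballP[d /= d0 H]; exists d => // t ct.
  have := H t; rewrite /ball/= -ltr_distlC => /(_ _)/[!ltr_distlC]; apply.
  by move: ct => /andP[? ?]; lra.
have Dc : D c = 0.
  have [Dc|Dc|//] := ltgtP (D c) 0.
    have [|d d0 H] := near_c (- D c); first by rewrite oppr_gt0.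
    have ltcy : c < y.
      by rewrite lt_neqAle cy andbT; apply/eqP => E; move: Dc; rewrite E ltNge (ltW Dy).
    pose t := Num.min (c + d / 2) y.
    have ct : c < t by rewrite lt_min ltcy ltrDl divr_gt0.
    have tc : t <= c + d / 2 by rewrite ge_min lexx.
    have Dt : 0 < D t by apply: pos; rewrite ct ge_min lexx orbT.
    have /H/andP[] : c - d < t < c + d by lra.
    by lra.
  have [d d0 H] := near_c _ Dc.
  have [t [/andP[xt ty] Dt] ct] := sup_adherent d0 (conj (ex_intro _ x Zx) uZ).
  have tc : t <= c by apply: ub_le_sup => //; split => //; rewrite xt.
  rewrite -/c in ct; have /H/andP[] : c - d < t < c + d by lra.
  by lra.
exists c; last by [].
rewrite xc lt_neqAle cy andbT; apply/eqP => E.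
by move: Dy; rewrite -E Dc ltxx.
Qed.

Variables (f : R -> R) (k d C M : R).
Hypothesis cf : continuous f.
Hypotheses (k0 : 0 < k) (d0 : 0 < d) (C0 : 0 <= C).
Hypothesis fC : forall z, `|f z| <= C.
Hypothesis fM : forall z, M <= `|z| -> f z = 0.

Let beta := soft_root d.

Section gluing.
Variables P N : R -> R.
Hypotheses (cP : continuous P) (cN : continuous N).
Hypotheses (P0 : forall x, 0 <= P x) (N0 : forall x, 0 <= N x).
Hypothesis dP : forall x y, x <= y -> (forall z, x <= z <= y -> 0 < P z) ->
  P y - P x = itg (fun z => k * (f z - beta (P z))) x y.
Hypothesis dN : forall x y, x <= y -> (forall z, x <= z <= y -> 0 < N z) ->
  N y - N x = itg (fun z => k * (f z + beta (N z))) x y.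

(** P and N are the candidates for u^2 / 2 on the branches u >= 0 and u <= 0. The larger one is
    taken with the sign of its branch; ties go to the negative branch. *)
Let W x := Num.max (P x) (N x).
Let s x : R := if N x < P x then 1 else - 1.
Let w x := k * (f x - s x * beta (W x)).

Let cD : continuous (fun x => P x - N x).
Proof. by move=> x; apply: cvgB; [exact: cP|exact: cN]. Qed.

Let cW : continuous W.
Proof. by move=> x; apply: continuous_max; [exact: cP|exact: cN]. Qed.

Let W0 x : 0 <= W x. Proof. by rewrite le_max P0. Qed.

Let c_rhs (Q : R -> R) (b : R) : continuous Q ->
  continuous (fun z => k * (f z + b * beta (Q z))).
Proof.
move=> cQ x; apply: cvgM; first exact: cvg_cst.
apply: cvgD; first exact: cf.
apply: cvgM; first exact: cvg_cst.
by apply: continuous_comp; [exact: cQ|exact: soft_root_continuous].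
Qed.

Let dP' x y : x <= y -> (forall z, x <= z <= y -> 0 < P z) ->
  P y - P x = itg (fun z => k * (f z + - 1 * beta (P z))) x y.
Proof. by move=> xy pos; rewrite dP//; apply: eq_itg => z _; rewrite mulN1r. Qed.

Let dN' x y : x <= y -> (forall z, x <= z <= y -> 0 < N z) ->
  N y - N x = itg (fun z => k * (f z + 1 * beta (N z))) x y.
Proof. by move=> xy pos; rewrite dN//; apply: eq_itg => z _; rewrite mul1r. Qed.

(* Where both branches are positive, P - N decreases. *)
Let branch x y : x <= y -> (forall z, x <= z <= y -> 0 < W z) -> N y < P y ->
  forall z, x <= z <= y -> N z < P z.
Proof.
move=> xy pos Dy z /andP[xz zy]; rewrite ltNge; apply/negP => Dz.
have [||c /andP[zc cy] [Dc right]] := last_nonpositive cD zy; rewrite ?subr_le0 ?subr_gt0//.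
have Wc : 0 < W c by apply: pos; rewrite (le_trans xz zc) ltW.
have NPc : N c = P c by lra.
have Pc : 0 < P c by move: Wc; rewrite /W NPc max_l.
have near_c (Q : R -> R) : continuous Q -> 0 < Q c ->
    exists2 e : R, 0 < e & forall t, `|c - t| < e -> 0 < Q t.
  move=> cQ Qc; have := @cQ c; move=> /cvgrPdist_lt/(_ _ Qc)/nbhs_ballP[e /= e0 H].
  exists e => // t ct; have := H t ct; move=> /(le_lt_trans (ler_norm _)); lra.
have [e1 e10 H1] := near_c P cP Pc.
have [|e2 e20 H2] := near_c N cN; first by rewrite NPc.
pose t := Num.min (c + Num.min e1 e2 / 2) y.
have e0 : 0 < Num.min e1 e2 by rewrite lt_min e10.
have ct : c < t by rewrite lt_min cy ltrDl divr_gt0.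
have te : t - c <= Num.min e1 e2 / 2 by rewrite lerBlDl ge_min lexx.
have m1 : Num.min e1 e2 <= e1 by rewrite ge_min lexx.
have m2 : Num.min e1 e2 <= e2 by rewrite ge_min lexx orbT.
have near_t r : c <= r <= t -> `|c - r| < Num.min e1 e2.
  by move=> /andP[cr rt]; rewrite distrC ger0_norm ?subr_ge0//; lra.
have E1 : P t - P c = itg (fun z => k * (f z + - 1 * beta (P z))) c t.
  by apply: dP' (ltW ct) _ => r /near_t H; apply: H1; exact: lt_le_trans m1.
have E2 : N t - N c = itg (fun z => k * (f z + 1 * beta (N z))) c t.
  by apply: dN' (ltW ct) _ => r /near_t H; apply: H2; exact: lt_le_trans m2.
have ty : t <= y by rewrite ge_min lexx orbT.
have := right t; rewrite ct ty => /(_ isT).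
suff : P t - P c <= N t - N c by lra.
rewrite E1 E2; apply: le_itg; [exact/continuous_loc_int/c_rhs|exact/continuous_loc_int/c_rhs|].
move=> r _; rewrite ler_pM2l// lerD2l mulN1r mul1r.
by have := soft_root_ge0 d (P r); have := soft_root_ge0 d (N r); rewrite -/beta; lra.
Qed.

Let ms : measurable_fun [set: TR] (s : TR -> TR).
Proof.
rewrite (_ : s = fun x => 2 * \1_[set x | 0 < P x - N x] x - 1).
  apply: measurable_funB => //; apply: measurable_funM => //.
  by apply: measurable_indic; exact: measurable_positive.
apply/funext => x; rewrite /s indicE; case: ifPn => PN.
  by rewrite mem_set /= ?subr_gt0//; ring.
by rewrite memNset /= ?subr_gt0; [ring|exact/negP].
Qed.

Let s1 x : `|s x| = 1. Proof. by rewrite /s; case: ifPn => _; rewrite ?normrN normr1. Qed.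

Let iw : loc_int w.
Proof.
have ib : loc_int (fun x => s x * beta (W x)).
  apply: (loc_intM ms); first by move=> x y; exists 1 => z _; rewrite s1.
  apply: continuous_loc_int => x.
  by apply: continuous_comp; [exact: cW|exact: soft_root_continuous].
apply: (@loc_intMc R (cst k)); first exact: cst_continuous.
by apply: loc_intB => //; exact: continuous_loc_int.
Qed.

(** By [branch] the relation N < P propagates to the left, so [x, y] splits at one point into a
    piece with W = P followed by a piece with W = N, either possibly missing. *)
Let dW x y : x <= y -> (forall z, x <= z <= y -> 0 < W z) -> W y - W x = itg w x y.
Proof.
move=> xy pos.
have left c : x <= c -> c <= y -> N c <= P c -> (forall t, x <= t < c -> N t < P t) ->
    W c - W x = itg w x c.
  move=> xc cy NPc NP; have PW t : x <= t <= c -> W t = P t.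
    move=> /andP[xt]; rewrite le_eqVlt => /predU1P[->|tc]; apply: max_l => //.
    by apply/ltW/NP; rewrite xt.
  rewrite !PW ?lexx ?xc// dP'//; last first.
    move=> t /andP[xt tc]; rewrite -PW ?xt//; apply: pos; rewrite xt (le_trans tc)//.
  apply: eq_itg_oo => //; first exact/continuous_loc_int/c_rhs.
  move=> t /andP[xt tc]; rewrite /w PW ?(ltW xt) ?(ltW tc)// /s NP ?(ltW xt)//.
  by rewrite mul1r mulN1r.
have right c : x <= c -> c <= y -> (forall t, c <= t <= y -> P t <= N t) ->
    W y - W c = itg w c y.
  move=> xc cy PN; have NW t : c <= t <= y -> W t = N t by move=> /PN; exact: max_r.
  rewrite !NW ?lexx ?cy// dN'//; last first.
    by move=> t /andP[ct ty]; rewrite -NW ?ct//; apply: pos; rewrite ty (le_trans xc).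
  apply: eq_itg => t cty; rewrite /w NW// /s ltNge PN//=; lra.
have [PNx|NPx] := leP (P x) (N x).
  apply: right => // t /andP[xt ty]; rewrite leNgt; apply/negP => NPt.
  have := @branch x t xt _ NPt x; rewrite lexx xt ltNge PNx => /(_ _ isT) H.
  by suff : false by []; apply: H => z /andP[xz zt]; apply: pos; rewrite xz (le_trans zt).
have [PNy|NPy] := leP (P y) (N y); last first.
  by apply: left => //; [exact: ltW|move=> t /andP[xt ty]; apply: (branch xy pos) => //; rewrite xt ltW].
(* After reflection, the last nonpositive point of the difference yields - c, the first point at
   which the two branches meet. *)
have cD' : continuous (fun t => P (- t) - N (- t)) by
  exact: (@continuous_reflect (fun t => P t - N t)).
have nxy : - y <= - x by rewrite lerN2.
have [||c /andP[yc cx] [Dc lft]] := last_nonpositive cD' nxy; rewrite ?opprK ?subr_le0 ?subr_gt0//.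
have xc : x <= - c by rewrite lerNr ltW.
have cy : - c <= y by rewrite lerNl.
rewrite (itg_chasles iw xc cy) -(left (- c))//; last 2 first.
- by move: Dc; lra.
- by move=> t /andP[xt tc]; rewrite -subr_gt0 -[t]opprK; apply: lft; rewrite ltrNr tc lerN2.
rewrite -(right (- c))//; first lra.
move=> t /andP[ct ty]; rewrite leNgt; apply/negP => NPt.
have := @branch (- c) t ct _ NPt (- c); rewrite lexx ct (_ : N (- c) = P (- c)); last by lra.
rewrite ltxx => /(_ _ isT) H; suff : false by [].
by apply: H => z /andP[cz zt]; apply: pos; rewrite (le_trans xc cz) (le_trans zt).
Qed.

(** The density is [w] only where W > 0; [engine], applied to W and to - W, shows that the zero set
    adds nothing to the increments. The sign condition is [branch]. *)
Lemma glued_profile : profile setT W (fun x => s x * Num.sqrt (2 * W x))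
  (fun x => \1_[set x | 0 < W x] x * w x).
Proof.
have mpos := measurable_positive cW.
have iv := loc_int_indic mpos iw.
have dense (a b : R) : a < b -> exists2 g, [set: R] g & a < g < b.
  by move=> ab; exists ((a + b) / 2) => //; lra.
split.
- exact: aeW.
- apply: (measurable_funM ms); apply: continuous_measurable_fun => x.
  apply: (@continuous_comp _ _ _ (fun x => 2 * W x) Num.sqrt); last exact: sqrt_continuous.
  by apply: cvgM; [exact: cvg_cst|exact: cW].
- split => // x y xy; apply/eqP; rewrite eq_le; apply/andP; split.
    apply: (@engine R _ _ _ setT cW W0 iw dense _ _ x y I I xy) => [z _|a b _ _ ab pos].
      by rewrite ger0_norm.
    by rewrite (dW (ltW ab) pos).
  have iNw : loc_int (fun x => - w x).
    by have := loc_intB (loc_int_cst 0) iw; under eq_fun do rewrite sub0r.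
  have := @engine R _ (fun x => - W x) _ setT cW W0 iNw dense _ _ x y I I xy.
  rewrite (eq_itg (g := fun z => - 1 * (\1_[set x | 0 < W x] z * w z))); last first.
    by move=> z _; rewrite mulN1r mulrN.
  rewrite itgZ// => H; suff : - W y - - W x <= - 1 * itg (fun z => \1_[set x | 0 < W x] z * w z) x y by lra.
  apply: H => [z _|a b _ _ ab pos]; first by rewrite normrN ger0_norm.
  rewrite (eq_itg (g := fun z => - 1 * w z)); last by move=> z _; rewrite mulN1r.
  by rewrite itgZ// -(dW (ltW ab) pos); lra.
- move=> x _; rewrite exprMn sqr_sqrtr ?mulr_ge0// -[s x ^+ 2]real_normK ?num_real// s1.
  by rewrite expr1n mul1r mulrAC divff ?mul1r// pnatr_eq0.
move=> x y _ _ xy pos; have sW t : x <= t <= y -> 0 < Num.sqrt (2 * W t).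
  by move=> /pos Wt; rewrite sqrtr_gt0 mulr_gt0.
rewrite !pmulr_lgt0 ?sW ?lexx ?(ltW xy)// /s.
case: (ltP (N y) (P y)) => [NPy _|_]; last by rewrite oppr_gt0 ltr10.
by rewrite (branch (ltW xy) pos NPy) ?lexx ?ltW.
Qed.

(** Where W > 0 the residual is the error of [soft_root]. Where W = 0 it is - f, and the two
    reflections bound f from above and from below. *)
Lemma glued_residual x : (P x = 0 -> f x <= d) -> (N x = 0 -> - f x <= d) ->
  `|s x * Num.sqrt (2 * W x) + k^-1 * (\1_[set x | 0 < W x] x * w x) - f x| <= d.
Proof.
move=> fP fN; have [Wx|Wx] := ltP 0 (W x).
  rewrite indicE mem_set//= mul1r /w mulKf ?gt_eqF//.
  have -> : s x * Num.sqrt (2 * W x) + (f x - s x * beta (W x)) - f x =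
            s x * (Num.sqrt (2 * W x) - beta (W x)) by ring.
  rewrite normrM s1 mul1r distrC ger0_norm ?subr_ge0 ?soft_root_ge//.
  by rewrite lerBlDl soft_root_le// ltW.
have {}Wx : W x = 0 by apply/eqP; rewrite eq_le Wx W0.
have Px : P x = 0 by apply/eqP; rewrite eq_le P0 andbT -Wx le_max lexx.
have Nx : N x = 0 by apply/eqP; rewrite eq_le N0 andbT -Wx le_max lexx orbT.
rewrite indicE memNset /= ?Wx ?ltxx// mul0r !(mulr0, sqrtr0) addr0 sub0r normrN.
by rewrite ler_norml fP// andbT lerNl fN.
Qed.

End gluing.

(** N solves the reflected equation for - f (- x), read from right to left. The radius [T] comes
    from the barrier and does not involve [d]. *)
Lemma approximate_profile : let T := M + 4 * C / k in
  exists W u v, [/\ profile setT W u v,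
    forall x, T <= `|x| -> [/\ W x = 0, u x = 0 & v x = 0]
  & \forall x \ae mu, `|u x + k^-1 * v x - f x| <= d].
Proof.
move=> T; have MT : M <= T by rewrite lerDl divr_ge0 ?mulr_ge0// ltW.
have fout z : z <= - M \/ M <= z -> f z = 0.
  move=> H; apply: fM; case: H => H; last exact: le_trans (ler_norm _).
  by rewrite -normrN; apply: le_trans (ler_norm _); rewrite lerNr.
have [|||P [cP P0 PT dP aP]] := @reflected_ode R f k d M C (- M) cf k0 d0 C0.
- by move=> z; apply: le_trans (fC z); exact: ler_norm.
- by move=> z zM; rewrite fout//; left.
- by move=> z zM; rewrite fout//; right.
have cf' : continuous (fun z => - f (- z)).
  by move=> z; apply: continuousN; exact: (continuous_reflect cf).
have [|||N' [cN' N0' NT' dN' aN']] := @reflected_ode R _ k d M C (- M) cf' k0 d0 C0.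
- by move=> z; apply: le_trans (fC (- z)); rewrite -normrN; exact: ler_norm.
- by move=> z zM; rewrite fout ?oppr0//; right; rewrite lerNr.
- by move=> z zM; rewrite fout ?oppr0//; left; rewrite lerN2.
pose N z := N' (- z).
have cN : continuous N by exact: continuous_reflect.
have N0 z : 0 <= N z by exact: N0'.
have dN x y : x <= y -> (forall z, x <= z <= y -> 0 < N z) ->
    N y - N x = itg (fun z => k * (f z + beta (N z))) x y.
  move=> xy pos; have := dN' (- y) (- x); rewrite lerN2 => /(_ xy) H.
  have {}H : N x - N y = itg (fun z => k * (- f (- z) - soft_root d (N' z))) (- y) (- x).
    apply: H => z /andP[yz zx]; rewrite -[z]opprK; apply: pos.
    by rewrite lerNr zx lerNl.
  have crhs : continuous (fun z => k * (- f (- z) - soft_root d (N' z))).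
    move=> z; apply: cvgM; first exact: cvg_cst.
    by apply: cvgB; [exact: cf'|apply: continuous_comp; [exact: cN'|exact: soft_root_continuous]].
  rewrite -opprB H -itg_opp// -mulN1r -itgZ; last exact/continuous_loc_int/(continuous_reflect crhs).
  by apply: eq_itg => z _; rewrite opprK /beta /N; ring.
do 3 eexists; split; first exact: (glued_profile cP cN P0 dP dN).
- move=> x Tx; have [Px Nx] : P x = 0 /\ N x = 0.
    have [x0|/ltW x0] := leP 0 x.
      rewrite ger0_norm// in Tx; split; [by apply: PT; right|apply: NT'; left].
      by rewrite lerN2 (le_trans MT).
    rewrite ler0_norm// in Tx; split; [apply: PT; left|by apply: NT'; right].
    by rewrite lerNr (le_trans MT).
  rewrite Px Nx maxxx indicE memNset /= ?maxxx ?Px ?Nx ?maxxx ?ltxx//.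
  by rewrite mulr0 sqrtr0 mulr0 mul0r.
apply: (ae_app aP); apply: ae_mono (ae_opp aN') => x H1 H2.
apply: (glued_residual P0 N0 H2) => Nx.
by have := H1 Nx; rewrite opprK.
Qed.

End approximate_profiles.

(** * Density and the Burgers operator *)

Section L1_density.
Context {R : realType}.
Local Notation mu := (@lebesgue_measure R).
Local Notation TR := (measurableTypeR R).
Implicit Types (f g u v w W : R -> R) (x y z T : R) (F U V : L1 R).

Lemma L1_dist_support U V f g T : loc_int f -> loc_int g ->
  (U : R -> R) = f %[ae mu] -> (V : R -> R) = g %[ae mu] ->
  (forall x, T <= `|x| -> f x = 0 /\ g x = 0) ->
  `|U - V| = itg (fun x => `|f x - g x|) (- T) T.
Proof.
move=> iF ig Uf Vg fg0.
have iw : loc_int (fun x => `|f x - g x|) by apply: loc_int_norm; exact: loc_intB.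
have [|_ <-] := @loc_int_support R _ (- T) T iw.
  move=> z; rewrite -ler_norml -ltNge => /ltW/fg0[-> ->].
  by rewrite subrr normr0.
rewrite L1_dist /Rintegral; congr fine; apply: ae_eq_integral => //.
- apply/measurable_EFinP; apply: measurableT_comp => //.
  by apply: measurable_funB; exact: measurable_L1.
- apply/measurable_EFinP; exact: iw.1.
- by apply: (ae_app Uf); apply: ae_mono Vg => x Vx Ux xT; rewrite Ux// Vx.
Qed.

Lemma le_ae_itg w c x y : loc_int w -> x <= y -> (\forall z \ae mu, w z <= c) ->
  itg w x y <= c * (y - x).
Proof.
move=> iw xy wc; rewrite -itg_cst//.
have im : loc_int (fun z => Num.min (w z) c).
  apply: (loc_int_between _ (g := w) (h := fun z => - (`|w z| + `|c|))) => //.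
  - by apply: measurable_minr => //; exact: iw.1.
  - have := loc_intB (loc_int_cst 0) (loc_intD (loc_int_norm iw) (loc_int_cst `|c|)).
    by under eq_fun do rewrite sub0r.
  move=> z; rewrite ge_min lexx andbT le_min; apply/andP; split.
    by have := lerNnormlW (lexx `|w z|); have := normr_ge0 c; lra.
  by have := lerNnormlW (lexx `|c|); have := normr_ge0 (w z); lra.
rewrite (@ae_eq_itg R w (fun z => Num.min (w z) c))//.
  apply: le_itg => //; first exact: loc_int_cst.
  by move=> z _; rewrite ge_min lexx orbT.
by apply: ae_mono wc => z wz _; rewrite min_l.
Qed.

(** Continuous functions that approach the indicator of |x| < T from inside, so that they vanish at
    both ends. *)
Definition cutoff T (n : nat) x : R := Num.min 1 (Num.max 0 (n%:R * (T - `|x|))).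

Lemma cutoff_continuous T n : continuous (cutoff T n).
Proof.
move=> x; apply: (@continuous_min _ _ (cst 1) (fun y => Num.max 0 (n%:R * (T - `|y|)))).
  exact: cvg_cst.
apply: (@continuous_max _ _ (cst 0) (fun y => n%:R * (T - `|y|))); first exact: cvg_cst.
apply: cvgM; first exact: cvg_cst.
by apply: cvgB; [exact: cvg_cst|exact: norm_continuous].
Qed.

Lemma cutoff_norm T n x : `|cutoff T n x| <= 1.
Proof.
have c0 : 0 <= cutoff T n x by rewrite le_min ler01 le_max lexx.
by rewrite ger0_norm// ge_min lexx.
Qed.

Lemma cutoff_out T n x : T <= `|x| -> cutoff T n x = 0.
Proof.
move=> Tx; rewrite /cutoff max_l; first by rewrite min_r.
by rewrite mulr_ge0_le0// subr_le0.
Qed.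

Lemma cutoff_cvg T x : cutoff T n x @[n --> \oo] --> ((`|x| < T)%R%:R : R).
Proof.
case: ltP => [xT|Tx]; last first.
  by apply: cvg_near_cst; apply: nearW => n; exact: cutoff_out.
apply: cvg_near_cst; near=> n.
have d0 : 0 < T - `|x| by rewrite subr_gt0.
have : (T - `|x|)^-1 <= n%:R by near: n; exact: nbhs_infty_ger.
rewrite -[_^-1]mul1r ler_pdivrMr// => H.
by rewrite /cutoff min_l// le_max H orbT.
Unshelve. all: by end_near. Qed.

(** F is truncated to [- T, T], approximated there by a continuous g, and g is multiplied by a
    cutoff. Quantifying over all classes of f leaves their choice to later uses. *)
Lemma compact_support_dense F (e : R) : 0 < e -> exists f T, [/\ 0 <= T,
  continuous f, forall x, T <= `|x| -> f x = 0
  & forall U, (U : R -> R) = f %[ae mu] -> `|F - U| < e].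
Proof.
move=> e0; have e2 : 0 < e / 2 by rewrite divr_gt0.
have iF := integrable_L1 F; have lF := integrable_loc_int iF.
have iaF : mu.-integrable setT (EFin \o (fun x => `|F x|)).
  exact: integrable_abse iF.
have cF := @itg_cvg R _ (fun n => - n%:R) (fun n => n%:R) iaF (fun _ => lexx _) (fun _ => lexx _).
have [n /= Hn] : exists n : nat,
    `|\int[mu]_x `|F x| - itg (fun x => `|F x|) (- n%:R) n%:R| < e / 2.
  by have /cvgrPdist_lt/(_ _ e2)[n _ H] := cF; exists n; exact: (H n (leqnn n)).
pose T : R := n%:R; have T0 : 0 <= T by exact: ler0n.
pose F1 x := \1_(`[- T, T]%classic : set TR) x * F x.
have lF1 : loc_int F1 by apply: loc_int_indic => //; exact: measurable_itv.
have F1E x : `|x| <= T -> F1 x = F x.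
  by move=> xT; rewrite /F1 indicE mem_set ?mul1r//= in_itv/= -ler_norml.
have F10 x : T < `|x| -> F1 x = 0.
  by move=> xT; rewrite /F1 indicE memNset ?mul0r//= in_itv/= -ler_norml leNgt xT.
have out z : ~~ (- T <= z <= T) -> F1 z = 0 by rewrite -ler_norml -ltNge; exact: F10.
have [iF1 _] := loc_int_support lF1 out.
have [U1 U1E] := L1_ex iF1.
have d1 : `|F - U1| < e / 2.
  suff -> : `|F - U1| = \int[mu]_x `|F x| - itg (fun x => `|F x|) (- T) T.
    exact: le_lt_trans (ler_norm _) Hn.
  have [||iaF1 eF1] := @loc_int_support R (fun x => `|F1 x|) (- T) T.
  - exact: loc_int_norm.
  - by move=> z /out ->; rewrite normr0.
  have -> : itg (fun x => `|F x|) (- T) T = itg (fun x => `|F1 x|) (- T) T.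
    by apply: eq_itg => z; rewrite -ler_norml => zT; rewrite F1E.
  rewrite -eF1 -RintegralB// L1_dist /Rintegral; congr fine; apply: ae_eq_integral => //.
  - apply/measurable_EFinP; apply: measurableT_comp => //.
    by apply: measurable_funB; exact: measurable_L1.
  - apply/measurable_EFinP; apply: measurable_funB; last exact: (loc_int_norm lF1).1.
    exact: (loc_int_norm lF).1.
  apply: ae_mono U1E => x U1x xT; rewrite U1x//; congr EFin.
  have [xT'|xT'] := leP `|x| T; first by rewrite F1E// subrr normr0 subrr.
  by rewrite F10// normr0 !subr0.
have [|||g [cg ig gF]] := @approximation_continuous_integrable R `[- T, T] F.
- exact: measurable_itv.
- by apply: compact_finite_measure; exact: segment_compact.
- exact: lF.2.
have [m Hm] : exists m, itg (fun x => `|F x - g m x|) (- T) T < e / 2.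
  have /fine_cvgP[_ /cvgrPdist_lt/(_ _ e2)[m _ H]] := gF.
  exists m; have := H m (leqnn m); rewrite sub0r normrN; apply: le_lt_trans.
  exact: ler_norm.
pose h k x := cutoff T k x * g m x.
have ch k : continuous (h k).
  by move=> x; apply: cvgM; [exact: cutoff_continuous|exact: cg].
have lg : loc_int (g m) by exact: continuous_loc_int.
have lh k : loc_int (h k) by exact: continuous_loc_int.
pose h' x := (`|x| < T)%R%:R * g m x.
have ch' x : h k x @[k --> \oo] --> h' x.
  by apply: cvgM; [exact: cutoff_cvg|exact: cvg_cst].
have lh' : loc_int h'.
  apply: loc_intM => //; last first.
    by move=> x y; exists 1 => z _; case: (_ < _); rewrite ?normr1 ?normr0.
  apply: (@measurable_fun_cvg _ TR R setT (fun k => cutoff T k)) => [k|x _].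
    by apply: continuous_measurable_fun; exact: cutoff_continuous.
  exact: cutoff_cvg.
have cd : itg (fun x => `|F x - h k x|) (- T) T @[k --> \oo] -->
    itg (fun x => `|F x - h' x|) (- T) T.
  apply: (itg_dominated_cvg (g := fun x => `|F x| + `|g m x|)).
  - by move=> k; apply: loc_int_norm; exact: loc_intB.
  - by apply: loc_int_norm; exact: loc_intB.
  - by apply: loc_intD; exact: loc_int_norm.
  - move=> k x; rewrite normr_id; apply: (le_trans (ler_normB _ _)); rewrite lerD2l.
    by rewrite normrM ler_piMl// cutoff_norm.
  - by move=> x; apply: cvg_norm; apply: cvgB; [exact: cvg_cst|exact: ch'].
have E : itg (fun x => `|F x - h' x|) (- T) T = itg (fun x => `|F x - g m x|) (- T) T.
  apply: eq_itg_oo; [by apply: loc_int_norm; exact: loc_intB|by apply: loc_int_norm; exact: loc_intB|].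
  by move=> z; rewrite -ltr_norml /h' => ->; rewrite mul1r.
have [k Hk] : exists k, itg (fun x => `|F x - h k x|) (- T) T < e / 2.
  have gap : 0 < e / 2 - itg (fun x => `|F x - h' x|) (- T) T by rewrite subr_gt0 E.
  have /cvgrPdist_lt/(_ _ gap)[k _ H] := cd; exists k.
  by have := H k (leqnn k) => /=; rewrite distrC => /(le_lt_trans (ler_norm _)); lra.
exists (h k), (T + 1); split => //.
- lra.
- by move=> x Tx; rewrite /h cutoff_out ?mul0r//; lra.
move=> U Uh; have := ler_distD U1 F U.
suff -> : `|U1 - U| = itg (fun x => `|F x - h k x|) (- T) T by lra.
have T1 : - (T + 1) <= - T by lra.
have T2 : - T <= T by lra.
have T3 : T <= T + 1 by lra.
have lw : loc_int (fun x => `|F1 x - h k x|) by apply: loc_int_norm; exact: loc_intB.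
rewrite (L1_dist_support (T := T + 1) lF1 (lh k) U1E Uh); last first.
  by move=> x Tx; rewrite /h cutoff_out ?mul0r ?F10//; lra.
have zero x y : (forall z, x < z < y -> T < `|z|) -> itg (fun x => `|F1 x - h k x|) x y = 0.
  move=> H; have [xy|yx] := leP x y; last first.
    by rewrite /itg set_itv_ge ?Rintegral_set0// bnd_simp -ltNge.
  rewrite (@eq_itg_oo R _ (cst 0))// ?itg_cst ?mul0r//; first exact: loc_int_cst.
  by move=> z /H zT; rewrite F10// /h cutoff_out ?ltW// mul0r subrr normr0.
rewrite (itg_chasles lw T1 (le_trans T2 T3)) (itg_chasles lw T2 T3) (zero _ (- T)) ?(zero T).
- by rewrite add0r addr0; apply: eq_itg => z; rewrite -ler_norml => zT; rewrite F1E.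
- by move=> z /andP[z1 _]; apply: lt_le_trans z1 (ler_norm _).
- by move=> z /andP[_ z2]; rewrite -normrN; apply: lt_le_trans (ler_norm _); rewrite ltrNr.
Qed.

(** The representative of the class U agrees with u only almost everywhere; the exceptional set is
    absorbed by the set [G] of a profile. *)
Lemma profile_burgers0 W u v T : profile setT W u v ->
  (forall x, T <= `|x| -> [/\ W x = 0, u x = 0 & v x = 0]) ->
  exists U V, [/\ burgers0 R (U, V), (U : R -> R) = u %[ae mu],
    (V : R -> R) = v %[ae mu] & loc_int u].
Proof.
move=> p out; have [_ mu_ pW sq sg] := p.
have cW := prim_continuous pW; have lW := continuous_loc_int cW.
have W0 := profile_ge0 p.
have lu : loc_int u.
  (* Local integrability of u comes from |u| <= 1/2 + u^2 / 2. *)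
  apply: (loc_int_between (h := fun x => - 1 * (2^-1 + W x)) mu_ _ (loc_intD (loc_int_cst 2^-1) lW)).
    by apply: loc_intMc; [exact: cst_continuous|exact: (loc_intD (loc_int_cst 2^-1) lW)].
  move=> x; rewrite mulN1r -ler_norml sq// /cst.
  have := sqr_ge0 (`|u x| - 1); rewrite sqrrB1 real_normK ?num_real//; lra.
have out' (w : R -> R) : (forall x, T <= `|x| -> w x = 0) -> forall z, ~~ (- T <= z <= T) -> w z = 0.
  by move=> wT z; rewrite -ler_norml -ltNge => /ltW; exact: wT.
have [iu _] := loc_int_support lu (out' u (fun x H => let: And3 _ h _ := out x H in h)).
have [iv _] := loc_int_support pW.1 (out' v (fun x H => let: And3 _ _ h := out x H in h)).
have [iW _] := loc_int_support lW (out' W (fun x H => let: And3 h _ _ := out x H in h)).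
have [U UE] := L1_ex iu; have [V VE] := L1_ex iv.
exists U, V; split => //.
apply: (@profile_entropy_pair R [set x | U x = u x] W).
  split => /=.
  - by apply: ae_mono UE => x; exact.
  - exact: measurable_L1.
  - have lV := integrable_loc_int (integrable_L1 V); split => // x y xy.
    rewrite pW.2//; apply: ae_eq_itg => //; first exact: pW.1.
    by apply: ae_mono VE => z Vz _; rewrite Vz.
  - by move=> x ->; exact: sq.
  - by move=> x y -> -> xy; exact: sg.
apply/integrableP; split.
  apply/measurable_EFinP; apply: measurable_funM => //.
  by apply: measurable_funX; exact: measurable_L1.
have /integrableP[mW] := iW; apply: le_lt_trans.
rewrite le_eqVlt; apply/orP; left; apply/eqP; apply: ae_eq_integral => //.
- apply: measurableT_comp => //; apply/measurable_EFinP; apply: measurable_funM => //.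
  by apply: measurable_funX; exact: measurable_L1.
- exact: measurableT_comp.
- by apply: ae_mono UE => x Ux xT; rewrite /= Ux// sq.
Qed.

Lemma burgers0_dense_range (l e : R) F : 0 < l -> 0 < e ->
  exists U V, burgers0 R (U, V) /\ `|U + l *: V - F| < e.
Proof.
move=> l0 e0; have e2 : 0 < e / 2 by rewrite divr_gt0.
have [f [M [M0 cf fM Ff]]] := compact_support_dense F e2.
have [C0 fC0] := continuous_loc_bounded cf (- M) M.
pose C : R := `|C0|; have CC : 0 <= C by exact: normr_ge0.
have fC z : `|f z| <= C.
  have [zM|/ltW Mz] := leP `|z| M; last by rewrite fM ?normr0.
  by apply: le_trans (ler_norm _); apply: fC0; rewrite -ler_norml.
have li0 : 0 < l^-1 by rewrite invr_gt0.
pose T := M + 4 * C / l^-1.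
have MT : M <= T by rewrite lerDl divr_ge0 ?mulr_ge0// ltW.
have T0 : 0 <= T by exact: le_trans MT.
(* The residual is at most [d] on [- T, T] and vanishes outside, so its L1 norm is at most 2 T d <=
   e / 4. The choice is legitimate because [T] was fixed without [d]. *)
pose d := e / 4 / (T + T + 1).
have T1 : 0 < T + T + 1 by lra.
have d0 : 0 < d by rewrite !divr_gt0.
have [W [u [v [p out aE]]]] := approximate_profile cf li0 d0 CC fC fM.
have [U [V [UV UE VE lu]]] := profile_burgers0 p out.
have lf : loc_int f by exact: continuous_loc_int.
have [|iF _] := @loc_int_support R f (- M) M lf.
  by move=> z; rewrite -ler_norml -ltNge => /ltW/fM.
have [H HE] := L1_ex iF.
exists U, V; split => //; have := ler_distD H (U + l *: V) F.
have h1 := Ff H HE; rewrite distrC in h1.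
suff h2 : `|U + l *: V - H| <= e / 4 by lra.
have lv : loc_int v by have [_ _ [] ] := p.
have llv : loc_int (fun x => l * v x) by apply: loc_intMc => //; exact: cst_continuous.
have lw : loc_int (fun x => u x + l * v x) by exact: loc_intD.
have UVE : (U + l *: V : R -> R) = (fun x => u x + l * v x) %[ae mu].
  apply: (ae_app UE); apply: (ae_app VE); apply: (ae_app (L1D U (l *: V))).
  by apply: ae_mono (L1Z l V) => x h3 h4 h5 h6 xT; rewrite h4// /= h3// h6// -h5.
rewrite (L1_dist_support (T := T) lw lf UVE HE); last first.
  move=> x Tx; have [_ -> ->] := out x Tx; rewrite mulr0 addr0; split => //.
  by apply: fM; exact: le_trans Tx.
have lwf : loc_int (fun x => `|u x + l * v x - f x|) by apply: loc_int_norm; exact: loc_intB.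
apply: (@le_trans _ _ (d * (T - - T))).
  apply: le_ae_itg => //; first lra.
  by move: aE; rewrite invrK.
rewrite /d opprK mulrAC ler_pdivrMr// ler_wpM2l ?divr_ge0 ?ltW//; lra.
Qed.

End L1_density.

(** * Density of the domain *)

Section burgers_domain.
Context {R : realType}.
Local Notation mu := (@lebesgue_measure R).
Local Notation TR := (measurableTypeR R).
Implicit Types (f g u : R -> R) (x y z T : R) (F U V : L1 R).

Lemma primZ (c : R) f g : prim f g -> prim (fun x => c * f x) (fun x => c * g x).
Proof.
move=> pf; have ic : loc_int (fun x => c * g x).
  by apply: loc_intMc; [exact: cst_continuous|exact: pf.1].
by split => // x y xy; rewrite -mulrBr pf.2// itgZ//; exact: pf.1.
Qed.

(** A continuous u cannot change sign where u^2 / 2 > 0, so the sign condition is automatic. *)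
Lemma profile_C1 u g : prim u g ->
  profile setT (fun x => 2^-1 * (u x * u x)) u (fun x => 2^-1 * (u x * g x + g x * u x)).
Proof.
move=> pu; have cu := prim_continuous pu; split.
- exact: aeW.
- exact: continuous_measurable_fun.
- exact: primZ (primM pu pu).
- by move=> x _; rewrite mulrC expr2.
move=> x y _ _ xy pos uy.
have u0 z : x <= z <= y -> u z != 0.
  by move=> /pos; apply: contraTneq => ->; rewrite !mulr0 ltxx.
by apply: (nonzero_sign cu u0 _ _ uy); rewrite ?lexx (ltW xy).
Qed.

(** The Steklov average of f has the explicit derivative (f (x + h) - f x) / h; it supplies
    absolutely continuous approximations of compact support. *)
Lemma shift_average f T : continuous f -> (forall x, T <= `|x| -> f x = 0) ->
  forall h, 0 < h -> exists g, prim (fun x => h^-1 * itg f x (x + h)) g /\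
    forall x, T + h <= `|x| -> g x = 0 /\ itg f x (x + h) = 0.
Proof.
move=> cf fT h h0; have lf := continuous_loc_int cf.
have [|intf _] := @loc_int_support R f (- T) T lf.
  by move=> z; rewrite -ler_norml -ltNge => /ltW/fT.
pose P x := \int[mu]_(t in `]-oo, x]) f t.
have dP x : is_derive x 1 P (f x).
  have ib : mu.-integrable [set` `]-oo, x + 1]] (EFin \o f).
    by apply: (integrableS _ _ _ intf).
  have x1 : x < x + 1 by rewrite ltrDl.
  have lx : (BInfty R true < BRight x)%E by rewrite ltNyr.
  have [d1 d2] := continuous_FTC1 x1 ib lx (@cf x).
  by apply: DeriveDef => //; rewrite -derive1E.
pose g x := h^-1 * (f (x + h) - f x).
pose Q x := h^-1 * (P (x + h) - P x).
have dQ x : is_derive x 1 Q (g x).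
  have sh : is_derive x 1 (fun x : R => x + h) 1.
    by apply: is_derive_eq; rewrite addr0.
  have dPs : is_derive x 1 (fun x => P (x + h)) (f (x + h)).
    by have := @is_derive1_comp R P (fun x : R => x + h) x _ _ (dP (x + h)) sh; rewrite mulr1.
  by apply: is_derive_eq.
have cfs : continuous (fun x => f (x + h)).
  move=> x; apply: (@continuous_comp _ _ _ (fun x : R => x + h) f); last exact: cf.
  by apply: cvgD; [exact: cvg_id|exact: cvg_cst].
have cg : continuous g.
  by move=> x; apply: cvgM; [exact: cvg_cst|apply: cvgB; [exact: cfs|exact: cf]].
have pP : prim P f by exact: prim_derive.
have QE x : Q x = h^-1 * itg f x (x + h) by rewrite /Q pP.2// lerDl ltW.
have pQ : prim Q g by exact: prim_derive.
exists g; split; first by rewrite (_ : (fun x => _) = Q)//; apply/funext => x.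
move=> x xT; have far z : x <= z <= x + h -> f z = 0.
  move=> /andP[xz zx]; apply: fT; move: xT; have [x0|x0] := leP 0 x.
    by rewrite (ger0_norm x0) (ger0_norm (le_trans x0 xz)); lra.
  rewrite (ltr0_norm x0) => xT; rewrite -normrN; apply: le_trans (ler_norm _); lra.
split; first by rewrite /g !far ?subrr ?mulr0// ?lexx lerDl ltW.
by rewrite (@eq_itg _ _ (cst 0))// itg_cst ?mul0r// lerDl ltW.
Qed.

Lemma shift_average_cvg f x : continuous f ->
  n.+1%:R^-1^-1 * itg f x (x + n.+1%:R^-1) @[n --> \oo] --> f x.
Proof.
move=> cf; have lf := continuous_loc_int cf; apply/cvgrPdist_le => e e0.
have /cvgrPdist_le/(_ _ e0)/nbhs_ballP[d /= d0 H] := @cf x.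
near=> n; have hd : n.+1%:R^-1 < d by near: n; exact: near_infty_natSinv_lt (PosNum d0).
set h : R := n.+1%:R^-1 in hd *; have h0 : 0 < h by rewrite invr_gt0.
have -> : f x - h^-1 * itg f x (x + h) = h^-1 * itg (fun z => f x - f z) x (x + h).
  rewrite (itgB _ _ (loc_int_cst (f x)) lf) itg_cst ?lerDl ?(ltW h0)//.
  by field; rewrite gt_eqF.
have lw : loc_int (fun z => f x - f z) by apply: loc_intB => //; exact: loc_int_cst.
rewrite normrM gtr0_norm ?invr_gt0// ler_pdivrMl//.
apply: (le_trans (le_norm_itg _ _ lw)).
have -> : h * e = itg (cst e) x (x + h) by rewrite itg_cst ?lerDl ?(ltW h0)//; ring.
apply: le_itg; [exact: loc_int_norm|exact: loc_int_cst|move=> z /andP[xz zx]].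
by apply: H; rewrite /ball/= distrC ger0_norm ?subr_ge0//; lra.
Unshelve. all: by end_near. Qed.

Lemma burgers0_dense_domain F (e : R) : 0 < e ->
  exists U V, burgers0 R (U, V) /\ `|F - U| < e.
Proof.
move=> e0; have e2 : 0 < e / 2 by rewrite divr_gt0.
have [f [T [T0 cf fT Ff]]] := compact_support_dense F e2.
have lf := continuous_loc_int cf.
have [|intf _] := @loc_int_support R f (- T) T lf.
  by move=> z; rewrite -ler_norml -ltNge => /ltW/fT.
have [H HE] := L1_ex intf.
have [C0 fC0] := continuous_loc_bounded cf (- T) T.
pose C : R := `|C0|; have CC : 0 <= C by exact: normr_ge0.
have fC z : `|f z| <= C.
  have [zM|/ltW Mz] := leP `|z| T; last by rewrite fT ?normr0.
  by apply: le_trans (ler_norm _); apply: fC0; rewrite -ler_norml.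
pose h n : R := n.+1%:R^-1.
have h0 n : 0 < h n by rewrite invr_gt0.
(* Widths of at most 1 keep all averages supported in [- (T + 1), T + 1]. *)
have h1 n : h n <= 1 by rewrite invf_le1// ler1n.
pose u n x := (h n)^-1 * itg f x (x + h n).
have uC n x : `|u n x| <= C.
  rewrite /u normrM gtr0_norm ?invr_gt0// ler_pdivrMl//.
  apply: (le_trans (le_norm_itg _ _ lf)).
  have -> : h n * C = itg (cst C) x (x + h n) by rewrite itg_cst ?lerDl ?(ltW (h0 n))//; ring.
  by apply: le_itg; [exact: loc_int_norm|exact: loc_int_cst|move=> z _; exact: fC].
have lu n : loc_int (u n).
  by have [g [pu _]] := shift_average cf fT (h0 n); exact/continuous_loc_int/(prim_continuous pu).
have cd : itg (fun x => `|f x - u n x|) (- (T + 1)) (T + 1) @[n --> \oo] -->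
    itg (cst 0) (- (T + 1)) (T + 1).
  apply: (itg_dominated_cvg (g := cst (C + C))).
  - by move=> n; apply: loc_int_norm; exact: loc_intB.
  - exact: loc_int_cst.
  - exact: loc_int_cst.
  - by move=> n x; rewrite normr_id; apply: (le_trans (ler_normB _ _)); rewrite lerD.
  - move=> x; rewrite /cst -[X in _ --> X](normr0 R) -(subrr (f x)); apply: cvg_norm.
    by apply: cvgB; [exact: cvg_cst|exact: shift_average_cvg].
rewrite itg_cst in cd; last lra.
have [n Hn] : exists n, itg (fun x => `|f x - u n x|) (- (T + 1)) (T + 1) < e / 2.
  have /cvgrPdist_lt/(_ _ e2)[n _ K] := cd; exists n.
  by have := K n (leqnn n); rewrite /= mul0r sub0r normrN => /(le_lt_trans (ler_norm _)).
have [g [pu out]] := shift_average cf fT (h0 n).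
have [|U [V [UV UE _ _]]] := profile_burgers0 (T := T + 1) (profile_C1 pu).
  move=> x xT; have [|-> ->] := out x; first by apply: le_trans xT; rewrite lerD2l.
  by rewrite !(mulr0, mul0r, addr0).
exists U, V; split => //; have := Ff H HE; have := ler_distD H F U.
suff -> : `|H - U| = itg (fun x => `|f x - u n x|) (- (T + 1)) (T + 1) by lra.
apply: L1_dist_support => // x xT; split; first by apply: fT; lra.
by have [|_] := out x; [apply: le_trans xT; rewrite lerD2l|rewrite /u => ->; rewrite mulr0].
Qed.

End burgers_domain.

(** * Closures of accretive operators *)

Section closure_of_operators.
Context {R : realType} {V : normedModType R}.
Implicit Types (G : set (V * V)) (u v : V).

Lemma closure_pairP G u v : closure G (u, v) <->
  forall e : R, 0 < e -> exists u' v', [/\ G (u', v'), `|u - u'| < e & `|v - v'| < e].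
Proof.
split=> [cG e e0|H B].
  have [|[u' v'] [Guv [/= h1 h2]]] := cG (ball (u, v) e); first exact: nbhsx_ballx.
  by exists u', v'; split => //; rewrite -ball_normE in h1 h2.
move=> /nbhs_ballP[e /= e0 eB]; have [u' [v' [Guv h1 h2]]] := H e e0.
by exists (u', v'); split => //; apply: eB; split; rewrite -ball_normE.
Qed.

Lemma closure_accretive G : accretive G -> accretive (closure G).
Proof.
move=> aG u1 v1 u2 v2 /closure_pairP c1 /closure_pairP c2 l l0.
apply/ler_addgt0Pr => e e0.
(* Replacing the pairs costs 2 d on the left and 2 d + 2 l d on the right, in total [e]. *)
pose d := e / (4 + 2 * l); have l4 : 0 < 4 + 2 * l by lra.
have d0 : 0 < d by rewrite divr_gt0.
have [x1 [y1 [G1 ux1 vy1]]] := c1 d d0; have [x2 [y2 [G2 ux2 vy2]]] := c2 d d0.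
have H := aG _ _ _ _ G1 G2 l l0.
have dE : d * (4 + 2 * l) = e by rewrite divfK ?gt_eqF.
have four (a b a' b' : V) : `|a - a'| < d -> `|b - b'| < d -> `|a - b - (a' - b')| <= d + d.
  move=> ha hb; rewrite opprD addrACA; apply: (le_trans (ler_normD _ _)).
  by rewrite -opprD normrN lerD// ltW.
have h1 := four _ _ _ _ ux1 ux2; have h3 := four _ _ _ _ vy1 vy2.
have h2 : `|x1 - x2 + l *: (y1 - y2) - (u1 - u2 + l *: (v1 - v2))| <= d + d + l * (d + d).
  rewrite opprD addrACA -scalerBr; apply: (le_trans (ler_normD _ _)).
  by rewrite distrC lerD// normrZ gtr0_norm// ler_pM2l// distrC.
have := ler_normD (u1 - u2 - (x1 - x2)) (x1 - x2); rewrite subrK.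
have := ler_normD (x1 - x2 + l *: (y1 - y2) - (u1 - u2 + l *: (v1 - v2))) (u1 - u2 + l *: (v1 - v2)).
rewrite subrK; lra.
Qed.

End closure_of_operators.

(** Accretivity bounds the distance of the first components of two approximate solutions by that of
    their right-hand sides, so they form a Cauchy sequence. The second components are recovered from
    the equation and converge too. *)
Lemma closure_range (R : realType) (V : completeNormedModType R) (G : set (V * V)) (l : R) :
  accretive G -> 0 < l ->
  (forall (f : V) (e : R), 0 < e -> exists u v, G (u, v) /\ `|u + l *: v - f| < e) ->
  forall f, exists u v, closure G (u, v) /\ u + l *: v = f.
Proof.
move=> aG l0 dense f.
have r0 n : 0 < (n.+1%:R^-1 : R) by rewrite invr_gt0.
pose p n : V * V := xget (0, 0) [set uv | G uv /\ `|uv.1 + l *: uv.2 - f| < n.+1%:R^-1].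
have pP n : G (p n) /\ `|(p n).1 + l *: (p n).2 - f| < n.+1%:R^-1.
  have [u [v H]] := dense f _ (r0 n).
  by have := @xgetI _ (0, 0) [set uv | G uv /\ `|uv.1 + l *: uv.2 - f| < n.+1%:R^-1] (u, v) H.
have pG n : G ((p n).1, (p n).2) by rewrite -surjective_pairing; exact: (pP n).1.
pose fn n := (p n).1 + l *: (p n).2.
have cf : fn @ \oo --> f.
  apply/cvgrPdist_lt => e e0; near=> n; rewrite distrC; apply: (lt_trans (pP n).2).
  by near: n; exact: near_infty_natSinv_lt (PosNum e0).
have near_f e : 0 < e -> \forall n \near \oo, `|f - fn n| < e.
  by move=> e0; have /cvgrPdist_lt/(_ _ e0) := cf.
have /cvg_ex[u cu] : cvgn (fun n => (p n).1).
  apply/cauchy_cvgP/cauchyP => e e0; have e2 : 0 < e / 2 by rewrite divr_gt0.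
  have [n _ Hn] := near_f _ e2.
  exists (p n).1; exists n => // m nm; rewrite -ball_normE /=.
  have := aG _ _ _ _ (pG n) (pG m) l l0; move=> /le_lt_trans; apply.
  have -> : (p n).1 - (p m).1 + l *: ((p n).2 - (p m).2) = fn n - fn m.
    by rewrite /fn scalerBr opprD addrACA.
  have := ler_distD f (fn n) (fn m); rewrite distrC.
  by have := Hn n (leqnn n); have := Hn m nm; rewrite /= (distrC f (fn n)); lra.
have pE n : (p n).2 = l^-1 *: (fn n - (p n).1).
  by rewrite /fn addrAC subrr add0r scalerA mulVf ?scale1r ?gt_eqF.
exists u, (l^-1 *: (f - u)); split; last first.
  by rewrite scalerA divff ?gt_eqF// scale1r addrC subrK.
have cv : (fun n => (p n).2) @ \oo --> l^-1 *: (f - u).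
  under eq_fun do rewrite pE.
  by apply: cvgZr; exact: cvgB.
apply/closure_pairP => e e0; near \oo => n; exists (p n).1, (p n).2; split.
- exact: pG.
- by near: n; move/cvgrPdist_lt : cu => /(_ _ e0).
- by near: n; move/cvgrPdist_lt : cv => /(_ _ e0).
Unshelve. all: by end_near. Qed.

(** * The operator [A] and the Cauchy problem *)

Section burgers_operator.
Context {R : realType}.

Lemma burgers_accretive : accretive (burgers R).
Proof.
apply: closure_accretive => u1 v1 u2 v2 e1 e2 l l0.
have [G1 [W1 p1]] := entropy_pair_profile e1.
have [G2 [W2 p2]] := entropy_pair_profile e2.
exact: (profile_dist p1 p2 e1.1 e2.1 l0).
Qed.

Lemma burgers_range (l : R) : 0 < l ->
  forall f, exists u v, burgers R (u, v) /\ u + l *: v = f.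
Proof.
move=> l0; apply: closure_range => //.
  by move=> u1 v1 u2 v2 H1 H2; apply: burgers_accretive; exact: subset_closure.
by move=> f e e0; exact: burgers0_dense_range.
Qed.

Lemma burgers_domain : closure (op_dom (burgers R)) = setT.
Proof.
apply/seteqP; split => // F _ B /nbhs_ballP[e /= e0 eB].
have [U [V [UV FU]]] := burgers0_dense_domain F e0.
exists U; split; last by apply: eB; rewrite -ball_normE.
by exists V; exact: subset_closure.
Qed.

End burgers_operator.

Theorem theorem4p4 (R : realType) (u0 : L1 R) :
  exists u : R -> L1 R,
    [/\ {within `[0, +oo[, continuous u},
        mild_solution (fornberg_whitham R) u0 u
      & forall v : R -> L1 R, mild_solution (fornberg_whitham R) u0 v ->
          forall t : R, 0 <= t -> v t = u t].
Proof.
(* 2 is the Lipschitz constant of the convolution operator in [conv_dK_lipschitz]. *)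
have L0 : (0 : R) < 2 by [].
have acc := @burgers_accretive R; have ran := @burgers_range R.
have qm := perturbation_quasi_m_accretive L0 acc ran (@conv_dK_lipschitz R).
have [S [semi gen]] := perturbation_generates L0 acc ran (@conv_dK_lipschitz R) burgers_domain.
exists (fun t => S t u0); split; first by have [_ _] := semi; exact.
  by split => //; exists S.
move=> v [_ [S' [semi' gen' vS']]] t t0; rewrite vS'//.
apply: (generates_unique _ semi' semi gen' gen) => //.
apply/seteqP; split => // x _; have : closure (op_dom (burgers R)) x by rewrite burgers_domain.
by apply: closure_subset; exact: op_dom_perturbation.
Qed.
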